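(* There is an efficient (polynomial-time, randomized) algorithm that, for every instance of FZA, computes a set $F\subseteq E$ whose expected revenue is at least $\mathrm{OPT}/\mathcal{O}\!\left(\frac{\log n}{\log\log n}\right)$, where $\mathrm{OPT}$ is the optimal revenue; i.e., an $\mathcal{O}(\log n/\log\log n)$-approximation for FZA in expectation.
   Context: Fare Zone Assignment (FZA): given a tree $T=(V,E)$ with $n=|V|$, a non-decreasing concave function $f\colon\mathbb{N}_0\to\mathbb{R}_{\ge 0}$, and commodities $i\in[k]$, each given by a path $P_i\subseteq E$, a bound $u_i\in\mathbb{N}_0$ and a weight $w_i\in\mathbb{N}$, find $F\subseteq E$ maximizing $\sum_{i\in[k]}\mathrm{rev}_i(F)$, where $\mathrm{rev}_i(F)=w_i f(|P_i\cap F|)$ if $|P_i\cap F|\le u_i$ and $0$ otherwise. *)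

(* Defs.v *)
From HB Require Import structures.
From mathcomp Require Import all_boot all_order all_algebra.
From mathcomp Require Import all_classical all_reals all_analysis.

Set Implicit Arguments.
Unset Strict Implicit.
Unset Printing Implicit Defensive.

Import Order.TTheory GRing.Theory Num.Theory.
Import numFieldNormedType.Exports.

Local Open Scope nat_scope.

(** * Fare Zone Assignment *)

Section Graphs.
Variable V : finType.
Implicit Types (e : rel V) (x : V) (p : seq V).

(* For a simple graph, a cycle is a duplicate-free closed walk visiting at
   least three vertices; shorter ones do not count (a 2-cycle is one edge). *)
Definition is_tree e : Prop :=
  [/\ symmetric e, irreflexive e, 0 < #|V|, (forall x y, connect e x y)
    & forall c : seq V, 2 < size c -> ~~ (cycle e c && uniq c)].

Definition edge_set e : {set {set V}} :=
  [set [set xy.1; xy.2] | xy : V * V & e xy.1 xy.2].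

Definition walk_edges x p : {set {set V}} :=
  [set [set xy.1; xy.2] | xy in zip (x :: p) p].

Definition is_path_edges e (P : {set {set V}}) : Prop :=
  exists x p, [/\ path e x p, uniq (x :: p) & P = walk_edges x p].

End Graphs.

Record fza (R : realType) := FZA {
  fza_n : nat;
  fza_adj : rel 'I_fza_n;
  fza_tree : is_tree fza_adj;
  fza_f : nat -> R;
  fza_f_ge0 : forall j, (0 <= fza_f j)%R;
  fza_f_nondecreasing : forall i j, i <= j -> (fza_f i <= fza_f j)%R;
  fza_f_concave : forall j,
    (fza_f j.+2 - fza_f j.+1 <= fza_f j.+1 - fza_f j)%R;
  fza_k : nat;
  fza_P : 'I_fza_k -> {set {set 'I_fza_n}};
  fza_P_path : forall i, is_path_edges fza_adj (fza_P i);
  fza_u : 'I_fza_k -> nat;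
  fza_w : 'I_fza_k -> nat;
  fza_w_gt0 : forall i, 0 < fza_w i
}.

Section Revenue.
Variables (R : realType) (I : fza R).
Local Open Scope ring_scope.

Definition fza_E : {set {set 'I_(fza_n I)}} := edge_set (@fza_adj _ I).

Definition fza_rev (i : 'I_(fza_k I)) (F : {set {set 'I_(fza_n I)}}) : R :=
  let c := #|fza_P i :&: F| in
  if (c <= fza_u i)%N then (fza_w i)%:R * fza_f I c else 0.

Definition revenue (F : {set {set 'I_(fza_n I)}}) : R := \sum_i fza_rev i F.

(* The default value 0 is harmless: revenues are nonnegative and the empty set
   is feasible. *)
Definition opt : R :=
  \big[Num.max/0]_(F : {set {set 'I_(fza_n I)}} | F \subset fza_E) revenue F.

End Revenue.

(** * Randomized programs with access to a real-valued oracle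

   A program is a finite piece of syntax, hence uniform over all instances.
   Natural numbers are charged logarithmic cost. Real numbers are opaque: they
   come only from oracle answers, are combined only by addition, subtraction and
   multiplication by a natural number (charged its bit length), and influence
   the control flow only through comparisons. Thus, when the oracle answers are
   rationals of polynomial bit length, a run of polynomial cost manipulates only
   rationals of polynomial bit length, and polynomial cost here is polynomial
   time on a probabilistic Turing machine. *)

Inductive aexp :=
| ANat of nat
| AGet of nat & aexp
| AAdd of aexp & aexp
| ASub of aexp & aexp
| AMul of aexp & aexp
| ADiv of aexp & aexp
| AMod of aexp & aexp.

Inductive rexp :=
| RGet of nat & aexp
| ROracle of aexp
| RAdd of rexp & rexp
| RSub of rexp & rexp
| RScale of aexp & rexp.

Inductive bexp :=
| BLeN of aexp & aexp
| BLeR of rexp & rexp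
| BNot of bexp
| BAnd of bexp & bexp.

Inductive cmd :=
| CSkip
| CSetN of nat & aexp & aexp
| CSetR of nat & aexp & rexp
| CFlip of nat & aexp
| CSeq of cmd & cmd
| CIf of bexp & cmd & cmd
| CWhile of bexp & cmd.

Definition bitlen (m : nat) : nat := (trunc_log 2 m).+1.

(* A memory is a family of unbounded arrays: [M A j] is cell [j] of array [A].
   Array names are constants of the program text, so a program uses only
   finitely many arrays. *)
Definition memory (T : Type) := nat -> nat -> T.

Definition upd T (M : memory T) (A j : nat) (v : T) : memory T :=
  fun B i => if (B == A) && (i == j) then v else M B i.

Record state (R : realType) := State {
  nmem : memory nat;
  rmem : memory R;
  coins : seq bool
}.

Section Semantics.
Variables (R : realType) (f : nat -> R).
Implicit Types (s : state R).

Fixpoint aval s (a : aexp) : nat :=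
  match a with
  | ANat m => m
  | AGet A a1 => nmem s A (aval s a1)
  | AAdd a1 a2 => aval s a1 + aval s a2
  | ASub a1 a2 => aval s a1 - aval s a2
  | AMul a1 a2 => aval s a1 * aval s a2
  | ADiv a1 a2 => aval s a1 %/ aval s a2
  | AMod a1 a2 => aval s a1 %% aval s a2
  end.

Fixpoint acost s (a : aexp) : nat :=
  bitlen (aval s a) +
  match a with
  | ANat _ => 0
  | AGet _ a1 => acost s a1
  | AAdd a1 a2 | ASub a1 a2 | AMul a1 a2 | ADiv a1 a2 | AMod a1 a2 =>
      acost s a1 + acost s a2
  end.

Fixpoint rval s (r : rexp) : R :=
  match r with
  | RGet A a => rmem s A (aval s a)
  | ROracle a => f (aval s a)
  | RAdd r1 r2 => (rval s r1 + rval s r2)%R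
  | RSub r1 r2 => (rval s r1 - rval s r2)%R
  | RScale a r1 => ((aval s a)%:R * rval s r1)%R
  end.

Fixpoint rcost s (r : rexp) : nat :=
  1 +
  match r with
  | RGet _ a | ROracle a => acost s a
  | RAdd r1 r2 | RSub r1 r2 => rcost s r1 + rcost s r2
  | RScale a r1 => acost s a + rcost s r1
  end.

Fixpoint bval s (b : bexp) : bool :=
  match b with
  | BLeN a1 a2 => aval s a1 <= aval s a2
  | BLeR r1 r2 => (rval s r1 <= rval s r2)%R
  | BNot b1 => ~~ bval s b1
  | BAnd b1 b2 => bval s b1 && bval s b2
  end.

Fixpoint bcost s (b : bexp) : nat :=
  1 +
  match b with
  | BLeN a1 a2 => acost s a1 + acost s a2
  | BLeR r1 r2 => rcost s r1 + rcost s r2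
  | BNot b1 => bcost s b1
  | BAnd b1 b2 => bcost s b1 + bcost s b2
  end.

(* [exec c s t s']: started in [s], the program [c] halts in [s'] at cost [t].
   Each coin flip consumes one bit of the random tape [coins]; there is no
   transition when the tape is exhausted. *)
Inductive exec : cmd -> state R -> nat -> state R -> Prop :=
| ExecSkip s : exec CSkip s 1 s
| ExecSetN A a v s :
    exec (CSetN A a v) s (1 + acost s a + acost s v)
      (State (upd (nmem s) A (aval s a) (aval s v)) (rmem s) (coins s))
| ExecSetR A a v s :
    exec (CSetR A a v) s (1 + acost s a + rcost s v)
      (State (nmem s) (upd (rmem s) A (aval s a) (rval s v)) (coins s))
| ExecFlip A a s (b : bool) r : coins s = b :: r ->
    exec (CFlip A a) s (1 + acost s a)
      (State (upd (nmem s) A (aval s a) (nat_of_bool b)) (rmem s) r)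
| ExecSeq c1 c2 s t1 s1 t2 s2 :
    exec c1 s t1 s1 -> exec c2 s1 t2 s2 ->
    exec (CSeq c1 c2) s (1 + t1 + t2) s2
| ExecIf b c1 c2 s t s' :
    exec (if bval s b then c1 else c2) s t s' ->
    exec (CIf b c1 c2) s (1 + bcost s b + t) s'
| ExecWhileF b c s : ~~ bval s b ->
    exec (CWhile b c) s (1 + bcost s b) s
| ExecWhileT b c s t1 s1 t2 s2 : bval s b ->
    exec c s t1 s1 -> exec (CWhile b c) s1 t2 s2 ->
    exec (CWhile b c) s (1 + bcost s b + t1 + t2) s2.

Lemma exec_det c s t1 s1 t2 s2 :
  exec c s t1 s1 -> exec c s t2 s2 -> t1 = t2 /\ s1 = s2.
Proof.
move=> H; elim: H t2 s2 => {c s t1 s1}.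
- by move=> s t2 s2 H; inversion H.
- by move=> A a v s t2 s2 H; inversion H.
- by move=> A a v s t2 s2 H; inversion H.
- move=> A a s b r E t2 s2 H; inversion H as [| | |A' a' s' b' r' E'| | | |].
  by move: E'; rewrite E => -[-> ->].
- move=> c1 c2 s u1 s1 u2 s2 _ IH1 _ IH2 t s' H.
  inversion H as [| | | |? ? ? v1 s3 v2 s4 H1 H2| | |].
  by have [? ?] := IH1 _ _ H1; subst; have [-> ->] := IH2 _ _ H2.
- move=> b c1 c2 s t s' _ IH t2 s2 H.
  inversion H as [| | | | |? ? ? ? ? ? H1| |].
  by have [-> ->] := IH _ _ H1.
- move=> b c s Hb t2 s2 H.
  inversion H as [| | | | | | |? ? ? ? ? ? ? Hb']; first by [].
  by rewrite Hb' in Hb.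
- move=> b c s u1 s1 u2 s2 Hb _ IH1 _ IH2 t s' H.
  inversion H as [| | | | | |? ? ? Hb'|? ? ? v1 s3 v2 s4 Hb' H1 H2].
    by subst; case/negP: Hb'.
  by have [? ?] := IH1 _ _ H1; subst; have [-> ->] := IH2 _ _ H2.
Qed.

End Semantics.

(** * Instances as program inputs, and program outputs *)

Section InputOutput.
Variables (R : realType) (I : fza R).
Local Notation n := (fza_n I).
Local Notation k := (fza_k I).

(* Array 0 holds [n] and [k]; array 1 the adjacency matrix, row by row; array 2
   the [k] adjacency matrices of the paths, one after the other; arrays 3 and 4
   the bounds and the weights. All other cells are 0. The function [f] is not
   part of the memory; it is the oracle. *)
Definition input_nmem : memory nat := fun A j =>
  match A with
  | 0 => match j with 0 => n | 1 => k | _ => 0 end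
  | 1 => [exists x : 'I_n, exists y : 'I_n,
           (j == x * n + y) && fza_adj x y]
  | 2 => [exists i : 'I_k, exists x : 'I_n, exists y : 'I_n,
           (j == (i * n + x) * n + y) && ([set x; y] \in fza_P i)]
  | 3 => if @insub _ _ 'I_k j is Some i then fza_u i else 0
  | 4 => if @insub _ _ 'I_k j is Some i then fza_w i else 0
  | _ => 0
  end.

Definition init_state (r : seq bool) : state R :=
  State input_nmem (fun _ _ => 0%R) r.

Definition input_size : nat :=
  n ^ 2 * k.+1 + \sum_(i < k) (bitlen (fza_u i) + bitlen (fza_w i)).

(* The output is read off array 5 as a matrix of marked vertex pairs. *)
Definition output_set (s : state R) : {set {set 'I_n}} :=
  [set [set xy.1; xy.2] | xy : 'I_n * 'I_n & nmem s 5 (xy.1 * n + xy.2) != 0].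

(* On every random tape of length [T], [c] halts within cost [T] (so that the
   tape is long enough) with output [F r]. By [exec_det], [F] is determined by
   [c], [I] and [T]. *)
Definition computes_within (c : cmd) (T : nat)
    (F : T.-tuple bool -> {set {set 'I_n}}) : Prop :=
  forall r : T.-tuple bool, exists t s,
    [/\ exec (fza_f I) c (init_state r) t s, t <= T & output_set s = F r].

End InputOutput.

Definition coin_expectation (R : realType) (T : nat) (X : T.-tuple bool -> R) : R :=
  ((\sum_(r : T.-tuple bool) X r) / 2 ^+ T)%R.

(* Main.v *)
Require Import Defs.
From HB Require Import structures.
From mathcomp Require Import all_boot all_order all_algebra.
From mathcomp Require Import all_classical all_reals all_analysis.
From mathcomp Require Import zify lra.

(** Root the tree at vertex 0 and represent an edge by its lower end. For a branching
    parameter [b] of order [log n / log log n], the vertices at which the integer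
    parts of (subtree size) / [b ^ l] jump form a separator of level [l]; every path
    has a level [l] at which it meets the separator of level [l] but not the one of
    level [l + 1], and there are only [O(log n / log b)] levels. Fix the level. A
    component left by the coarser separator contains fewer than [b] marks of the finer
    one, hence fewer than [2 b] segments between branching marks, and a path consists
    of full segments, of at most three partial segments, and of two side pieces
    hanging off the marks. By concavity the revenue of the optimum on a commodity is
    at most the sum of what these pieces earn separately.

    The number of optimal edges in every segment, rounded down to a power of two, can
    be guessed component by component, since [(log n + 2) ^ (2 b) <= 64 n ^ 2]. A fair
    coin per segment and per side piece isolates, with constant probability, one kind
    of piece on a given path. Then the full segments are served by their lowest edges,
    the partial segments and the sides by a dynamic program over a forest, and the
    bound [u_i] is respected because every piece takes at most what the optimum takes
    there. Trying all levels and guesses and keeping the best candidate costs a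
    constant factor per level.

    Polynomial cost is obtained from closure properties: a function of the read-only
    input and of the tables is definable if some command evaluates it at polynomial
    cost, and definable functions are closed under arithmetic, bounded sums, products
    and quantifiers, table updates and bounded loops. *)

Set Implicit Arguments.
Unset Strict Implicit.
Unset Printing Implicit Defensive.

Import Order.TTheory GRing.Theory Num.Theory.
Import numFieldNormedType.Exports.

Local Open Scope nat_scope.

(** * Bounded sums and quantifiers over the natural numbers *)

Definition sumN n (F : nat -> nat) := \sum_(i < n) F i.
Definition prodN n (F : nat -> nat) := \prod_(i < n) F i.
Definition allN n (p : pred nat) := all p (iota 0 n).
Definition hasN n (p : pred nat) := has p (iota 0 n).

Lemma allNP n (p : pred nat) : reflect (forall x, x < n -> p x) (allN n p).
Proof.
apply: (iffP allP) => H x; first by move=> ltx; apply: H; rewrite mem_iota.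
by rewrite mem_iota => /andP[_]; apply: H.
Qed.

Lemma hasNP n (p : pred nat) : reflect (exists2 x, x < n & p x) (hasN n p).
Proof.
apply: (iffP hasP) => -[x]; first by rewrite mem_iota => /andP[_ ltx] px; exists x.
by move=> ltx px; exists x; rewrite ?mem_iota.
Qed.

Lemma eq_sumN n F G : (forall i, i < n -> F i = G i) -> sumN n F = sumN n G.
Proof. by move=> E; apply: eq_bigr => i _; apply: E. Qed.

Lemma leq_sumN n F G : (forall i, i < n -> F i <= G i) -> sumN n F <= sumN n G.
Proof. by move=> E; apply: leq_sum => i _; apply: E. Qed.

Lemma sumND n F G : sumN n (fun i => F i + G i) = sumN n F + sumN n G.
Proof. exact: big_split. Qed.

Lemma exchange_sumN n m (F : nat -> nat -> nat) :
  sumN n (fun i => sumN m (F i)) = sumN m (fun j => sumN n (F^~ j)).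
Proof. exact: exchange_big. Qed.

Lemma sumN_mull n c F : sumN n (fun i => c * F i) = c * sumN n F.
Proof. by rewrite /sumN big_distrr. Qed.

Lemma sumN_mulr n c F : sumN n (fun i => F i * c) = sumN n F * c.
Proof. by rewrite /sumN big_distrl. Qed.

Lemma sumN_eq0 n F : (forall i, i < n -> F i = 0) -> sumN n F = 0.
Proof. by move=> E; apply: big1 => i _; apply: E. Qed.

Lemma sumN_gt0 n F : (0 < sumN n F) = hasN n (fun x => 0 < F x).
Proof.
rewrite /sumN lt0n sum_nat_eq0; apply/idP/hasNP => [|[x xn Fx]].
  by rewrite negb_forall => /existsP[x]; rewrite -lt0n; exists x.
by rewrite negb_forall; apply/existsP; exists (Ordinal xn); rewrite -lt0n.
Qed.

Lemma sumN_only n F j :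
  j < n -> (forall i, i < n -> i != j -> F i = 0) -> sumN n F = F j.
Proof.
move=> jn E; rewrite /sumN (bigD1 (Ordinal jn)) //= big1 ?addn0 // => i ne.
by apply: E => //; apply: contra ne => /eqP e; apply/eqP; apply: val_inj.
Qed.

Lemma leq_sumN_term n F j : j < n -> F j <= sumN n F.
Proof. by move=> jn; rewrite /sumN (bigD1 (Ordinal jn)) //= leq_addr. Qed.

Lemma sumN_pred1 n (p : pred nat) j :
  j < n -> sumN n (fun i => (i == j) && p i) = p j.
Proof. by move=> jn; rewrite (sumN_only jn) ?eqxx // => i _ /negPf ->. Qed.

Lemma sumN_card n (p : pred nat) : sumN n p = #|[set i : 'I_n | p i]|.
Proof.
rewrite /sumN -sum1_card [RHS]big_mkcond /=.
by apply: eq_bigr => i _; rewrite inE; case: (p i).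
Qed.

Lemma sumN_size n (p : pred nat) : sumN n p = size [seq z <- iota 0 n | p z].
Proof.
rewrite -sum1_size big_filter big_mkcond /= -[n in iota 0 n]subn0 big_mkord.
by apply: eq_bigr => i _; case: (p i).
Qed.

Lemma sumN_pred_le n (p : pred nat) : sumN n p <= n.
Proof. by rewrite sumN_card -[leqRHS]card_ord max_card. Qed.

Lemma sumN_pred_lt n (p : pred nat) j : j < n -> ~~ p j -> sumN n p < n.
Proof.
move=> jn npj; rewrite sumN_card -[ltnRHS]card_ord -cardsT proper_card // properT.
by apply: contra npj => /eqP/setP/(_ (Ordinal jn)); rewrite !inE /= => ->.
Qed.

Lemma sumN_ltn n m : m <= n -> sumN n (fun i => i < m) = m.
Proof.
move=> mn; rewrite /sumN -big_mkcond /= -(big_ord_widen n (fun=> 1) mn).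
by rewrite sum1_card card_ord.
Qed.

Lemma sumN_le1 n (p : pred nat) :
  (forall i j, i < n -> j < n -> p i -> p j -> i = j) -> sumN n p <= 1.
Proof.
move=> U; case: (boolP (hasN n p)) => [/hasNP[j jn pj]|/hasNP np].
  rewrite (sumN_only jn) ?leq_b1 // => i lin ne.
  by case pi: (p i) => //; case/eqP: ne; exact: U.
by rewrite sumN_eq0 // => i lin; case pi: (p i) => //; case: np; exists i.
Qed.

Lemma card_rank_lt (I : finType) (S : {set I}) (rank : I -> nat) k :
  {in S &, injective rank} -> {in S, forall v, rank v < #|S|} -> k <= #|S| ->
  #|[set v in S | rank v < k]| = k.
Proof.
move=> rank_inj rank_lt kS; case: (posnP #|S|) => [S0|S_gt0].
  have -> : k = 0 by lia.
  by apply/eqP; rewrite cards_eq0; apply/eqP/setP => v; rewrite !inE ltn0 andbF.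
pose g v : 'I_#|S| := Ordinal (ltn_pmod (rank v) S_gt0).
have gE v : v \in S -> g v = rank v :> nat by move=> vS; rewrite /= modn_small // rank_lt.
have g_inj : {in S &, injective g}.
  by move=> v w vS wS /(congr1 val) /= E; apply: rank_inj => //; rewrite -!gE //= E.
have gS : g @: S = [set: 'I_#|S|].
  by apply/eqP; rewrite eqEcard finset.subsetT cardsT card_ord (card_in_imset g_inj) leqnn.
have g_sub : {in [set v in S | rank v < k] &, injective g}.
  by move=> v w; rewrite inE => /andP[vS _]; rewrite inE => /andP[wS _]; exact: g_inj.
rewrite -(card_in_imset g_sub).
have -> : g @: [set v in S | rank v < k] = [set j : 'I_#|S| | j < k].
  apply/setP => j; rewrite inE; apply/imsetP/idP => [[v]|jk].
    by rewrite inE => /andP[vS lt] ->; rewrite gE.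
  have : j \in g @: S by rewrite gS inE.
  by case/imsetP=> v vS E; exists v => //; rewrite inE vS -gE // -E.
by rewrite -(sumN_card _ (fun j => j < k)) sumN_ltn.
Qed.

Lemma divn_index n v w : w < n -> (v * n + w) %/ n = v.
Proof. by case: n => // n wn; rewrite divnMDl // divn_small // addn0. Qed.

Lemma modn_index n v w : w < n -> (v * n + w) %% n = w.
Proof. by move=> wn; rewrite modnMDl modn_small. Qed.

Lemma ltn_index m n v w : v < m -> w < n -> v * n + w < m * n.
Proof. by move=> vm wn; apply: (@leq_trans (v.+1 * n)); [rewrite mulSn; lia|rewrite leq_mul]. Qed.

Definition powN n b l := prodN n (fun i => if i < l then b else 1).

Definition log2N n := sumN n (fun l => powN n 2 l.+1 <= n).

Lemma powNE n b l : l <= n -> powN n b l = b ^ l.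
Proof.
move=> ln; rewrite /powN /prodN -big_mkcond /= -(big_ord_widen n (fun=> b) ln).
by rewrite prod_nat_const card_ord.
Qed.

Lemma trunc_log_ltn_self b n : 1 < b -> 0 < n -> trunc_log b n < n.
Proof. by move=> b1 n0; apply: leq_trans (trunc_logP b1 n0); exact: ltn_expl. Qed.

Lemma log2NE n : 0 < n -> log2N n = trunc_log 2 n.
Proof.
move=> n0; rewrite -[RHS](sumN_ltn (ltnW (trunc_log_ltn_self (ltnSn 1) n0))).
apply: eq_sumN => l ln; rewrite powNE //; congr nat_of_bool; apply/idP/idP => h.
  exact: trunc_log_max.
by apply: leq_trans (trunc_logP (ltnSn 1) n0); rewrite leq_exp2l.
Qed.

(** * Trees and levels *)

(* Vertices are the numbers below [tree_size]. [anc v w] reads "[v] is an ancestor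
   of [w]" and [child c v] reads "[v] is the parent of [c]"; an edge is represented
   by its lower end point, so that sets of edges are sets of vertices. *)
Record tree := Tree {
  tree_size : nat;
  anc : rel nat;
  child : rel nat
}.

Definition ahead (T : tree) (up : bool) v w := if up then anc T w v else anc T v w.

(* The vertices of the finer separator are marked, those avoided by the coarser one
   are free. *)
Record level := Level {
  level_tree :> tree;
  free : pred nat;
  mark : pred nat
}.

Section Separators.
Variable T : tree.
Local Notation n := (tree_size T).

Definition subtree_size v := sumN n (fun w => anc T v w).

(* The quotients by [q] of the subtree sizes of the children fall short of that of a
   vertex of the separator: it cuts the tree into pieces of size about [q]. *)
Definition separator q v :=
  subtree_size v %/ q != sumN n (fun c => child T c v * (subtree_size c %/ q)).

Definition separator_level q q' := Level T (fun v => ~~ separator q' v) (separator q).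

End Separators.

Section LevelNotions.
Variable L : level.
Local Notation n := (tree_size L).

Definition conn v w :=
  anc L v w && allN n (fun y => anc L v y && anc L y w ==> free L y).

Definition comp_top c := free L c && ~~ hasN n (fun p => child L c p && free L p).

Definition skeleton v := hasN n (fun w => conn v w && mark L w).

(* The closure of the marks under branching cuts the skeleton into vertical segments,
   each named after its lowest vertex. *)
Definition seg_end v :=
  free L v && (mark L v || (1 < sumN n (fun c => child L c v && skeleton c))).

Definition in_seg v z := [&& conn v z, seg_end z &
  allN n (fun y => [&& anc L v y, anc L y z & y != z] ==> ~~ seg_end y)].

Definition same_seg v w := hasN n (fun z => in_seg v z && in_seg w z).

(* [y] is the root of the subtree hanging off the skeleton that contains [v]. *)
Definition hanging_root v y :=
  [&& conn y v, ~~ skeleton y & hasN n (fun p => child L y p && skeleton p)].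

End LevelNotions.

(** * Rooted trees *)

Record rooted (T : tree) (par dep : nat -> nat) : Prop := Rooted {
  rooted_par0 : par 0 = 0;
  rooted_dep0 : dep 0 = 0;
  rooted_par_lt : forall v, v < tree_size T -> par v < tree_size T;
  rooted_dep : forall v, 0 < v < tree_size T -> dep v = (dep (par v)).+1;
  rooted_dep_lt : forall v, v < tree_size T -> dep v < tree_size T;
  rooted_anc : forall v w, anc T v w =
    [&& v < tree_size T, w < tree_size T, dep v <= dep w
      & iter (dep w - dep v) par w == v];
  rooted_child : forall c v, child T c v = [&& c < tree_size T, 0 < c & par c == v]
}.

Section RootedTree.
Variables (T : tree) (par dep : nat -> nat).
Hypothesis rT : rooted T par dep.
Local Notation n := (tree_size T).
Local Notation anc := (anc T).
Local Notation child := (child T).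

Lemma iter_par_lt k v : v < n -> iter k par v < n.
Proof. by move=> vn; elim: k => //= k; exact: (rooted_par_lt rT). Qed.

Lemma dep_par v : v < n -> dep (par v) = (dep v).-1.
Proof.
case: v => [|v] vn; first by rewrite (rooted_par0 rT) (rooted_dep0 rT).
by rewrite (rooted_dep rT (v := v.+1)).
Qed.

Lemma dep_iter_par k v : v < n -> dep (iter k par v) = dep v - k.
Proof.
move=> vn; elim: k => [|k IH]; first by rewrite subn0.
by rewrite iterS dep_par ?iter_par_lt // IH subnS.
Qed.

Lemma dep_eq0 v : v < n -> (dep v == 0) = (v == 0).
Proof.
by case: v => [|v] vn; rewrite ?(rooted_dep0 rT) // (rooted_dep rT (v := v.+1)).
Qed.

Lemma iter_par0 k : iter k par 0 = 0.
Proof. by elim: k => //= k ->; exact: (rooted_par0 rT). Qed.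

Lemma anc_ltl v w : anc v w -> v < n.
Proof. by rewrite (rooted_anc rT) => /and4P[]. Qed.

Lemma anc_ltr v w : anc v w -> w < n.
Proof. by rewrite (rooted_anc rT) => /and4P[]. Qed.

Lemma anc_leq_dep v w : anc v w -> dep v <= dep w.
Proof. by rewrite (rooted_anc rT) => /and4P[]. Qed.

Lemma iter_par_anc v w : anc v w -> iter (dep w - dep v) par w = v.
Proof. by rewrite (rooted_anc rT) => /and4P[_ _ _ /eqP]. Qed.

Lemma ancP v w : w < n -> reflect (exists k, iter k par w = v) (anc v w).
Proof.
move=> wn; apply: (iffP idP) => [/iter_par_anc <-|[k <-]]; first by eexists.
rewrite (rooted_anc rT) dep_iter_par // leq_subr iter_par_lt // wn /=; apply/eqP.
case: (leqP k (dep w)) => kw; first by rewrite subKn.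
have root : iter (dep w) par w = 0.
  by apply/eqP; rewrite -dep_eq0 ?iter_par_lt // dep_iter_par // subnn.
have -> : dep w - k = 0 by lia.
by rewrite subn0 root -(subnK (ltnW kw)) iterD root iter_par0.
Qed.

Lemma anc_refl v : v < n -> anc v v.
Proof. by move=> vn; rewrite (rooted_anc rT) vn leqnn subnn /=. Qed.

Lemma ahead_refl up v : v < n -> ahead T up v v.
Proof. by case: up; exact: anc_refl. Qed.

Lemma anc_trans u v w : anc u v -> anc v w -> anc u w.
Proof.
move=> uv vw; have vn := anc_ltl vw; have wn := anc_ltr vw.
move: uv vw => /(ancP _ vn)[k <-] /(ancP _ wn)[j <-]; apply/ancP => //.
by exists (k + j); rewrite iterD.
Qed.

Lemma anc_eq v w : anc v w -> dep w <= dep v -> v = w.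
Proof. by move=> /iter_par_anc E; rewrite -subn_eq0 => /eqP d0; rewrite -E d0. Qed.

Lemma anc_anti v w : anc v w -> anc w v -> v = w.
Proof. by move=> vw wv; apply: anc_eq => //; exact: anc_leq_dep. Qed.

Lemma anc_ltn_dep v w : anc v w -> v != w -> dep v < dep w.
Proof. by move=> vw; apply: contraNltn => /(anc_eq vw) ->. Qed.

Lemma anc_chain u v w : anc u w -> anc v w -> dep u <= dep v -> anc u v.
Proof.
move=> uw vw uv; apply/ancP; first exact: anc_ltl vw.
exists (dep v - dep u); rewrite -{2}(iter_par_anc vw) -iterD -[RHS](iter_par_anc uw).
by congr (iter _ _ _); have := anc_leq_dep vw; lia.
Qed.

Lemma anc_total u v w : anc u w -> anc v w -> anc u v || anc v u.
Proof.
move=> uw vw; case: (leqP (dep u) (dep v)) => le; first by rewrite (anc_chain uw vw).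
by rewrite (anc_chain vw uw) ?orbT // ltnW.
Qed.

Lemma anc_par w : w < n -> anc (par w) w.
Proof. by move=> wn; apply/ancP => //; exists 1. Qed.

Lemma anc_to_par v w : anc v w -> v != w -> anc v (par w).
Proof.
move=> vw ne; have lt := anc_ltn_dep vw ne; have wn := anc_ltr vw.
apply: (anc_chain vw (anc_par wn)); rewrite dep_par //; lia.
Qed.

Lemma child_ltl c v : child c v -> c < n.
Proof. by rewrite (rooted_child rT) => /and3P[]. Qed.

Lemma child_par c v : child c v -> par c = v.
Proof. by rewrite (rooted_child rT) => /and3P[_ _ /eqP]. Qed.

Lemma par_child c : c < n -> 0 < c -> child c (par c).
Proof. by move=> cn c0; rewrite (rooted_child rT) cn c0 eqxx. Qed.

Lemma child_ltr c v : child c v -> v < n.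
Proof. by move=> p; rewrite -(child_par p); exact: (rooted_par_lt rT (child_ltl p)). Qed.

Lemma child_dep c v : child c v -> dep c = (dep v).+1.
Proof.
move=> p; rewrite -(child_par p) (rooted_dep rT) // (child_ltl p) andbT.
by move: p; rewrite (rooted_child rT) => /and3P[].
Qed.

Lemma anc_neq_child v w : anc v w -> v != w -> child w (par w).
Proof.
move=> vw ne; have wn := anc_ltr vw; apply: par_child => //.
by rewrite lt0n -dep_eq0 // -lt0n (leq_ltn_trans _ (anc_ltn_dep vw ne)).
Qed.

Lemma anc_child_ex v w : anc v w -> v != w -> exists2 c, child c v & anc c w.
Proof.
move=> vw ne; have lt := anc_ltn_dep vw ne; have wn := anc_ltr vw.
set c := iter (dep w - dep v).-1 par w.
have cn : c < n by exact: iter_par_lt.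
have dc : dep c = (dep v).+1 by rewrite dep_iter_par //; lia.
exists c; last by apply/ancP => //; eexists.
have -> : v = par c by rewrite -iterS prednK ?subn_gt0 // iter_par_anc.
by apply: par_child; rewrite // lt0n -dep_eq0 // dc.
Qed.

Lemma child_anc c v : child c v -> anc v c.
Proof. by move=> p; rewrite -(child_par p) anc_par // (child_ltl p). Qed.

Lemma child_not_anc c v : child c v -> ~~ anc c v.
Proof. by move=> p; apply/negP => /anc_leq_dep; rewrite (child_dep p) ltnn. Qed.

Lemma child_uniq c c' v w : child c v -> child c' v -> anc c w -> anc c' w -> c = c'.
Proof.
move=> p p' cw cw'.
have depE : dep c = dep c' by rewrite (child_dep p) (child_dep p').
by apply: anc_eq; rewrite ?depE //; apply: (anc_chain cw cw'); rewrite depE.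
Qed.

Lemma rooted_ind (P : nat -> Prop) :
  (forall v, v < n -> (forall c, child c v -> P c) -> P v) ->
  forall v, v < n -> P v.
Proof.
move=> H v; move Ek : (n - dep v) => k; elim/ltn_ind: k v Ek => k IH v Ek vn.
apply: H => // c p; have cn := child_ltl p; apply: (IH (n - dep c)) => //.
have := child_dep p; have := rooted_dep_lt rT cn; lia.
Qed.

End RootedTree.

Section Connected.
Variables (L : level) (par dep : nat -> nat).
Hypothesis rL : rooted L par dep.
Local Notation n := (tree_size L).
Local Notation anc := (anc L).
Local Notation child := (child L).
Local Notation conn := (conn L).

Lemma connP v w :
  reflect (anc v w /\ forall y, anc v y -> anc y w -> free L y) (conn v w).
Proof.
apply: (iffP andP) => -[vw H]; split=> //.
  by move=> y vy yw; move/allNP: H => /(_ y (anc_ltl rL yw)); rewrite vy yw.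
by apply/allNP => y yn; apply/implyP => /andP[vy yw]; exact: H.
Qed.

Lemma conn_anc v w : conn v w -> anc v w. Proof. by case/andP. Qed.

Lemma conn_ltl v w : conn v w -> v < n.
Proof. by move/conn_anc/(anc_ltl rL). Qed.

Lemma conn_ltr v w : conn v w -> w < n.
Proof. by move/conn_anc/(anc_ltr rL). Qed.

Lemma conn_free v w : conn v w -> free L v /\ free L w.
Proof.
move=> /connP[vw H]; have vn := anc_ltl rL vw; have wn := anc_ltr rL vw.
by split; apply: H => //; exact: (anc_refl rL).
Qed.

Lemma conn_trans u v w : conn u v -> conn v w -> conn u w.
Proof.
move=> /connP[uv H] /connP[vw H']; apply/connP.
split=> [|y uy yw]; first exact: (anc_trans rL uv vw).
by case/orP: (anc_total rL vw yw) => [vy|yv]; [exact: H'|exact: H].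
Qed.

Lemma conn_split u v w : conn u w -> anc u v -> anc v w -> conn u v /\ conn v w.
Proof.
move=> /connP[uw H] uv vw.
split; apply/connP; split=> // y uy yv; apply: H => //; first exact: (anc_trans rL yv vw).
exact: (anc_trans rL uv uy).
Qed.

Lemma conn_refl v : v < n -> free L v -> conn v v.
Proof.
move=> vn Uv; apply/connP; split; first exact: (anc_refl rL).
by move=> y vy yv; rewrite -(anc_anti rL vy yv).
Qed.

Lemma conn_child c v : free L c -> free L v -> child c v -> conn v c.
Proof.
move=> Uc Uv p; apply/connP; split; first exact: (child_anc rL).
move=> y vy yc; case: (eqVneq y c) => [->//|ne].
have yp := anc_to_par rL yc ne; rewrite (child_par rL p) in yp.
by rewrite (anc_anti rL yp vy).
Qed.

Lemma conn_child_ex v w : conn v w -> v != w -> exists2 c, child c v & conn c w.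
Proof.
move=> cvw ne; have [c p cw] := anc_child_ex rL (conn_anc cvw) ne; exists c => //.
by have [] := conn_split cvw (child_anc rL p) cw.
Qed.

Lemma conn_rec v w : v < n -> (conn v w : nat) =
  free L v * ((w == v) + sumN n (fun c => child c v && conn c w)).
Proof.
move=> vn; have [Uv|nUv] := boolP (free L v); last first.
  by rewrite mul0n; apply/eqP; rewrite eqb0; apply: contra nUv => /conn_free[].
rewrite mul1n; have [->|ne] := eqVneq w v.
  rewrite conn_refl // sumN_eq0 // => c _; case p: (child c v) => //=.
  by case cv: (conn c v) => //; case/negP: (child_not_anc rL p); exact: conn_anc.
have [cvw|ncvw] := boolP (conn v w).
  rewrite eq_sym in ne; have [c p cw] := conn_child_ex cvw ne.
  rewrite (sumN_only (child_ltl rL p)) ?p ?cw // => c' _ ne'.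
  case p': (child c' v) => //=; case cw': (conn c' w) => //; case/eqP: ne'.
  exact: (child_uniq rL p' p (conn_anc cw') (conn_anc cw)).
rewrite sumN_eq0 // => c _; case p: (child c v) => //=; case cw: (conn c w) => //.
have [Uc _] := conn_free cw.
by rewrite (conn_trans (conn_child Uc Uv p) cw) in ncvw.
Qed.

Lemma sum_conn_rec v (F : nat -> nat) : v < n ->
  sumN n (fun w => conn v w * F w) =
  free L v * (F v + sumN n (fun c => child c v * sumN n (fun w => conn c w * F w))).
Proof.
move=> vn; rewrite (@eq_sumN _ _ (fun w => free L v * ((w == v) * F w +
   sumN n (fun c => (child c v && conn c w) * F w)))); last first.
  by move=> w wn; rewrite conn_rec // -mulnA mulnDl sumN_mulr.
rewrite sumN_mull sumND; congr (_ * (_ + _)).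
  by rewrite (sumN_only vn) ?eqxx ?mul1n // => i _ /negPf ->.
rewrite exchange_sumN; apply: eq_sumN => c cn; rewrite -sumN_mull; apply: eq_sumN => w _.
by rewrite -mulnb mulnA.
Qed.

Lemma comp_topP c : reflect (free L c /\ forall p, child c p -> ~~ free L p) (comp_top L c).
Proof.
apply: (iffP andP) => -[Uc H]; split=> //.
  by move=> p pc; apply: contra H => Up; apply/hasNP; exists p; rewrite ?pc ?(child_ltr rL pc).
by apply/negP => /hasNP[p _ /andP[pc Up]]; have := H p pc; rewrite Up.
Qed.

Lemma comp_top_ex v : v < n -> free L v -> exists2 c, comp_top L c & conn c v.
Proof.
move Ek : (dep v) => m; elim: m v Ek => [|m IH] v Ek vn Uv.
  exists v; last exact: conn_refl.
  by apply/comp_topP; split=> // p /(child_dep rL); lia.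
have pv : child v (par v) by apply: (par_child rL); rewrite // lt0n -(dep_eq0 rL) // Ek.
case: (boolP (free L (par v))) => [Up|nUp].
  have [||c tc cp] := IH (par v) _ _ Up; first by rewrite (dep_par rL) // Ek.
    exact: (rooted_par_lt rL).
  by exists c => //; exact: (conn_trans cp (conn_child Uv Up pv)).
exists v; last exact: conn_refl.
by apply/comp_topP; split=> // p /(child_par rL) <-.
Qed.

Lemma comp_top_uniq c c' v :
  comp_top L c -> comp_top L c' -> conn c v -> conn c' v -> c = c'.
Proof.
suff above x x' : comp_top L x' -> conn x v -> anc x x' -> anc x' v -> x = x'.
  move=> tc tc' cv cv'.
  case/orP: (anc_total rL (conn_anc cv) (conn_anc cv')) => h.
    exact: above tc' cv h (conn_anc cv').
  by apply/esym; exact: above tc cv' h (conn_anc cv).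
move=> /comp_topP[_ tx'] xv xx' x'v; apply/eqP; apply: contraT => ne.
have [cx _] := conn_split xv xx' x'v.
have [cxp _] := conn_split cx (anc_to_par rL xx' ne) (anc_par rL (anc_ltr rL xx')).
by have := tx' _ (anc_neq_child rL xx' ne); rewrite (conn_free cxp).2.
Qed.

End Connected.

(** * Separators *)

Section SeparatorTheory.
Variables (T : tree) (par dep : nat -> nat).
Hypothesis rT : rooted T par dep.
Local Notation n := (tree_size T).
Local Notation child := (child T).
Local Notation size := (subtree_size T).

Lemma subtree_sizeE v : v < n -> size v = 1 + sumN n (fun c => child c v * size c).
Proof.
pose L := Level T xpredT xpred0.
have sizeE w : sumN n (fun x => conn L w x * 1) = size w.
  apply: eq_sumN => x _; rewrite muln1 /conn andb_idr // => _.
  by apply/allNP => y _; rewrite implybT.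
move=> vn; rewrite -sizeE (@sum_conn_rec L _ _ rT v (fun=> 1) vn) mul1n.
by congr (_ + _); apply: eq_sumN => c _; rewrite sizeE.
Qed.

Lemma subtree_size_le v : size v <= n.
Proof. exact: sumN_pred_le. Qed.

Lemma separator1 v : v < n -> separator T 1 v.
Proof.
move=> vn; rewrite /separator divn1 subtree_sizeE //.
rewrite (@eq_sumN _ (fun c => _ * (_ %/ 1)) (fun c => child c v * size c)).
  by rewrite add1n neq_ltn ltnSn orbT.
by move=> c _; rewrite divn1.
Qed.

Lemma separator_large q v : n < q -> ~~ separator T q v.
Proof.
move=> nq; have small w : size w %/ q = 0.
  by rewrite divn_small // (leq_ltn_trans (subtree_size_le w)).
by rewrite negbK small sumN_eq0 // => c _; rewrite small muln0.
Qed.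

Lemma sum_child_div_le q v : v < n -> sumN n (fun c => child c v * (size c %/ q)) <= size v %/ q.
Proof.
move=> vn; case: (posnP q) => [->|q0].
  by rewrite sumN_eq0 // => c _; rewrite divn0 muln0.
rewrite leq_divRL // -sumN_mulr subtree_sizeE //; apply: leq_trans (leq_addl _ _).
by apply: leq_sumN => c _; rewrite -mulnA leq_mul // leq_divM.
Qed.

(* Off the coarse separator the quotients by [b * q] add up exactly, hence so do the
   remainders; the size of the fine separator is controlled by the remainder alone. *)
Lemma separator_count_lt b q v : 0 < b -> 0 < q -> v < n ->
  sumN n (fun w => conn (separator_level T q (b * q)) v w * separator T q w) < b.
Proof.
move=> b0 q0 vn; set L := separator_level T q (b * q).
have bq0 : 0 < b * q by rewrite muln_gt0 b0.
pose rem w := (size w %% (b * q)) %/ q.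
suff le_rem : sumN n (fun w => conn L v w * separator T q w) <= rem v.
  by apply: leq_ltn_trans le_rem _; rewrite ltn_divLR //; exact: ltn_pmod.
elim/(rooted_ind rT): v / vn => v vn IH; rewrite (sum_conn_rec (L := L) rT) //.
have [|_] := boolP (free L v); last by rewrite mul0n.
rewrite mul1n /= negbK => /eqP quotE.
have divq w : size w %/ q = b * (size w %/ (b * q)) + rem w.
  by rewrite {1}(divn_eq (size w) (b * q)) mulnA divnMDl // mulnC.
have le_children : sumN n (fun c => child c v * sumN n (fun w => conn L c w * separator T q w)) <=
   sumN n (fun c => child c v * rem c).
  by apply: leq_sumN => c cn; case p: (child c v); rewrite ?mul0n // !mul1n IH.
have rem_step : separator T q v + sumN n (fun c => child c v * rem c) <= rem v.
  have sumE : sumN n (fun c => child c v * (size c %/ q)) =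
      b * (size v %/ (b * q)) + sumN n (fun c => child c v * rem c).
    by rewrite quotE -sumN_mull -sumND; apply: eq_sumN => c _; rewrite divq mulnDr mulnCA.
  have := sum_child_div_le q vn; rewrite /separator.
  by move: sumE (divq v); case: eqP => /=; lia.
exact: leq_trans (leq_add (leqnn _) le_children) rem_step.
Qed.

End SeparatorTheory.

(** * Segments *)

Section Segments.
Variables (L : level) (par dep : nat -> nat).
Hypothesis rL : rooted L par dep.
Local Notation n := (tree_size L).
Local Notation anc := (anc L).
Local Notation child := (child L).
Local Notation conn := (conn L).
Local Notation skeleton := (skeleton L).
Local Notation seg_end := (seg_end L).
Local Notation in_seg := (in_seg L).

Lemma skeletonP v : reflect (exists2 w, conn v w & mark L w) (skeleton v).
Proof.
apply: (iffP (hasNP _ _)) => [[w _ /andP[c m]]|[w c m]]; first by exists w.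
by exists w; rewrite ?c ?(conn_ltr rL c).
Qed.

Lemma skeleton_free v : skeleton v -> free L v.
Proof. by case/skeletonP=> w /(conn_free rL)[]. Qed.

Lemma skeleton_lt v : skeleton v -> v < n.
Proof. by case/skeletonP=> w /(conn_ltl rL). Qed.

Lemma skeleton_up u v : conn u v -> skeleton v -> skeleton u.
Proof.
by move=> uv /skeletonP[w vw m]; apply/skeletonP; exists w => //; exact: (conn_trans rL uv).
Qed.

Lemma mark_skeleton v : v < n -> free L v -> mark L v -> skeleton v.
Proof. by move=> vn Uv m; apply/skeletonP; exists v => //; exact: (conn_refl rL). Qed.

Lemma seg_end_skeleton v : v < n -> seg_end v -> skeleton v.
Proof.
move=> vn /andP[Uv /orP[m|/ltnW]]; first exact: mark_skeleton.
rewrite sumN_gt0 => /hasNP[c _]; rewrite lt0b => /andP[p h].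
exact: (skeleton_up (conn_child rL (skeleton_free h) Uv p)).
Qed.

Lemma skeleton_child v : skeleton v -> ~~ seg_end v -> exists c, [/\ child c v, skeleton c &
  forall c', child c' v -> skeleton c' -> c' = c].
Proof.
move=> hv; rewrite negb_and (skeleton_free hv) negb_or /= -leqNgt => /andP[nM le1].
have [w cvw m] := skeletonP _ hv.
have ne : v != w by apply: contraNneq nM => ->.
have [c p ccw] := conn_child_ex rL cvw ne.
have hc : skeleton c by apply/skeletonP; exists w.
exists c; split=> // c' p' hc'; apply/eqP; apply: contraTT le1 => ne'; rewrite -ltnNge.
have cn := child_ltl rL p; have cn' := child_ltl rL p'.
rewrite /sumN (bigD1 (Ordinal cn)) //= p hc (bigD1 (Ordinal cn')) /=; first by rewrite p' hc'.
by apply: contra ne' => /eqP[->].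
Qed.

Lemma in_seg_conn v z : in_seg v z -> conn v z. Proof. by case/and3P. Qed.

Lemma in_seg_anc v z : in_seg v z -> anc v z. Proof. by move/in_seg_conn/conn_anc. Qed.

Lemma in_seg_ltl v z : in_seg v z -> v < n.
Proof. by move/in_seg_anc/(anc_ltl rL). Qed.

Lemma in_seg_ltr v z : in_seg v z -> z < n.
Proof. by move/in_seg_anc/(anc_ltr rL). Qed.

Lemma in_seg_end v z : in_seg v z -> seg_end z. Proof. by case/and3P. Qed.

Lemma in_seg_between v z y : in_seg v z -> anc v y -> anc y z -> y != z -> ~~ seg_end y.
Proof.
case/and3P=> _ _ /allNP H vy yz ne; have := H y (anc_ltl rL yz).
by rewrite vy yz ne.
Qed.

Lemma in_seg_skeleton v z : in_seg v z -> skeleton v.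
Proof.
move=> h; apply: (skeleton_up (in_seg_conn h)).
exact: seg_end_skeleton (in_seg_ltr h) (in_seg_end h).
Qed.

Lemma in_segI v z : conn v z -> seg_end z ->
  (forall y, anc v y -> anc y z -> y != z -> ~~ seg_end y) -> in_seg v z.
Proof.
move=> c m H; apply/and3P; split=> //.
by apply/allNP => y _; apply/implyP => /and3P[]; exact: H.
Qed.

Lemma in_seg_refl z : z < n -> seg_end z -> in_seg z z.
Proof.
move=> zn m; apply: in_segI => //; first by apply: (conn_refl rL) => //; case/andP: m.
by move=> y zy yz; rewrite (anc_anti rL zy yz) eqxx.
Qed.

Lemma in_seg_of_end v z : in_seg v z -> seg_end v -> z = v.
Proof.
move=> h m; apply/eqP; apply: contraT; rewrite eq_sym => ne.
by rewrite (negPf (in_seg_between h (anc_refl rL (in_seg_ltl h)) (in_seg_anc h) ne)) in m.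
Qed.

Lemma in_seg_mid v w z : in_seg v z -> anc v w -> anc w z -> in_seg w z.
Proof.
move=> h vw wz; have [_ c] := conn_split rL (in_seg_conn h) vw wz.
apply: in_segI => //; first exact: in_seg_end h.
by move=> y wy yz ne; apply: (in_seg_between h) => //; exact: (anc_trans rL vw wy).
Qed.

Lemma in_seg_up v c z : ~~ seg_end v -> free L v -> child c v -> in_seg c z -> in_seg v z.
Proof.
move=> nm Uv p h; have Uc := skeleton_free (in_seg_skeleton h).
apply: in_segI => [||y vy yz ne].
- exact: (conn_trans rL (conn_child rL Uc Uv p) (in_seg_conn h)).
- exact: in_seg_end h.
case: (eqVneq v y) => [<-//|vy'].
have [c' p' cy] := anc_child_ex rL vy vy'.
have c_uniq : c' = c by exact: (child_uniq rL p' p (anc_trans rL cy yz) (in_seg_anc h)).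
by rewrite c_uniq in cy; exact: (in_seg_between h).
Qed.

Lemma in_seg_ex v : skeleton v -> exists z, in_seg v z.
Proof.
move=> hv; have vn := skeleton_lt hv; elim/(rooted_ind rL): v / vn hv => v vn IH hv.
case: (boolP (seg_end v)) => [m|nm]; first by exists v; exact: in_seg_refl.
have [c [p hc _]] := skeleton_child hv nm; have [z h] := IH c p hc.
by exists z; exact: (in_seg_up nm (skeleton_free hv) p).
Qed.

Lemma in_seg_uniq v z z' : in_seg v z -> in_seg v z' -> z = z'.
Proof.
move=> h; have vn := in_seg_ltl h.
elim/(rooted_ind rL): v / vn z z' h => v vn IH z z' h h'.
case: (boolP (seg_end v)) => [m|nm]; first by rewrite (in_seg_of_end h m) (in_seg_of_end h' m).
have [c [p hc uc]] := skeleton_child (in_seg_skeleton h) nm.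
have down y : in_seg v y -> in_seg c y.
  move=> hy; have ne : v != y by apply: contraNneq nm => ->; exact: in_seg_end hy.
  have [c' p' cy] := conn_child_ex rL (in_seg_conn hy) ne.
  have hc' := skeleton_up cy (seg_end_skeleton (in_seg_ltr hy) (in_seg_end hy)).
  by rewrite -(uc c' p' hc'); exact: in_seg_mid hy (child_anc rL p') (conn_anc cy).
exact: (IH c p) (down _ h) (down _ h').
Qed.

Lemma seg_end_anc v w z z' : in_seg v z -> in_seg w z' -> conn v w -> z != z' -> anc z w.
Proof.
move=> h h' c ne; have vn := in_seg_ltl h.
elim/(rooted_ind rL): v / vn h c => v vn IH h c.
case: (boolP (seg_end v)) => [m|nm]; first by rewrite (in_seg_of_end h m) (conn_anc c).
case: (eqVneq v w) => [vw|vw].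
  by rewrite vw in h; rewrite (in_seg_uniq h h') eqxx in ne.
have [d p cd] := conn_child_ex rL c vw.
have [z2 d_in] := in_seg_ex (skeleton_up cd (in_seg_skeleton h')).
have z_uniq := in_seg_uniq (in_seg_up nm (skeleton_free (in_seg_skeleton h)) p d_in) h.
by rewrite z_uniq in d_in; exact: (IH d p).
Qed.

Lemma same_segP v w : reflect (exists2 z, in_seg v z & in_seg w z) (same_seg L v w).
Proof.
apply: (iffP (hasNP _ _)) => [[z _ /andP[]]|[z vz wz]]; first by exists z.
by exists z; rewrite ?vz ?wz ?(in_seg_ltr vz).
Qed.

Lemma same_seg_in v w z : same_seg L v w -> in_seg v z -> in_seg w z.
Proof. by case/same_segP=> z' h h' hv; rewrite -(in_seg_uniq h hv). Qed.

Lemma in_same_seg v w z : in_seg v z -> in_seg w z -> same_seg L v w.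
Proof. by move=> h h'; apply/same_segP; exists z. Qed.

Lemma same_segC v w : same_seg L v w = same_seg L w v.
Proof. by apply: eq_has => z; rewrite andbC. Qed.

Lemma seg_end_count v : v < n ->
  sumN n (fun w => conn v w * seg_end w) + skeleton v <=
    2 * sumN n (fun w => conn v w * mark L w).
Proof.
elim/(rooted_ind rL)=> {}v vn IH; rewrite !(sum_conn_rec rL) //.
have [Uv|nUv] := boolP (free L v); last first.
  rewrite !mul0n add0n muln0 leqn0 eqb0; apply: contra nUv; exact: skeleton_free.
rewrite !mul1n; set ends := sumN n _; set marks := sumN n _.
pose k := sumN n (fun c => child c v && skeleton c).
have le : ends + k <= 2 * marks.
  rewrite /ends /k /marks -sumND -sumN_mull; apply: leq_sumN => c cn.
  by case p: (child c v); rewrite ?mul0n ?muln0 //= !mul1n; exact: IH.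
have hv : skeleton v -> mark L v || (0 < k).
  case/skeletonP=> w c m; case: (eqVneq v w) => [->|ne]; first by rewrite m.
  have [d p cd] := conn_child_ex rL c ne; apply/orP; right.
  apply: leq_trans (leq_sumN_term _ (child_ltl rL p)); rewrite p lt0b.
  by apply/skeletonP; exists w.
rewrite /seg_end Uv /= -/k; move: hv le; case: (mark L v) => /=;
  case: (skeleton v) => /= hv le; lia.
Qed.

Lemma hanging_rootP v y :
  reflect [/\ conn y v, ~~ skeleton y & exists2 p, child y p & skeleton p] (hanging_root L v y).
Proof.
apply: (iffP and3P) => -[yv ny top]; split=> //.
  by case/hasNP: top => p _ /andP[]; exists p.
by case: top => p p1 p2; apply/hasNP; exists p; rewrite ?p1 ?(child_ltr rL p1).
Qed.

Lemma hanging_root_lt v y : hanging_root L v y -> y < n.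
Proof. by case/hanging_rootP=> /(conn_ltl rL). Qed.

Lemma hanging_root_ex r x : conn r x -> skeleton r -> ~~ skeleton x ->
  exists y, hanging_root L x y.
Proof.
move=> crx hr; move Ek : (dep x) => k; elim: k x Ek crx => [|k IH] x Ek crx nx.
  have r_eq : r = x by apply: (anc_eq rL (conn_anc crx)); rewrite Ek.
  by rewrite -r_eq hr in nx.
have ne : r != x by apply: contraNneq nx => <-.
have xn := conn_ltr rL crx; have Ux := (conn_free rL crx).2.
have p := anc_neq_child rL (conn_anc crx) ne.
have [crp cpx] := conn_split rL crx (anc_to_par rL (conn_anc crx) ne) (anc_par rL xn).
case: (boolP (skeleton (par x))) => [hp|np].
  by exists x; apply/hanging_rootP; split=> //; [exact: (conn_refl rL)|exists (par x)].
have [|y /hanging_rootP[y1 y2 y3]] := IH (par x) _ crp np; first by rewrite (dep_par rL) // Ek.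
by exists y; apply/hanging_rootP; split=> //; exact: (conn_trans rL y1 cpx).
Qed.

Lemma hanging_root_mid v w y :
  hanging_root L v y -> conn w v -> ~~ skeleton w -> hanging_root L w y.
Proof.
case/hanging_rootP=> y1 y2 [p p1 p2] wv nw; apply/hanging_rootP; split=> //; last by exists p.
have yw : anc y w.
  case/orP: (anc_total rL (conn_anc y1) (conn_anc wv)) => // wy.
  case: (eqVneq w y) => [->|ne]; first exact: (anc_refl rL (conn_ltl rL y1)).
  have [cwy _] := conn_split rL wv wy (conn_anc y1).
  have wp : anc w p by rewrite -(child_par rL p1); exact: (anc_to_par rL wy ne).
  have [cwp _] := conn_split rL cwy wp (child_anc rL p1).
  by rewrite (skeleton_up cwp p2) in nw.
by have [] := conn_split rL y1 yw (conn_anc wv).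
Qed.

Lemma hanging_root_uniq v y y' : hanging_root L v y -> hanging_root L v y' -> y = y'.
Proof.
move=> h h'; have /hanging_rootP[y1 y2 _] := h; have /hanging_rootP[y1' y2' _] := h'.
have /hanging_rootP[k1 _ _] := hanging_root_mid h y1' y2'.
have /hanging_rootP[k2 _ _] := hanging_root_mid h' y1 y2.
exact: (anc_anti rL (conn_anc k1) (conn_anc k2)).
Qed.

End Segments.

(** * Paths at one level *)

(* The path between [s] and [t] with topmost vertex [a], as the set of the lower end
   points of its edges. *)
Definition tree_path (T : tree) a s t v := [&& anc T a v, v != a & anc T v s || anc T v t].

Lemma tree_pathC T a s t v : tree_path T a s t v = tree_path T a t s v.
Proof. by rewrite /tree_path orbC. Qed.

Record level_path (L : level) a s t : Prop := LevelPath {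
  level_path_l : anc L a s;
  level_path_r : anc L a t;
  level_path_lca : forall v, anc L v s -> anc L v t -> anc L v a;
  level_path_free : forall v, anc L a v -> anc L v s || anc L v t -> free L v;
  level_path_mark : exists m, [/\ anc L a m, anc L m s || anc L m t & mark L m]
}.

Lemma level_pathC L a s t : level_path L a s t -> level_path L a t s.
Proof.
case=> l r lca is_free [m [m1 m2 m3]]; split=> //.
- by move=> v v1 v2; apply: lca.
- by move=> v v1 v2; apply: is_free => //; rewrite orbC.
by exists m; split=> //; rewrite orbC.
Qed.

Section PathCounts.
Variables (L : level) (a s t : nat) (F : pred nat).
Local Notation n := (tree_size L).
Local Notation inP := (tree_path L a s t).

Definition partial_seg z :=
  hasN n (fun w => in_seg L w z && inP w) && hasN n (fun w => in_seg L w z && ~~ inP w).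

Definition full_seg z := [&& seg_end L z, ~~ partial_seg z & inP z].

Definition path_count := sumN n (fun w => inP w && F w).
Definition side_count x := sumN n (fun w => [&& anc L a w, anc L w x, ~~ skeleton L w & F w]).
Definition seg_count z := sumN n (fun w => in_seg L w z && F w).
Definition piece_count z := sumN n (fun w => [&& in_seg L w z, inP w & F w]).
Definition full_count := sumN n (fun z => full_seg z * seg_count z).

End PathCounts.

Section LevelPath.
Variables (L : level) (par dep : nat -> nat).
Hypothesis rL : rooted L par dep.
Local Notation n := (tree_size L).
Local Notation anc := (anc L).
Local Notation conn := (conn L).
Local Notation skeleton := (skeleton L).
Local Notation seg_end := (seg_end L).
Local Notation in_seg := (in_seg L).

Variables a s t : nat.
Hypothesis P : level_path L a s t.
Local Notation inP := (tree_path L a s t).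
Local Notation partial_seg := (partial_seg L a s t).

Lemma level_path_ltl : s < n.
Proof. exact: (anc_ltr rL (level_path_l P)). Qed.

Lemma level_path_conn v : anc a v -> anc v s || anc v t -> conn a v.
Proof.
move=> av vst; apply/(connP rL); split=> // y ay yv; apply: (level_path_free P) => //.
by case/orP: vst => h; rewrite (anc_trans rL yv h) ?orbT.
Qed.

Lemma level_path_connl : conn a s.
Proof.
apply: level_path_conn (level_path_l P) _.
by rewrite (anc_refl rL) // (anc_ltr rL (level_path_l P)).
Qed.

Lemma level_path_connr : conn a t.
Proof.
apply: level_path_conn (level_path_r P) _.
by rewrite (anc_refl rL) ?orbT // (anc_ltr rL (level_path_r P)).
Qed.

Lemma tree_path_conn w : inP w -> conn a w.
Proof. by case/and3P=> aw _; exact: level_path_conn. Qed.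

Lemma level_path_skeleton : skeleton a.
Proof.
have [m [am mst Mm]] := level_path_mark P.
by apply/(skeletonP rL); exists m => //; exact: level_path_conn.
Qed.

(** ** The segments that a path meets partially *)

(* [z] is the segment that the path leaves towards [x]. *)
Definition exits_seg x z :=
  hasN n (fun w => [&& in_seg w z, anc w x, anc a w, w != a & ~~ anc z x]).

Lemma exits_segI x z w : in_seg w z -> anc w x -> anc a w -> w != a -> ~~ anc z x ->
  exits_seg x z.
Proof.
move=> wz wx aw wa zx; apply/hasNP; exists w; first exact: (anc_ltl rL wx).
by rewrite wz wx aw wa zx.
Qed.

Lemma exits_seg_uniq x z z' : conn a x -> exits_seg x z -> exits_seg x z' -> z = z'.
Proof.
move=> cax /hasNP[w _ /and5P[h wx aw wa zx]] /hasNP[w' _ /and5P[h' wx' aw' wa' zx']].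
apply/eqP; apply: contraT => ne.
have [_ cw] := conn_split rL cax aw wx; have [_ cw'] := conn_split rL cax aw' wx'.
case/orP: (anc_total rL wx wx') => ww.
  have [cww _] := conn_split rL cw ww wx'.
  by rewrite (anc_trans rL (seg_end_anc rL h h' cww ne) wx') in zx.
have [cww _] := conn_split rL cw' ww wx; rewrite eq_sym in ne.
by rewrite (anc_trans rL (seg_end_anc rL h' h cww ne) wx) in zx'.
Qed.

Lemma partial_segP z : reflect
  ((exists2 w, in_seg w z & inP w) /\ (exists2 w, in_seg w z & ~~ inP w)) (partial_seg z).
Proof.
apply: (iffP andP) => [[/hasNP[w _ /andP[w1 w2]] /hasNP[v _ /andP[v1 v2]]]|].
  by split; [exists w|exists v].
case=> [[w w1 w2] [v v1 v2]]; split; apply/hasNP.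
  by exists w; rewrite ?w1 ?(in_seg_ltl rL w1).
by exists v; rewrite ?v1 ?(in_seg_ltl rL v1).
Qed.

Lemma partial_seg_lt z : partial_seg z -> z < n.
Proof. by case/partial_segP=> -[w /(in_seg_ltr rL)]. Qed.

Lemma partial_segN z w : in_seg w z -> ~~ partial_seg z -> inP w = inP z.
Proof.
move=> hw np; have hz := in_seg_refl rL (in_seg_ltr rL hw) (in_seg_end hw).
apply/idP/idP => h; apply: contraT => h'; case/negP: np; apply/partial_segP.
  by split; [exists w|exists z].
by split; [exists z|exists w].
Qed.

(* The path covers exactly the vertices of the segment [z] that are ahead of [v]; the
   uncovered vertex makes [v] unique. *)
Definition partial_end up z v :=
  [/\ in_seg v z, forall w, in_seg w z -> inP w = ahead L up v w &
      exists w, [/\ in_seg w z, ~~ ahead L up v w & conn a w]].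

Lemma partial_end_down z : in_seg a z -> a != z ->
  (forall w, in_seg w z -> anc w s || anc w t) -> exists v, partial_end false z v.
Proof.
move=> ha az hst; have [v p vz] := anc_child_ex rL (in_seg_anc ha) az.
have hv := in_seg_mid rL ha (child_anc rL p) vz; exists v; split=> //.
  move=> w hw; rewrite /tree_path hst // andbT; apply/andP/idP => [[aw wa]|vw].
    apply: (anc_chain rL vz (in_seg_anc hw)); rewrite (child_dep rL p).
    by apply: (anc_ltn_dep rL) aw _; rewrite eq_sym.
  split; first exact: (anc_trans rL (child_anc rL p) vw).
  by apply: contraTneq vw => ->; exact: (child_not_anc rL p).
exists a; split=> //; first exact: (child_not_anc rL p).
exact: (conn_refl rL (skeleton_lt rL level_path_skeleton)
  (skeleton_free rL level_path_skeleton)).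
Qed.

(* Between the top of the path and a mark on it there is a segment end. *)
Lemma in_seg_top_not_below z : in_seg a z -> anc z s || anc z t.
Proof.
move=> ha; have [m [am mst Mm]] := level_path_mark P.
have cam := level_path_conn am mst; have mn := conn_ltr rL cam.
have endm : seg_end m by apply/andP; split; [exact: (conn_free rL cam).2|rewrite Mm].
have zm : anc z m.
  case: (eqVneq z m) => [->|ne]; first exact: (anc_refl rL).
  exact: (seg_end_anc rL ha (in_seg_refl rL mn endm) cam ne).
by case/orP: mst => h; rewrite (anc_trans rL zm h) ?orbT.
Qed.

Lemma lowest_common z x w : in_seg w z -> anc w x ->
  exists v, [/\ in_seg v z, anc v x, anc w v & forall u, in_seg u z -> anc u x -> anc u v].
Proof.
move=> hw wx; pose Q (i : 'I_n) := in_seg i z && anc i x.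
have Qw : Q (Ordinal (anc_ltl rL wx)) by rewrite /Q /= hw wx.
case: (arg_maxnP (fun i : 'I_n => dep i) Qw) => v /andP[hv vx] vmax.
have low u : in_seg u z -> anc u x -> anc u v.
  move=> hu ux; apply: (anc_chain rL ux vx).
  by apply: (vmax (Ordinal (anc_ltl rL ux))); rewrite /Q /= hu ux.
by exists v; split=> //; exact: low.
Qed.

Lemma partial_end_up x x' z w : level_path L a x x' -> inP =1 tree_path L a x x' ->
  (anc z s || anc z t = anc z x || anc z x') ->
  ~~ anc z x -> ~~ anc z x' -> in_seg w z -> anc w x -> anc a w -> w != a ->
  exists v, partial_end true z v.
Proof.
move=> Pxx inPE stE zx zx' hw wx aw wa.
have [v [hv vx wv low]] := lowest_common hw wx; exists v; split=> //; last first.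
  exists z; split; first exact: (in_seg_refl rL (in_seg_ltr rL hw) (in_seg_end hw)).
    by apply: contra zx => zv; exact: (anc_trans rL zv vx).
  have iw : inP w by rewrite inPE /tree_path aw wa wx.
  exact: (conn_trans rL (tree_path_conn iw) (in_seg_conn hw)).
move=> u hu; rewrite inPE; apply/idP/idP => [/and3P[au ua /orP[ux|ux']]|uv].
- exact: low.
- case/orP: (anc_total rL (in_seg_anc hw) (in_seg_anc hu)) => wu.
    have wa' := level_path_lca Pxx wx (anc_trans rL wu ux').
    by rewrite (anc_anti rL wa' aw) eqxx in wa.
  exact: (anc_trans rL wu wv).
have ux := anc_trans rL uv vx; rewrite /tree_path ux /= andbT.
case: (boolP (anc u a)) => [ua|nua]; last first.
  have au : anc a u.
    by case/orP: (anc_total rL ux (anc_trans rL aw wx)) => // h; rewrite h in nua.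
  by rewrite au /=; apply: contraNneq nua => ->; exact: (anc_refl rL (anc_ltl rL aw)).
have ha := in_seg_mid rL hu ua (anc_trans rL aw (in_seg_anc hw)).
by have := in_seg_top_not_below ha; rewrite stE (negPf zx) (negPf zx').
Qed.

Lemma partial_seg_cases z : partial_seg z ->
  (in_seg a z || exits_seg s z || exits_seg t z) /\ exists up v, partial_end up z v.
Proof.
move=> /partial_segP[[w hw /and3P[aw wa wst]] [w0 hw0 nw0]].
case: (boolP (anc z s || anc z t)) => [zst|/norP[zs zt]].
  have st v : in_seg v z -> anc v s || anc v t.
    by move=> hv; case/orP: zst => h; rewrite (anc_trans rL (in_seg_anc hv) h) ?orbT.
  have az : anc a z := anc_trans rL aw (in_seg_anc hw).
  have az' : a != z.
    apply: contraNneq wa => E; rewrite -E in hw.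
    by rewrite (anc_anti rL aw (in_seg_anc hw)).
  have ha : in_seg a z.
    move: nw0; rewrite /tree_path (st _ hw0) andbT negb_and negbK => /orP[naw0|/eqP <-//].
    apply: (in_seg_mid rL hw0 _ az).
    by case/orP: (anc_total rL az (in_seg_anc hw0)) => // h; rewrite h in naw0.
  by split; [rewrite ha|exists false; exact: partial_end_down].
case/orP: wst => wx.
  split; first by rewrite (exits_segI hw wx aw wa zs) orbT.
  by exists true; apply: (partial_end_up P _ _ zs zt hw).
split; first by rewrite (exits_segI hw wx aw wa zt) !orbT.
exists true; apply: (partial_end_up (level_pathC P) _ _ zt zs hw) => //.
  by move=> v; exact: tree_pathC.
by rewrite orbC.
Qed.

Lemma partial_seg_count : sumN n partial_seg <= 3.
Proof.
apply: (@leq_trans (sumN n (in_seg a) + sumN n (exits_seg s) + sumN n (exits_seg t))).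
  rewrite -!sumND; apply: leq_sumN => z _; case pz: (partial_seg z) => //.
  by have [/orP[/orP[]|] ->] := partial_seg_cases pz; lia.
have top_le1 : sumN n (in_seg a) <= 1.
  by apply: sumN_le1 => i j _ _; exact: (in_seg_uniq rL).
have exit_le1 x : conn a x -> sumN n (exits_seg x) <= 1.
  by move=> cax; apply: sumN_le1 => i j _ _; exact: exits_seg_uniq.
have := exit_le1 s level_path_connl; have := exit_le1 t level_path_connr; lia.
Qed.

(** ** Splitting a path into pieces *)

Section Counts.
Variable F : pred nat.
Local Notation side_count := (side_count L a F).
Local Notation piece_count := (piece_count L a s t F).
Local Notation full_count := (full_count L a s t F).
Local Notation path_count := (path_count L a s t F).

Lemma sum_piece_count_skeleton :
  sumN n piece_count = sumN n (fun w => skeleton w && (inP w && F w)).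
Proof.
rewrite /piece_count exchange_sumN; apply: eq_sumN => w wn.
case: (boolP (skeleton w)) => [hw|nw] /=.
  have [z hz] := in_seg_ex rL hw; rewrite (sumN_only (in_seg_ltr rL hz)) ?hz // => z' _ ne.
  by case h: (in_seg w z') => //; rewrite (in_seg_uniq rL h hz) eqxx in ne.
rewrite sumN_eq0 // => z _; case h: (in_seg w z) => //.
by rewrite (in_seg_skeleton rL h) in nw.
Qed.

Lemma sum_piece_countE :
  sumN n piece_count = full_count + sumN n (fun z => partial_seg z * piece_count z).
Proof.
rewrite /full_count -sumND; apply: eq_sumN => z _; rewrite /full_seg.
have [pz|npz] /= := boolP (partial_seg z); first by rewrite andbF mul1n.
rewrite mul0n addn0; have [_|nmz] /= := boolP (seg_end z); last first.
  by apply: sumN_eq0 => w _; case h: (in_seg w z) => //; rewrite (in_seg_end h) in nmz.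
rewrite -sumN_mull; apply: eq_sumN => w _.
by case h: (in_seg w z); rewrite ?muln0 //= (partial_segN h npz) mulnb.
Qed.

Lemma path_count_le : path_count <=
  full_count + (side_count s + side_count t + sumN n (fun z => partial_seg z * piece_count z)).
Proof.
rewrite addnCA -sum_piece_countE sum_piece_count_skeleton /side_count /path_count -!sumND.
apply: leq_sumN => w _; case: (boolP (inP w)) => //= /and3P[aw wa wst]; case: (F w) => //=.
by case: (boolP (skeleton w)) => hw //=; rewrite ?aw /=; case/orP: wst => -> //=; lia.
Qed.

Lemma sum_piece_count_le : sumN n piece_count <= path_count.
Proof. by rewrite sum_piece_count_skeleton; apply: leq_sumN => w _; case: (skeleton w). Qed.

Lemma full_piece_count_le z : partial_seg z -> full_count + piece_count z <= path_count.
Proof.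
move=> pz; apply: leq_trans sum_piece_count_le; rewrite sum_piece_countE leq_add2l.
have := leq_sumN_term (fun z => partial_seg z * piece_count z) (partial_seg_lt pz).
by rewrite pz mul1n.
Qed.

Lemma full_count_le : full_count <= path_count.
Proof. by apply: leq_trans sum_piece_count_le; rewrite sum_piece_countE leq_addr. Qed.

Lemma side_count_le : side_count s <= path_count.
Proof.
apply: leq_sumN => w _; case: (boolP [&& _, _, _ & _]) => // /and4P[aw ws nw Fw].
rewrite /tree_path aw ws Fw /= andbT; have -> // : w != a.
by apply: contraNneq nw => ->; exact: level_path_skeleton.
Qed.

End Counts.
End LevelPath.

(** * Chains in a rooted tree *)

(* A forest given by its partial parent function [next] and its proper ancestors
   [above]; the rank witnesses that there is no cycle. *)
Record forest n (N : pred nat) (next above : rel nat) (rank : nat -> nat) : Prop := Forest {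
  forest_lt : forall v, N v -> v < n;
  forest_next : forall v p, next v p -> N v /\ N p;
  forest_next_uniq : forall v p p', next v p -> next v p' -> p = p';
  forest_rank : forall v p, next v p -> rank p < rank v;
  forest_rank_lt : forall v, v < n -> rank v < n;
  forest_above : forall v w, above v w <-> exists2 p, next v p & w = p \/ above p w
}.

Definition above_count n (above : rel nat) (F : pred nat) v := sumN n (fun w => above v w && F w).

Definition chain_count n (above : rel nat) (F : pred nat) v := above_count n above F v + F v.

Section ForestTheory.
Variables (n : nat) (N : pred nat) (next above : rel nat) (rank : nat -> nat).
Hypothesis FR : forest n N next above rank.

Lemma forest_next_lt v p : next v p -> v < n /\ p < n.
Proof. by case/(forest_next FR) => /(forest_lt FR) vn /(forest_lt FR). Qed.

Lemma forest_above_rank v w : above v w -> rank w < rank v /\ w < n.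
Proof.
move Ek : (rank v) => k; elim/ltn_ind: k v Ek => k IH v Ek /(forest_above FR)[p vp [->|pw]].
  by rewrite -Ek (forest_rank FR vp) (forest_next_lt vp).2.
have lt := forest_rank FR vp; rewrite Ek in lt.
by have [rank_lt wn] := IH _ lt p erefl pw; split=> //; exact: ltn_trans lt.
Qed.

Lemma forest_above_irr v : ~~ above v v.
Proof. by apply/negP => /forest_above_rank[]; rewrite ltnn. Qed.

Lemma above_count_next F v p :
  next v p -> above_count n above F v = chain_count n above F p.
Proof.
move=> vp; rewrite /chain_count /above_count addnC -(sumN_pred1 F (forest_next_lt vp).2).
rewrite -sumND; apply: eq_sumN => w _.
have [->|ne] := eqVneq w p.
  have -> : above v p by apply/(forest_above FR); exists p => //; left.
  by rewrite (negPf (forest_above_irr p)) addn0.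
rewrite add0n; congr (nat_of_bool (_ && _)); apply/idP/idP => [/(forest_above FR)[p' vp' H]|pw].
  by rewrite (forest_next_uniq FR vp' vp) in H; case: H => // E; rewrite E eqxx in ne.
by apply/(forest_above FR); exists p => //; right.
Qed.

Lemma above_count_root F v : (forall p, ~~ next v p) -> above_count n above F v = 0.
Proof.
move=> root; apply: sumN_eq0 => w _; case vw: (above v w) => //.
by have /(forest_above FR)[p vp _] := vw; have := root p; rewrite vp.
Qed.

Lemma chain_count_le F v : v < n -> chain_count n above F v <= n.
Proof.
move=> vn; rewrite /chain_count; case Fv: (F v); last by rewrite addn0 sumN_pred_le.
by rewrite addn1 (sumN_pred_lt vn) // (negPf (forest_above_irr v)).
Qed.

End ForestTheory.

Section Chains.
Variables (T : tree) (up : bool) (N : pred nat) (R : rel nat).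

Definition next_vertex v p := if up then child T v p else child T p v.
Definition chain_next v p := [&& N v, N p, R v p & next_vertex v p].
Definition chain_ahead v w := [&& N v, N w, R v w, ahead T up v w & w != v].
Definition chain_rank (dep : nat -> nat) v := if up then dep v else (tree_size T).-1 - dep v.

Variables par dep : nat -> nat.
Hypothesis rT : rooted T par dep.
Local Notation n := (tree_size T).
Local Notation ahead := (ahead T up).
Local Notation rank := (chain_rank dep).

Lemma ahead_trans u v w : ahead u v -> ahead v w -> ahead u w.
Proof.
by rewrite /ahead; case: (up) => uv vw; [exact: (anc_trans rT vw uv)|exact: (anc_trans rT uv vw)].
Qed.

Lemma ahead_anti v w : ahead v w -> ahead w v -> v = w.
Proof.
by rewrite /ahead; case: (up) => vw wv; [exact: (anc_anti rT wv vw)|exact: (anc_anti rT vw wv)].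
Qed.

Lemma next_ahead v p : next_vertex v p -> ahead v p.
Proof. by rewrite /next_vertex /ahead; case: (up); exact: (child_anc rT). Qed.

Lemma next_not_ahead v p : next_vertex v p -> ~~ ahead p v.
Proof. by rewrite /next_vertex /ahead; case: (up); exact: (child_not_anc rT). Qed.

Lemma ahead_next_ex v w : ahead v w -> w != v -> exists2 p, next_vertex v p & ahead p w.
Proof.
rewrite /ahead /next_vertex; case: (up) => vw ne; last first.
  by apply: (anc_child_ex rT vw); rewrite eq_sym.
by exists (par v); [exact: (anc_neq_child rT vw ne)|exact: (anc_to_par rT vw ne)].
Qed.

Lemma rank_ahead v w z : anc T v z -> anc T w z -> rank w <= rank v -> ahead v w.
Proof.
move=> vz wz; have := rooted_dep_lt rT (anc_ltl rT vz).
have := rooted_dep_lt rT (anc_ltl rT wz).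
rewrite /chain_rank /ahead; case: (up) => dw dv le; first exact: (anc_chain rT wz vz).
by apply: (anc_chain rT vz wz); lia.
Qed.

Lemma chain_last (Q : pred nat) z w : (forall v, Q v -> anc T v z) -> Q w ->
  exists2 v, Q v & forall u, Q u -> ahead v u.
Proof.
move=> Qz Qw; have lt u (Qu : Q u) := anc_ltl rT (Qz u Qu).
case: (arg_maxnP (fun i : 'I_n => rank i) (Qw : [pred i : 'I_n | Q i] (Ordinal (lt w Qw)))).
move=> v Qv vmax; exists v => // u Qu.
by apply: (rank_ahead (Qz v Qv) (Qz u Qu)); exact: (vmax (Ordinal (lt u Qu))).
Qed.

Hypothesis N_lt : forall v, N v -> v < n.
Hypothesis R_trans : forall u v w, R u v -> R v w -> R u w.
Hypothesis R_convex : forall v u w, N v -> N w -> R v w -> ahead v u -> ahead u w ->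
  [/\ N u, R v u & R u w].
Hypothesis next_uniq : forall v p p', chain_next v p -> chain_next v p' -> p = p'.

Lemma chain_ahead_step v w :
  chain_ahead v w <-> exists2 p, chain_next v p & w = p \/ chain_ahead p w.
Proof.
split=> [/and5P[Nv Nw vRw vw ne]|[p /and4P[Nv Np vRp vp]]].
  have [p vp pw] := ahead_next_ex vw ne.
  have [Np vRp pRw] := R_convex Nv Nw vRw (next_ahead vp) pw.
  exists p; first by apply/and4P.
  by case: (eqVneq w p) => [->|ne']; [left|right; apply/and5P].
case=> [->|/and5P[_ Nw pRw pw _]]; apply/and5P; split=> //.
- exact: next_ahead.
- by apply/eqP => E; have := next_not_ahead vp; rewrite E -{2}E (next_ahead vp).
- exact: (R_trans vRp pRw).
- exact: (ahead_trans (next_ahead vp) pw).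
by apply: contraNneq (next_not_ahead vp) => <-.
Qed.

Lemma chain_forest : forest n N chain_next chain_ahead rank.
Proof.
split=> //; first by move=> v p /and4P[].
- move=> v p /and4P[Nv Np _]; rewrite /next_vertex /chain_rank.
  have := rooted_dep_lt rT (N_lt Nv); have := rooted_dep_lt rT (N_lt Np).
  by case: (up) => dp dv /(child_dep rT); lia.
- by move=> v vn; have := rooted_dep_lt rT vn; rewrite /chain_rank; case: ifP => _; lia.
exact: chain_ahead_step.
Qed.

End Chains.

Lemma chain_countE (T : tree) up (N : pred nat) (R : rel nat) par dep (F : pred nat) v :
  rooted T par dep -> v < tree_size T -> N v -> R v v ->
  chain_count (tree_size T) (chain_ahead T up N R) F v =
    sumN (tree_size T) (fun w => [&& N w, R v w, ahead T up v w & F w]).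
Proof.
move=> rT vn Nv vRv; rewrite /chain_count /above_count -(sumN_pred1 F vn) -sumND.
apply: eq_sumN => w _; rewrite /chain_ahead Nv; have [->|_] := eqVneq w v.
  by rewrite Nv vRv (ahead_refl rT) //= andbF.
by rewrite andbT addn0 !andbA.
Qed.

(** * The candidates that use the sides of the paths *)

Section SideNotions.
Variables (L : level) (coin : pred nat).
Local Notation n := (tree_size L).

(* The subtrees hanging off the skeleton are used if the coin of their root is 1. *)
Definition side_vertex v :=
  [&& free L v, ~~ skeleton L v & hasN n (fun y => hanging_root L v y && coin y)].

Definition side_linked v w := conn L w v.
Definition side_next := chain_next L true side_vertex side_linked.
Definition side_above := chain_ahead L true side_vertex side_linked.

(* The usable part of the path [P] is the chain from [v] up to the root of a hanging
   subtree. *)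
Definition side_served (P : pred nat) u v j :=
  [&& side_vertex v, allN n (fun w => side_vertex w ==> (P w == conn L w v)) & j <= u].

End SideNotions.

Section SideTheory.
Variables (L : level) (par dep : nat -> nat).
Hypothesis rL : rooted L par dep.
Variable coin : pred nat.
Local Notation n := (tree_size L).
Local Notation anc := (anc L).
Local Notation conn := (conn L).
Local Notation skeleton := (skeleton L).
Local Notation side_vertex := (side_vertex L coin).
Local Notation side_above := (side_above L coin).

Lemma side_vertexP w : reflect
  [/\ free L w, ~~ skeleton w & exists2 y, hanging_root L w y & coin y] (side_vertex w).
Proof.
apply: (iffP and3P) => -[fw nw root]; split=> //.
  by case/hasNP: root => y _ /andP[]; exists y.
by case: root => y y1 y2; apply/hasNP; exists y; rewrite ?y1 ?(hanging_root_lt rL y1).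
Qed.

Lemma side_vertex_lt w : side_vertex w -> w < n.
Proof. by case/side_vertexP=> _ _ [y /(hanging_rootP rL)[/(conn_ltr rL)]]. Qed.

Lemma side_vertex_refl w : side_vertex w -> conn w w.
Proof.
by move=> Nw; apply: (conn_refl rL (side_vertex_lt Nw)); case/side_vertexP: Nw.
Qed.

Lemma side_vertex_up v w : side_vertex v -> conn w v -> ~~ skeleton w -> side_vertex w.
Proof.
move=> /side_vertexP[_ _ [y ky cy]] wv nw; apply/side_vertexP; split=> //.
  exact: (conn_free rL wv).1.
by exists y => //; exact: (hanging_root_mid rL ky wv nw).
Qed.

Lemma side_forest :
  forest n side_vertex (side_next L coin) side_above (chain_rank L true dep).
Proof.
apply: (chain_forest rL) => [|u v w vu wv|v u w Nv Nw wv uv wu|v p p'].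
- exact: side_vertex_lt.
- exact: (conn_trans rL wv vu).
- have [wcu ucv] := conn_split rL wv wu uv; split=> //.
  apply: (side_vertex_up Nv ucv); case/side_vertexP: Nw => _ nw _.
  by apply: contra nw; exact: (skeleton_up rL wcu).
by move=> /and4P[_ _ _ /(child_par rL) <-] /and4P[_ _ _ /(child_par rL) <-].
Qed.

Lemma side_chain_countE F v : side_vertex v ->
  chain_count n side_above F v = sumN n (fun w => [&& side_vertex w, conn w v & F w]).
Proof.
move=> Nv; have vv := side_vertex_refl Nv.
rewrite (chain_countE (R := side_linked L) _ _ rL (side_vertex_lt Nv) Nv vv); apply: eq_sumN => w _.
by rewrite /side_linked; case cv: (conn w v); rewrite ?andbF //= (conn_anc cv).
Qed.

Lemma side_served_uniq P u v v' j j' :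
  side_served L coin P u v j -> side_served L coin P u v' j' -> v = v'.
Proof.
case/and3P=> Nv /allNP H _ /and3P[Nv' /allNP H' _].
have Pv : P v.
  by have := H v (side_vertex_lt Nv); rewrite Nv (side_vertex_refl Nv) => /eqP.
have Pv' : P v'.
  by have := H' v' (side_vertex_lt Nv'); rewrite Nv' (side_vertex_refl Nv') => /eqP.
have := H' v (side_vertex_lt Nv); have := H v' (side_vertex_lt Nv').
rewrite Nv Nv' Pv Pv' /= => /eqP vv' /eqP v'v.
exact: (anc_anti rL (conn_anc (esym v'v)) (conn_anc (esym vv'))).
Qed.

Lemma side_served_count P u v j (F : pred nat) : side_served L coin P u v j ->
  (forall w, w < n -> F w -> side_vertex w) ->
  sumN n (fun w => P w && F w) = chain_count n side_above F v.
Proof.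
case/and3P=> Nv /allNP H _ FN; rewrite side_chain_countE //; apply: eq_sumN => w wn.
case Fw: (F w); last by rewrite !andbF.
by have := H w wn; rewrite (FN w wn Fw) => /eqP ->.
Qed.

Section OnePath.
Variables a s t : nat.
Hypothesis P : level_path L a s t.
Local Notation inP := (tree_path L a s t).
Hypothesis coin_t : forall y, hanging_root L t y -> ~~ coin y.

Lemma side_vertex_on_path w : side_vertex w -> inP w = conn w s.
Proof.
move=> Nw; have /side_vertexP[Uw nw [y kw cy]] := Nw.
apply/idP/idP => [/and3P[aw wa /orP[ws|wt]]|cws].
- by have [] := conn_split rL (level_path_connl rL P) aw ws.
- have [_ cwt] := conn_split rL (level_path_connr rL P) aw wt.
  have nt : ~~ skeleton t by apply: contra nw; exact: (skeleton_up rL cwt).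
  have [y' ky'] := hanging_root_ex rL (level_path_connr rL P) (level_path_skeleton rL P) nt.
  have := coin_t ky'.
  by rewrite -(hanging_root_uniq rL kw (hanging_root_mid rL ky' cwt nw)) cy.
have aw : anc a w.
  case/orP: (anc_total rL (level_path_l P) (conn_anc cws)) => // wa.
  have [cwa _] := conn_split rL cws wa (level_path_l P).
  by rewrite (skeleton_up rL cwa (level_path_skeleton rL P)) in nw.
rewrite /tree_path aw (conn_anc cws) andbT /=.
by apply: contraNneq nw => ->; exact: (level_path_skeleton rL P).
Qed.

Variable y : nat.
Hypotheses (root_s : hanging_root L s y) (coin_y : coin y).

Lemma side_vertex_above w :
  anc a w -> anc w s -> ~~ skeleton w -> side_vertex w /\ conn w s.
Proof.
move=> aw ws nw; have [_ cws] := conn_split rL (level_path_connl rL P) aw ws.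
split=> //; apply/side_vertexP; split=> //; first exact: (conn_free rL cws).1.
by exists y => //; exact: (hanging_root_mid rL root_s cws nw).
Qed.

Lemma side_vertex_end : side_vertex s.
Proof.
have /(hanging_rootP rL)[ys ny _] := root_s.
have ns : ~~ skeleton s by apply: contra ny; exact: (skeleton_up rL ys).
have ss := anc_refl rL (level_path_ltl rL P).
by have [] := side_vertex_above (level_path_l P) ss ns.
Qed.

Lemma side_count_chain F : chain_count n side_above F s = side_count L a F s.
Proof.
rewrite side_chain_countE ?side_vertex_end //; apply: eq_sumN => w _.
case: (F w); rewrite ?andbF // !andbT; congr nat_of_bool; apply/andP/and3P => [[Nw cws]|].
  have := side_vertex_on_path Nw; rewrite cws => /and3P[-> _ _].
  by rewrite (conn_anc cws); case/side_vertexP: Nw.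
by case=> aw ws nw; exact: side_vertex_above.
Qed.

Lemma side_served_path (Q : pred nat) u F : (forall v, v < n -> Q v = inP v) ->
  path_count L a s t F <= u -> side_served L coin Q u s (chain_count n side_above F s).
Proof.
move=> QE le; apply/and3P; split; first exact: side_vertex_end.
  by apply/allNP => w wn; apply/implyP => Nw; rewrite QE // side_vertex_on_path.
by rewrite side_count_chain; apply: leq_trans le; exact: (side_count_le rL P).
Qed.

End OnePath.
End SideTheory.

(** * The candidates that use the segments *)

Section SegmentNotions.
Variables (L : level) (x : nat -> nat) (c : nat).
Local Notation n := (tree_size L).

(* In the component below [c], at most [x z] vertices of each segment [z] are used. *)
Definition seg_vertex v := conn L c v && hasN n (fun z => in_seg L v z && (0 < x z)).

Definition seg_capacity v j := hasN n (fun z => in_seg L v z && (j <= x z)).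

Definition seg_next up := chain_next L up seg_vertex (same_seg L).
Definition seg_ahead up := chain_ahead L up seg_vertex (same_seg L).

(* The path [P] covers exactly the vertices ahead of [v] in the segment of [v], and each
   other segment entirely or not at all. *)
Definition seg_fits up (P : pred nat) v := [&& seg_vertex v,
  allN n (fun w => seg_vertex w ==> (if same_seg L v w then P w == ahead L up v w
    else allN n (fun z => in_seg L w z ==> (P w == P z)))) &
  hasN n (fun w => [&& seg_vertex w, same_seg L v w & ~~ ahead L up v w])].

Definition other_load (P : pred nat) v :=
  sumN n (fun z => [&& conn L c z, seg_end L z, ~~ in_seg L v z & P z] * x z).

Definition seg_served up P u v j :=
  [&& allN n (fun w => P w ==> conn L c w), seg_fits up P v & j + other_load P v <= u].

Definition lower_count z v := sumN n (fun w => [&& in_seg L w z, anc L v w & w != v]).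

Definition lowest v := conn L c v && hasN n (fun z => in_seg L v z && (lower_count z v < x z)).

End SegmentNotions.

Section SegmentTheory.
Variables (L : level) (par dep : nat -> nat).
Hypothesis rL : rooted L par dep.
Variables (x : nat -> nat) (c : nat).
Local Notation n := (tree_size L).
Local Notation anc := (anc L).
Local Notation conn := (conn L).
Local Notation seg_end := (seg_end L).
Local Notation in_seg := (in_seg L).
Local Notation same_seg := (same_seg L).
Local Notation ahead := (ahead L).
Local Notation seg_vertex := (seg_vertex L x c).
Local Notation seg_ahead := (seg_ahead L x c).

Lemma seg_vertexP v : reflect (conn c v /\ exists2 z, in_seg v z & 0 < x z) (seg_vertex v).
Proof.
apply: (iffP andP) => -[cv]; first by case/hasNP=> z _ /andP[]; split=> //; exists z.
by case=> z h xz; split=> //; apply/hasNP; exists z; rewrite ?h ?(in_seg_ltr rL h).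
Qed.

Lemma seg_vertex_lt v : seg_vertex v -> v < n.
Proof. by case/seg_vertexP=> /(conn_ltr rL). Qed.

Lemma seg_vertex_seg v : seg_vertex v -> exists z, in_seg v z.
Proof. by case/seg_vertexP=> _ [z]; exists z. Qed.

Lemma seg_vertex_same v w z :
  seg_vertex v -> in_seg v z -> in_seg w z -> conn c w -> seg_vertex w.
Proof.
case/seg_vertexP=> cv [z' h' xz] h hw cw; apply/seg_vertexP; split=> //; exists z => //.
by rewrite (in_seg_uniq rL h h').
Qed.

Lemma same_seg_refl v : seg_vertex v -> same_seg v v.
Proof. by case/seg_vertex_seg=> z h; exact: (in_same_seg rL h h). Qed.

Lemma same_seg_trans u v w : same_seg u v -> same_seg v w -> same_seg u w.
Proof.
by case/(same_segP rL)=> z uz vz /(same_seg_in rL)/(_ vz); exact: (in_same_seg rL uz).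
Qed.

Lemma seg_forest up : forest n seg_vertex (seg_next L x c up) (seg_ahead up) (chain_rank L up dep).
Proof.
apply: (chain_forest rL) => [v|u v w|v u w Nv Nw vw vu uw|v p p'].
- exact: seg_vertex_lt.
- exact: same_seg_trans.
- have [z vz wz] := same_segP rL _ _ vw.
  have [cu uz] : conn c u /\ in_seg u z.
    move: vu uw; rewrite /ahead; case: up => vu uw.
      have uz := in_seg_mid rL wz uw (anc_trans rL vu (in_seg_anc vz)); split=> //.
      have /seg_vertexP[cw _] := Nw; apply: (conn_trans rL cw).
      exact: (conn_split rL (in_seg_conn wz) uw (in_seg_anc uz)).1.
    have uz := in_seg_mid rL vz vu (anc_trans rL uw (in_seg_anc wz)); split=> //.
    have /seg_vertexP[cv _] := Nv; apply: (conn_trans rL cv).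
    exact: (conn_split rL (in_seg_conn vz) vu (in_seg_anc uz)).1.
  split; [exact: seg_vertex_same Nv vz uz cu|exact: (in_same_seg rL vz uz)|].
  exact: (in_same_seg rL uz wz).
case/and4P=> _ _ /(same_segP rL)[z vz pz] vp /and4P[_ _ /(same_seg_in rL)/(_ vz) pz' vp'].
move: vp vp'; rewrite /next_vertex; case: up => vp vp'.
  by rewrite -(child_par rL vp) -(child_par rL vp').
exact: (child_uniq rL vp vp' (in_seg_anc pz) (in_seg_anc pz')).
Qed.

Lemma seg_chain_countE up F v : seg_vertex v -> chain_count n (seg_ahead up) F v =
  sumN n (fun w => [&& seg_vertex w, same_seg v w, ahead up v w & F w]).
Proof.
by move=> Nv; rewrite (chain_countE _ _ rL (seg_vertex_lt Nv) Nv (same_seg_refl Nv)).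
Qed.

Definition capacity v := sumN n (fun z => in_seg v z * x z).

Lemma capacityE v z : in_seg v z -> capacity v = x z.
Proof.
move=> h; rewrite /capacity (sumN_only (in_seg_ltr rL h)) ?h ?mul1n // => z' _ ne.
by case h': (in_seg v z') => //; rewrite (in_seg_uniq rL h' h) eqxx in ne.
Qed.

Lemma seg_capacity_leq v j : seg_vertex v -> j <= capacity v -> seg_capacity L x v j.
Proof.
case/seg_vertexP=> _ [z h _]; rewrite (capacityE h) => le; apply/hasNP; exists z.
  exact: (in_seg_ltr rL h).
by rewrite h.
Qed.

Section Fit.
Variables (up : bool) (P F : pred nat).
Local Notation seg_fits := (seg_fits L x c up P).
Local Notation count := (chain_count n (seg_ahead up) F).

Lemma seg_fits_vertex v : seg_fits v -> seg_vertex v. Proof. by case/and3P. Qed.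

Lemma seg_fits_same v w : seg_fits v -> seg_vertex w -> same_seg v w -> P w = ahead up v w.
Proof.
case/and3P=> _ /allNP H _ Nw s.
by have := H w (seg_vertex_lt Nw); rewrite Nw s => /eqP.
Qed.

Lemma seg_fits_other v w z :
  seg_fits v -> seg_vertex w -> ~~ same_seg v w -> in_seg w z -> P w = P z.
Proof.
case/and3P=> _ /allNP H _ Nw s hw.
have := H w (seg_vertex_lt Nw); rewrite Nw (negPf s) /=.
by move/allNP/(_ z (in_seg_ltr rL hw)); rewrite hw => /eqP.
Qed.

Lemma seg_fits_on_path v : seg_fits v -> P v.
Proof.
move=> g; have Nv := seg_fits_vertex g.
by rewrite (seg_fits_same g Nv (same_seg_refl Nv)) (ahead_refl rL) ?seg_vertex_lt.
Qed.

Lemma seg_fits_uniq v v' : seg_fits v -> seg_fits v' -> v = v'.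
Proof.
move=> g g'; have Nv := seg_fits_vertex g; have Nv' := seg_fits_vertex g'.
have [s|ns] := boolP (same_seg v v').
  apply: (ahead_anti rL (up := up)); first by rewrite -(seg_fits_same g Nv' s) seg_fits_on_path.
  by rewrite -(seg_fits_same g' Nv) ?seg_fits_on_path // same_segC.
(* The path meets the segment of [v'] partially, but [v] does not allow that. *)
have /and3P[_ _ /hasNP[w wn /and3P[Nw s' nch]]] := g'.
have [z hv' hw] := same_segP rL _ _ s'.
have ns2 : ~~ same_seg v w.
  by apply: contra ns => vw; apply: (same_seg_trans vw); rewrite same_segC.
have := seg_fits_same g' Nw s'; rewrite (negPf nch).
by rewrite (seg_fits_other g Nw ns2 hw) -(seg_fits_other g Nv' ns hv') seg_fits_on_path.
Qed.

Hypothesis F_vertex : forall w, w < n -> F w -> seg_vertex w.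
Hypothesis F_capacity : forall w, w < n -> F w -> seg_capacity L x w (count w).

Lemma seg_load_le z : sumN n (fun w => in_seg w z && F w) <= x z.
Proof.
case: (boolP (hasN n (fun w => in_seg w z && F w))) => [/hasNP[w0 _ w0F]|no]; last first.
  rewrite sumN_eq0 // => w wn; apply/eqP; rewrite eqb0; apply: contra no => hw.
  by apply/hasNP; exists w.
have [|v /andP[hv Fv] vlast] := chain_last up rL (Q := fun w => in_seg w z && F w) (z := z) _ w0F.
  by move=> w /andP[/in_seg_anc].
have vn := in_seg_ltl rL hv; have Nv := F_vertex vn Fv.
have /hasNP[z' _ /andP[hv' le]] := F_capacity vn Fv.
rewrite (in_seg_uniq rL hv hv'); apply: leq_trans le.
rewrite seg_chain_countE //; apply: leq_sumN => w wn.
case hw: (in_seg w z') => //=; case Fw: (F w) => //.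
rewrite F_vertex // (in_same_seg rL hv' hw) vlast // Fw andbT.
by rewrite (in_seg_uniq rL hv hv').
Qed.

Lemma seg_fits_chain_count v : seg_fits v ->
  count v = sumN n (fun w => [&& same_seg v w, P w & F w]).
Proof.
move=> g; rewrite seg_chain_countE ?seg_fits_vertex //; apply: eq_sumN => w wn.
case Fw: (F w); rewrite ?andbF // !andbT (F_vertex wn Fw) /=.
by case s: (same_seg v w); rewrite //= (seg_fits_same g (F_vertex wn Fw) s).
Qed.

Lemma seg_fits_count v : seg_fits v ->
  count v <= sumN n (fun w => P w && F w) <= count v + other_load L x c P v.
Proof.
move=> g; have split_seg : sumN n (fun w => P w && F w) =
    count v + sumN n (fun w => [&& ~~ same_seg v w, P w & F w]).
  rewrite seg_fits_chain_count // -sumND; apply: eq_sumN => w _.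
  by case: (same_seg v w); rewrite /= ?addn0 ?add0n.
rewrite split_seg leq_addr leq_add2l /=.
pose other z := [&& conn c z, seg_end z, ~~ in_seg v z & P z].
apply: (@leq_trans (sumN n (fun z => other z * sumN n (fun w => in_seg w z && F w)))); last first.
  by apply: leq_sumN => z _; rewrite leq_mul2l seg_load_le orbT.
rewrite (@eq_sumN _ (fun z => _ * sumN _ _)
  (fun z => sumN n (fun w => other z * (in_seg w z && F w)))) => [|z _]; last first.
  by rewrite sumN_mull.
rewrite exchange_sumN; apply: leq_sumN => w wn.
case: (boolP [&& _, _ & _]) => // /and3P[ns Pw Fw]; have Nw := F_vertex wn Fw.
have /seg_vertexP[cw [z hw _]] := Nw.
apply: leq_trans (leq_sumN_term _ (in_seg_ltr rL hw)).
rewrite /other (conn_trans rL cw (in_seg_conn hw)) (in_seg_end hw) hw Fw.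
rewrite -(seg_fits_other g Nw ns hw) Pw andbT /=.
by case hvz: (in_seg v z) => //; rewrite (in_same_seg rL hvz hw) in ns.
Qed.

End Fit.

Lemma lower_count_anc z v w : in_seg w z -> anc v w -> v != w ->
  lower_count L z w < lower_count L z v.
Proof.
move=> hw vw ne; rewrite /lower_count !sumN_card; apply: proper_card; apply/properP; split.
  apply/fintype.subsetP => y; rewrite !inE => /and3P[hy wy ny].
  rewrite hy (anc_trans rL vw wy) /=; apply: contraNneq ne => E.
  by rewrite (anc_anti rL vw) // -E.
exists (Ordinal (in_seg_ltl rL hw)); rewrite !inE ?eqxx ?andbF //.
by rewrite hw vw eq_sym.
Qed.

Lemma lower_count_inj z v w : in_seg v z -> in_seg w z ->
  lower_count L z v = lower_count L z w -> v = w.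
Proof.
move=> hv hw E; apply/eqP; apply: contraT => ne.
case/orP: (anc_total rL (in_seg_anc hv) (in_seg_anc hw)) => h.
  by have := lower_count_anc hw h ne; rewrite E ltnn.
by rewrite eq_sym in ne; have := lower_count_anc hv h ne; rewrite E ltnn.
Qed.

Lemma lowest_in_seg_count z k : k <= sumN n (fun w => in_seg w z) ->
  sumN n (fun v => in_seg v z && (lower_count L z v < k)) = k.
Proof.
pose S := [set v : 'I_n | in_seg v z].
rewrite sumN_card -/S => kS.
rewrite -[RHS](card_rank_lt (rank := fun v : 'I_n => lower_count L z v) _ _ kS).
- by rewrite sumN_card; apply: eq_card => v; rewrite !inE.
- by move=> v w; rewrite !inE => hv hw /(lower_count_inj hv hw)/val_inj.
move=> v vS; rewrite /lower_count sumN_card; apply: proper_card; apply/properP; split.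
  by apply/fintype.subsetP => w; rewrite !inE => /and3P[].
by exists v => //; rewrite !inE eqxx !andbF.
Qed.

Lemma lowestE w : conn c w ->
  (lowest L x c w : nat) = sumN n (fun z => in_seg w z && (lower_count L z w < x z)).
Proof.
move=> cw; rewrite /lowest cw /=; case: (boolP (hasN n _)) => [/hasNP[z zn hz]|no].
  rewrite (sumN_only zn) ?hz // => z' _ ne; apply/eqP; rewrite eqb0.
  apply/negP => /andP[h' _]; case/andP: hz => h _.
  by rewrite (in_seg_uniq rL h' h) eqxx in ne.
rewrite sumN_eq0 // => z zn; apply/eqP; rewrite eqb0; apply: contra no => hz.
by apply/hasNP; exists z.
Qed.

Section OnePath.
Variables a s t : nat.
Hypothesis P : level_path L a s t.
Local Notation inP := (tree_path L a s t).
Local Notation partial_seg := (partial_seg L a s t).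
Variables (Q F : pred nat).
Hypothesis QE : forall w, w < n -> Q w = inP w.
Hypothesis ca : conn c a.
Hypothesis x_le : forall z, conn c z -> seg_end z -> x z <= seg_count L F z.

Lemma tree_path_in_comp w : inP w -> conn c w.
Proof. by move=> iw; exact: (conn_trans rL ca (tree_path_conn rL P iw)). Qed.

Section PartialPiece.
Variables (up : bool) (z v : nat).
Hypothesis v_end : partial_end L a s t up z v.
Hypothesis xz_gt0 : 0 < x z.
Hypothesis x_other : forall z', z' != z -> partial_seg z' -> x z' = 0.

Lemma partial_end_vertex : seg_vertex v.
Proof.
have [hv Hv _] := v_end; apply/seg_vertexP; split; last by exists z.
by apply: tree_path_in_comp; rewrite Hv // (ahead_refl rL) // (in_seg_ltl rL hv).
Qed.

Lemma partial_end_fits : seg_fits L x c up Q v.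
Proof.
have [hv Hv [w0 [hw0 nw0 cw0]]] := v_end; have Nv := partial_end_vertex.
apply/and3P; split=> //; last first.
  have Nw0 := seg_vertex_same Nv hv hw0 (conn_trans rL ca cw0).
  by apply/hasNP; exists w0; rewrite ?seg_vertex_lt // Nw0 (in_same_seg rL hv hw0) nw0.
apply/allNP => w wn; apply/implyP => Nw; case: ifP => [sm|ns].
  by rewrite QE // Hv //; exact: (same_seg_in rL sm hv).
apply/allNP => z' zn'; apply/implyP => hw; rewrite !QE //; apply/eqP.
have /seg_vertexP[_ [z2 wz2 xz2]] := Nw; have z_uniq := in_seg_uniq rL wz2 hw.
apply: (partial_segN rL hw); apply/negP => pz; move: xz2; rewrite z_uniq x_other // -?z_uniq.
by apply/eqP => z_eq; rewrite z_eq in wz2; rewrite (in_same_seg rL hv wz2) in ns.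
Qed.

Lemma partial_end_chain_count :
  chain_count n (seg_ahead up) F v = piece_count L a s t F z.
Proof.
have [hv Hv _] := v_end; have Nv := partial_end_vertex.
rewrite seg_chain_countE //; apply: eq_sumN => w wn.
case: (F w); rewrite ?andbF // !andbT; congr nat_of_bool.
apply/and3P/andP => [[Nw sm vw]|[hw iw]].
  by have hw := same_seg_in rL sm hv; rewrite Hv.
split; [|exact: (in_same_seg rL hv hw)|by rewrite -Hv].
exact: seg_vertex_same Nv hv hw (tree_path_in_comp iw).
Qed.

Lemma other_load_le_full : other_load L x c Q v <= full_count L a s t F.
Proof.
have [hv _ _] := v_end; apply: leq_sumN => z' zn'; rewrite QE // /full_seg.
case: (boolP (in_seg v z')) => [_|nv]; first by rewrite /= !andbF.
have ne : z' != z by apply: contraNneq nv => ->.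
case: (boolP (partial_seg z')) => pz; first by rewrite (x_other ne pz) muln0.
case: (boolP (conn c z')) => //= cz; case: (boolP (seg_end z')) => //= mz.
by rewrite leq_mul // x_le.
Qed.

Lemma partial_end_served u : partial_seg z -> path_count L a s t F <= u ->
  seg_served L x c up Q u v (minn (x z) (piece_count L a s t F z)).
Proof.
move=> pz le; apply/and3P; split; [|exact: partial_end_fits|].
  by apply/allNP => w wn; apply/implyP; rewrite QE //; exact: tree_path_in_comp.
have := full_piece_count_le rL F pz; have := other_load_le_full.
by have := geq_minr (x z) (piece_count L a s t F z); lia.
Qed.

End PartialPiece.

Lemma lowest_count : (forall z, partial_seg z -> x z = 0) ->
  sumN n (fun w => Q w && lowest L x c w) = sumN n (fun z => full_seg L a s t z * x z).
Proof.
move=> x_partial.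
transitivity (sumN n (fun w => sumN n (fun z =>
    inP w * (in_seg w z && (lower_count L z w < x z))))).
  apply: eq_sumN => w wn; rewrite QE // sumN_mull -mulnb.
  by have [/tree_path_in_comp/lowestE ->|] := boolP (inP w); rewrite ?mul0n.
rewrite exchange_sumN; apply: eq_sumN => z zn; rewrite /full_seg.
case: (boolP (partial_seg z)) => pz.
  by rewrite andbF mul0n; apply: sumN_eq0 => w _; rewrite x_partial // ltn0 andbF muln0.
case: (boolP (seg_end z)) => [mz|nmz]; last first.
  rewrite mul0n; apply: sumN_eq0 => w _; case h: (in_seg w z); rewrite ?muln0 //.
  by rewrite (in_seg_end h) in nmz.
rewrite /=; transitivity (sumN n (fun w =>
    inP z * (in_seg w z && (lower_count L z w < x z)))).
  by apply: eq_sumN => w _; case h: (in_seg w z); rewrite ?muln0 // (partial_segN rL h pz).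
rewrite sumN_mull; case: (boolP (inP z)) => [iz|_]; last by rewrite !mul0n.
rewrite lowest_in_seg_count //; apply: leq_trans (x_le (tree_path_in_comp iz) mz) _.
by apply: leq_sumN => w _; case: (in_seg w z); case: (F w).
Qed.

End OnePath.
End SegmentTheory.

(** * Guessing the budgets of the segments *)

Lemma digits_ex K (e : nat -> nat) m : 0 < K -> (forall j, e j < K) ->
  exists2 g, g < K ^ m & forall j, j < m -> (g %/ K ^ j) %% K = e j.
Proof.
move=> K0; elim: m e => [|m IH] e He; first by exists 0.
have [g gK Hg] := IH (fun j => e j.+1) (fun j => He _).
exists (g * K + e 0).
  rewrite expnS; apply: (@leq_trans (g.+1 * K)); last by rewrite mulnC leq_mul.
  by rewrite mulSn addnC ltn_add2r He.
case=> [|j] jm; first by rewrite divn1 modnMDl modn_small.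
by rewrite expnS divnMA divnMDl // [e 0 %/ K]divn_small ?He // addn0 Hg.
Qed.

(* A code [g] assigns to each segment of the component below [c] a digit in base
   [log2N n + 2], and thereby a budget, which is zero or a power of two. *)
Section Codes.
Variables (L : level) (c : nat).
Local Notation n := (tree_size L).
Local Notation conn := (conn L).
Local Notation seg_end := (seg_end L).

Definition seg_index z := sumN n (fun y => [&& y < z, conn c y & seg_end y]).

Definition seg_digit g z := (g %/ powN n (log2N n + 2) (seg_index z)) %% (log2N n + 2).

Definition seg_budget g z :=
  if seg_digit g z == 0 then 0 else powN n 2 (seg_digit g z - 1).

Definition rounded_count (coin F : pred nat) z :=
  if coin z && (0 < seg_count L F z) then 2 ^ trunc_log 2 (seg_count L F z) else 0.

Lemma rounded_count_le coin F z : rounded_count coin F z <= seg_count L F z.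
Proof. by rewrite /rounded_count; case: ifP => // /andP[_ s0]; exact: trunc_logP. Qed.

Lemma seg_count_lt_double (coin F : pred nat) z : coin z -> 0 < seg_count L F z ->
  seg_count L F z < 2 * rounded_count coin F z.
Proof. by move=> cz s0; rewrite /rounded_count cz s0 -expnS trunc_log_ltn. Qed.

Lemma seg_index_lt z z' : conn c z -> seg_end z -> z < n -> z < z' -> seg_index z < seg_index z'.
Proof.
move=> cz mz zn zz'; rewrite /seg_index -addn1 -[1](sumN_pred1 predT zn) -sumND.
apply: leq_sumN => w _; case: (ltngtP w z) => [lt|lt|->] /=; rewrite ?addn0 ?cz ?mz ?zz' //.
by rewrite (ltn_trans lt zz').
Qed.

Lemma seg_index_inj z z' : conn c z -> seg_end z -> z < n -> conn c z' -> seg_end z' -> z' < n ->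
  seg_index z = seg_index z' -> z = z'.
Proof.
move=> cz mz zn cz' mz' zn' E; case: (ltngtP z z') => // lt.
  by have := seg_index_lt cz mz zn lt; rewrite E ltnn.
by have := seg_index_lt cz' mz' zn' lt; rewrite E ltnn.
Qed.

Lemma seg_index_lt_count z : conn c z -> seg_end z -> z < n ->
  seg_index z < sumN n (fun w => conn c w * seg_end w).
Proof.
move=> cz mz zn; rewrite /seg_index -addn1 -[1](sumN_pred1 predT zn) -sumND.
apply: leq_sumN => w _; rewrite mulnb andbT.
by case: (ltngtP w z) => [_|_|->] /=; rewrite ?addn0 ?cz ?mz.
Qed.

Lemma seg_digit_ex (d : nat -> nat) : (forall z, conn c z -> z < n) ->
  (forall z, d z < log2N n + 2) ->
  exists2 g, g < (log2N n + 2) ^ sumN n (fun w => conn c w * seg_end w) &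
    forall z, conn c z -> seg_end z -> seg_digit g z = d z.
Proof.
move=> conn_lt dK; set K := log2N n + 2; have K0 : 0 < K by rewrite addn_gt0 orbT.
pose e j := sumN n (fun z => [&& conn c z, seg_end z & seg_index z == j] * d z) %% K.
have eE z : conn c z -> seg_end z -> e (seg_index z) = d z.
  move=> cz mz; rewrite /e (sumN_only (conn_lt z cz)).
    by rewrite cz mz eqxx mul1n modn_small.
  move=> z' zn' ne; case: (boolP [&& _, _ & _]) => // /and3P[cz' mz' /eqP E].
  by rewrite (seg_index_inj cz' mz' zn' cz mz (conn_lt z cz) E) eqxx in ne.
have [g gK Hg] := digits_ex (sumN n (fun w => conn c w * seg_end w)) K0
  (fun j => ltn_pmod _ K0 : e j < K).
exists g => // z cz mz; rewrite /seg_digit powNE ?sumN_pred_le // Hg ?eE //.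
exact: seg_index_lt_count (conn_lt z cz).
Qed.

Lemma seg_budget_ex coin F : 0 < n -> (forall z, conn c z -> z < n) ->
  exists2 g, g < (log2N n + 2) ^ sumN n (fun w => conn c w * seg_end w) &
    forall z, conn c z -> seg_end z -> seg_budget g z = rounded_count coin F z.
Proof.
move=> n0 conn_lt; have seg_le z : seg_count L F z <= n by exact: sumN_pred_le.
pose d z := if coin z && (0 < seg_count L F z) then (trunc_log 2 (seg_count L F z)).+1 else 0.
have [z|g gK gd] := @seg_digit_ex d conn_lt.
  rewrite /d log2NE // addn2; case: ifP => // _.
  by rewrite !ltnS; exact: leq_trunc_log.
exists g => // z cz mz; rewrite /seg_budget gd // /d /rounded_count.
case: (_ && _) => //=; rewrite subn1 /= powNE //.
apply: leq_trans (leq_trunc_log 2 (seg_le z)) _.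
exact: ltnW (trunc_log_ltn_self (ltnSn 1) n0).
Qed.

End Codes.

(** * Polynomially bounded functions *)

Definition poly_bounded (g : nat -> nat) := exists a, forall X, 0 < X -> g X <= a * X ^ a.

Lemma poly_bounded_const c : poly_bounded (fun=> c).
Proof. by exists c => X X0; rewrite leq_pmulr // expn_gt0 X0. Qed.

Lemma poly_bounded_id : poly_bounded id.
Proof. by exists 1 => X X0; rewrite mul1n expn1. Qed.

Lemma poly_bounded_add g h :
  poly_bounded g -> poly_bounded h -> poly_bounded (fun X => g X + h X).
Proof.
move=> [a g_le] [b h_le]; exists (a + b) => X X0.
rewrite mulnDl leq_add //.
  by apply: leq_trans (g_le _ X0) _; rewrite leq_mul2l leq_pexp2l ?orbT ?leq_addr.
by apply: leq_trans (h_le _ X0) _; rewrite leq_mul2l leq_pexp2l ?orbT ?leq_addl.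
Qed.

Lemma poly_bounded_mul g h :
  poly_bounded g -> poly_bounded h -> poly_bounded (fun X => g X * h X).
Proof.
move=> [a g_le] [b h_le]; exists (a * b + (a + b)) => X X0.
apply: leq_trans (leq_mul (g_le _ X0) (h_le _ X0)) _.
rewrite mulnACA -expnD leq_mul ?leq_addr // leq_pexp2l //; lia.
Qed.

Lemma poly_bounded_comp g h : (forall X, 0 < X -> 0 < h X) ->
  poly_bounded g -> poly_bounded h -> poly_bounded (fun X => g (h X)).
Proof.
move=> h_gt0 [a g_le] [b h_le]; exists (a * b ^ a + b * a) => X X0.
apply: leq_trans (g_le _ (h_gt0 _ X0)) _.
have le_pow : h X ^ a <= b ^ a * X ^ (b * a).
  by rewrite expnM -expnMn; case: (posnP a) => [->//|a0]; rewrite leq_exp2r // h_le.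
apply: (@leq_trans (a * b ^ a * X ^ (b * a))); first by rewrite -mulnA leq_mul2l le_pow orbT.
by rewrite leq_mul ?leq_addr // leq_pexp2l // leq_addl.
Qed.

Ltac solve_poly_bounded :=
  repeat first [ assumption | exact: poly_bounded_const | exact: poly_bounded_id
               | apply: poly_bounded_add | apply: poly_bounded_mul ].

Lemma bitlen_le v y : v <= 2 ^ y -> bitlen v <= y.+1.
Proof.
move=> le; rewrite /bitlen ltnS.
case: v le => [|v] le; first by rewrite trunc_log0.
by rewrite -(@trunc_expnK 2 y) // leq_trunc_log.
Qed.

Lemma bitlen_leS v : bitlen v <= v.+1.
Proof. by apply: bitlen_le; exact: ltnW (ltn_expl _ _). Qed.

(** * Running time *)

Section Runs.
Variables (R : realType) (f : nat -> R).
Implicit Types s : state R.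

Definition set_nat s A i v : state R := State (upd (nmem s) A i v) (rmem s) (coins s).

Definition set_real s A i v : state R := State (nmem s) (upd (rmem s) A i v) (coins s).

Definition runs c s T (Q : state R -> Prop) := exists t s', [/\ exec f c s t s', t <= T & Q s'].

Lemma runs_weak c s T T' (Q Q' : state R -> Prop) :
  T <= T' -> (forall s', Q s' -> Q' s') -> runs c s T Q -> runs c s T' Q'.
Proof.
move=> le QQ' [t [s' [E tT Qs']]]; exists t, s'; split=> //; first exact: leq_trans le.
exact: QQ'.
Qed.

Lemma runs_seq c1 c2 s T1 T2 (Q1 Q2 : state R -> Prop) : runs c1 s T1 Q1 ->
  (forall s1, Q1 s1 -> runs c2 s1 T2 Q2) -> runs (CSeq c1 c2) s (1 + T1 + T2) Q2.
Proof.
move=> [t1 [s1 [E1 le1 /[swap] H /H[t2 [s2 [E2 le2 Q]]]]]].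
exists (1 + t1 + t2), s2; split=> //; first exact: ExecSeq E1 E2.
by rewrite leq_add // leq_add.
Qed.

Lemma runs_set_nat A a v s i w T (Q : state R -> Prop) : aval s a = i -> aval s v = w ->
  1 + acost s a + acost s v <= T -> Q (set_nat s A i w) -> runs (CSetN A a v) s T Q.
Proof. by move=> <- <- le Qs; eexists _, _; split; [exact: ExecSetN|exact: le|]. Qed.

Lemma runs_set_real A a v s i w T (Q : state R -> Prop) : aval s a = i -> rval f s v = w ->
  1 + acost s a + rcost s v <= T -> Q (set_real s A i w) -> runs (CSetR A a v) s T Q.
Proof. by move=> <- <- le Qs; eexists _, _; split; [exact: ExecSetR|exact: le|]. Qed.

Lemma runs_if p c1 c2 s T (Q : state R -> Prop) :
  runs (if bval f s p then c1 else c2) s T Q -> runs (CIf p c1 c2) s (1 + bcost s p + T) Q.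
Proof.
move=> [t [s' [E le Qs']]]; exists (1 + bcost s p + t), s'; split=> //; first exact: ExecIf.
by rewrite leq_add2l.
Qed.

End Runs.

(** * Bounded loops *)

(* The bounds of loops are expressions in the numbers of vertices and commodities. *)
Inductive bound := BSize | BCount | BConst of nat | BAdd of bound & bound | BMul of bound & bound.

Fixpoint bound_val b (st : memory nat) : nat :=
  match b with
  | BSize => st 0 0
  | BCount => st 0 1
  | BConst c => c
  | BAdd b1 b2 => bound_val b1 st + bound_val b2 st
  | BMul b1 b2 => bound_val b1 st * bound_val b2 st
  end.
Arguments bound_val : simpl never.

Fixpoint bound_exp b : aexp :=
  match b with
  | BSize => AGet 0 (ANat 0)
  | BCount => AGet 0 (ANat 1)
  | BConst c => ANat c
  | BAdd b1 b2 => AAdd (bound_exp b1) (bound_exp b2)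
  | BMul b1 b2 => AMul (bound_exp b1) (bound_exp b2)
  end.

Fixpoint bound_cost b (X : nat) : nat :=
  match b with
  | BSize | BCount => X + 5
  | BConst c => c.+1
  | BAdd b1 b2 => (bound_cost b1 X + bound_cost b2 X) + 1 + (bound_cost b1 X + bound_cost b2 X)
  | BMul b1 b2 => (bound_cost b1 X * bound_cost b2 X) + 1 + (bound_cost b1 X + bound_cost b2 X)
  end.

Lemma poly_bounded_bound_cost b : poly_bounded (bound_cost b).
Proof. by elim: b => [||c|b1 IH1 b2 IH2|b1 IH1 b2 IH2] /=; solve_poly_bounded. Qed.

Lemma poly_bounded_loop_input b T :
  poly_bounded T -> poly_bounded (fun X => T (bound_cost b X + X)).
Proof.
move=> pT; apply: (@poly_bounded_comp T (fun X => bound_cost b X + X)) => // [X X0|].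
  by rewrite addn_gt0 X0 orbT.
by have := poly_bounded_bound_cost b => pb; solve_poly_bounded.
Qed.

(* Arrays reserved for the evaluation of definable functions, and the output array. *)
Notation nat_stack := 6 (only parsing).
Notation loop_vars := 7 (only parsing).
Notation nat_buffer := 9 (only parsing).
Notation real_stack := 0 (only parsing).
Notation real_buffer := 1 (only parsing).
Notation output_array := 5 (only parsing).

Definition CFor b m c :=
  CSeq (CSetN loop_vars (ANat m) (ANat 0))
    (CWhile (BNot (BLeN (bound_exp b) (AGet loop_vars (ANat m))))
       (CSeq c (CSetN loop_vars (ANat m) (AAdd (AGet loop_vars (ANat m)) (ANat 1))))).

Lemma runs_for (R : realType) (f : nat -> R) m b N c s (Inv : nat -> state R -> Prop) Tc Tb :
  (forall x s, x <= N -> Inv x s -> [/\ nmem s loop_vars m = x,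
     aval s (bound_exp b) = N & acost s (bound_exp b) <= Tb]) ->
  (forall x s, x < N -> Inv x s -> runs f c s Tc (fun s' =>
     nmem s' loop_vars m = x /\ Inv x.+1 (set_nat s' loop_vars m x.+1))) ->
  Inv 0 (set_nat s loop_vars m 0) ->
  runs f (CFor b m c) s (N.+1 * (Tc + Tb + 4 * N + 8 * m + 50)) (Inv N).
Proof.
move=> guard body; rewrite /CFor; set D := Tc + Tb + 4 * N + 6 * m + 40; set loop := CWhile _ _.
suff runs_loop x s1 : x <= N -> Inv x s1 -> runs f loop s1 ((N - x).+1 * D) (Inv N).
  move=> I0; pose s0 := set_nat s loop_vars m 0.
  have init := runs_set_nat f (A := loop_vars) (a := ANat m) (v := ANat 0) (s := s)
    (Q := fun s1 => s1 = s0) erefl erefl (leqnn _) erefl.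
  apply: (runs_weak _ (fun _ I => I) (runs_seq init _)); last first.
    by move=> _ ->; exact: runs_loop 0 _ (leq0n N) I0.
  by rewrite /= subn0 /D; have := bitlen_leS m; have := bitlen_leS 0; nia.
move=> xN; move Ek : (N - x) => k; elim: k x s1 xN Ek => [|k IH] x s1 xN Ek Invx.
  have [varE boundE cost_le] := guard x s1 xN Invx; have xE : x = N by lia.
  eexists _, s1; split; [| |by rewrite -xE].
    by apply: ExecWhileF; rewrite /= varE boundE negbK; lia.
  by rewrite /= varE mul1n; have := bitlen_leS m; have := bitlen_leS x; rewrite /D; lia.
have xN' : x < N by lia.
have [varE boundE cost_le] := guard x s1 xN Invx.
have [t [s2 [Ec Lc [varE2 Inv2]]]] := body x s1 xN' Invx.
have [|t2 [s3 [run3 le3 Inv3]]] := IH x.+1 _ xN' _ Inv2; first by lia.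
have incr : exec f (CSetN loop_vars (ANat m) (AAdd (AGet loop_vars (ANat m)) (ANat 1))) s2
    (1 + acost s2 (ANat m) + acost s2 (AAdd (AGet loop_vars (ANat m)) (ANat 1)))
    (set_nat s2 loop_vars m x.+1).
  have -> : x.+1 = aval s2 (AAdd (AGet loop_vars (ANat m)) (ANat 1)) by rewrite /= varE2 addn1.
  exact: ExecSetN.
eexists _, s3; split; [| |exact: Inv3].
  by apply: ExecWhileT (ExecSeq Ec incr) run3; rewrite /= varE boundE -ltnNge.
rewrite /= varE varE2 addn1; have := bitlen_leS m; have := bitlen_leS x.
have := bitlen_leS x.+1; have := bitlen_leS 1.
by move: le3; set Y := k.+1 * D => le3; rewrite mulSn -/Y /D; lia.
Qed.

(** * Definable functions *)

Inductive arith := OAdd | OSub | OMul | ODiv | OMod.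

Definition arith_val o x y :=
  match o with
  | OAdd => x + y | OSub => x - y | OMul => x * y | ODiv => x %/ y | OMod => x %% y
  end.

Definition arith_exp o :=
  match o with
  | OAdd => AAdd | OSub => ASub | OMul => AMul | ODiv => ADiv | OMod => AMod
  end.

Lemma arith_val_le o x y a b : x <= 2 ^ a -> y <= 2 ^ b -> arith_val o x y <= 2 ^ (a + b).+2.
Proof.
move=> xa yb; apply: (@leq_trans (x.+1 * y.+1)).
  case: o => /=; [lia|lia|lia| |].
    by apply: leq_trans (leq_div _ _) _; nia.
  by apply: leq_trans (leq_mod _ _) _; nia.
have -> : (a + b).+2 = a.+1 + b.+1 by lia.
rewrite expnD leq_mul // expnS; have := expn_gt0 2 a; have := expn_gt0 2 b; lia.
Qed.

Lemma aval_arith (R : realType) o (s : state R) a b :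
  aval s (arith_exp o a b) = arith_val o (aval s a) (aval s b).
Proof. by case: o. Qed.

Lemma acost_arith (R : realType) o (s : state R) a b : acost s (arith_exp o a b) =
  bitlen (arith_val o (aval s a) (aval s b)) + (acost s a + acost s b).
Proof. by case: o. Qed.

Fixpoint ctx (m : nat) : Type := if m is m'.+1 then (ctx m' * nat)%type else unit.

Fixpoint ctx_get m : ctx m -> nat -> nat :=
  if m is m'.+1 then fun e i => if i == m' then e.2 else ctx_get e.1 i else fun _ _ => 0.

Section Definable.
Variable R : realType.
Local Notation state := (state R).

(* What a run reads but never changes: the read-only arrays and the oracle. *)
Record env := Env { env_mem : memory nat; oracle : nat -> R }.
Coercion env_mem : env >-> memory.

Record tables := Tables { btab : nat -> nat -> bool; rtab : nat -> nat -> R }.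

Definition scratch (A : nat) := [|| A == nat_stack, A == loop_vars | A == nat_buffer].

(* The output array and the arrays from [lim] on are Boolean and writable; the others
   are read-only. *)
Definition writable (lim A : nat) := (A == output_array) || (lim <= A).

Definition bounded_input X (st : memory nat) :=
  [/\ 0 < X, st 0 0 <= X, st 0 1 <= X & forall A j, st A j <= 2 ^ X].

Definition represents lim (st : memory nat) (d : tables) (s : state) :=
  (forall A j : nat, ~~ scratch A ->
     nmem s A j = if writable lim A then btab d A j : nat else st A j) /\
  (forall A j, real_buffer < A -> rmem s A j = rtab d A j).

(* [loc] assigns to each context variable its cell among the loop variables. *)
Record valid X lim (st : memory nat) d m (loc : nat -> nat) (e : ctx m) s : Prop := Valid {
  valid_bounded : bounded_input X st;
  valid_represents : represents lim st d s;
  valid_ctx : forall i, i < m ->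
    nmem s loop_vars (loc i) = ctx_get e i /\ ctx_get e i <= 2 ^ X
}.

Definition preserves m k (s s' : state) :=
  [/\ coins s' = coins s,
      forall A i, ~~ ((A == nat_stack) && (k <= i) || (A == loop_vars) && (m <= i)) ->
        nmem s' A i = nmem s A i &
      forall A i, ~~ ((A == real_stack) && (k <= i)) -> rmem s' A i = rmem s A i].

Lemma preserves_weak m k m1 k1 s s' :
  m <= m1 -> k <= k1 -> preserves m1 k1 s s' -> preserves m k s s'.
Proof.
move=> mm kk [c n r]; split=> // A i H; [apply: n|apply: r]; apply: contra H.
  by case/orP=> /andP[-> le]; apply/orP; [left|right]; lia.
by case/andP=> -> le; lia.
Qed.

Lemma preserves_trans m k s1 s2 s3 :
  preserves m k s1 s2 -> preserves m k s2 s3 -> preserves m k s1 s3.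
Proof.
move=> [c1 n1 r1] [c2 n2 r2]; split=> [|A i H|A i H]; first by rewrite c2.
  by rewrite n2 ?n1.
by rewrite r2 ?r1.
Qed.

Lemma preserves_set_nat m k s A i v :
  (A == nat_stack) && (k <= i) || (A == loop_vars) && (m <= i) ->
  preserves m k s (set_nat s A i v).
Proof.
move=> Ai; split=> // B j H; rewrite /= /upd; case: eqP => //= BA; case: eqP => // ji.
by rewrite BA ji Ai in H.
Qed.

Lemma preserves_set_real m k s i v : k <= i -> preserves m k s (set_real s real_stack i v).
Proof.
move=> ki; split=> // B j H; rewrite /= /upd; case: eqP => //= BA; case: eqP => // ji.
by rewrite BA ji ki in H.
Qed.

Lemma preserves_stack m k s s' : preserves m k.+1 s s' ->
  nmem s' nat_stack k = nmem s nat_stack k /\ rmem s' real_stack k = rmem s real_stack k.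
Proof. by case=> _ n r; rewrite n ?r //= ltnn. Qed.

Lemma preserves_var m k s s' i : preserves m k s s' -> i < m ->
  nmem s' loop_vars i = nmem s loop_vars i.
Proof. by case=> _ n _ im; rewrite n //= leqNgt im. Qed.

Lemma represents_preserves lim st d m k s s' :
  preserves m k s s' -> represents lim st d s -> represents lim st d s'.
Proof.
move=> [_ Hn def_r] [rn rr]; split=> A j H.
  by rewrite Hn ?rn //; apply: contra H; rewrite /scratch => /orP[]/andP[-> _]; rewrite ?orbT.
by rewrite def_r ?rr //; case: A H.
Qed.

Lemma represents_set_nat lim st d s A i v :
  scratch A -> represents lim st d s -> represents lim st d (set_nat s A i v).
Proof.
move=> sA [rn rr]; split=> // B j H; rewrite /= /upd.
by case: (B =P A) H => [->|_ H]; [rewrite sA|exact: rn].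
Qed.

Lemma valid_preserves X lim st d m loc (e : ctx m) m' k s s' : (forall i, i < m -> loc i < m') ->
  preserves m' k s s' -> valid X lim st d loc e s -> valid X lim st d loc e s'.
Proof.
move=> loc_lt P [w r rc]; split=> // [|i im]; first exact: represents_preserves P r.
by rewrite (preserves_var P (loc_lt i im)); exact: rc.
Qed.

Lemma bounded_input_mono X Y st : X <= Y -> bounded_input X st -> bounded_input Y st.
Proof.
move=> XY [X0 n1 k1 H]; split; [lia|lia|lia|] => A j.
by apply: leq_trans (H A j) _; rewrite leq_exp2l.
Qed.

(* A command evaluates into the cells [k] of the stacks, using the loop variables from
   [m'] on; [P] relates the context, a bound on the size, and the two results. *)
Definition definable lim m (P : ctx m -> env -> tables -> nat -> nat -> R -> Prop) :=
  forall loc m' k, (forall i, i < m -> loc i < m') ->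
  exists c T, poly_bounded T /\ forall X (st : env) d e s, valid X lim st d loc e s ->
    runs (oracle st) c s (T X) (fun s' => preserves m' k s s' /\
      P e st d (T X) (nmem s' nat_stack k) (rmem s' real_stack k)).

Definition nat_definable lim m (phi : ctx m -> env -> tables -> nat) :=
  definable lim (fun e st d B v _ => v = phi e st d /\ phi e st d <= 2 ^ B).

Definition bool_definable lim m (phi : ctx m -> env -> tables -> bool) :=
  nat_definable lim (fun e st d => nat_of_bool (phi e st d)).

Definition real_definable lim m (phi : ctx m -> env -> tables -> R) :=
  definable lim (fun e st d _ _ r => r = phi e st d).

Lemma definable_weak lim m (P : ctx m -> env -> tables -> nat -> nat -> R -> Prop) :
  definable lim P -> definable (m := m.+1) lim (fun e => P e.1).
Proof.
move=> H loc m' k loc_lt; have [|c [T [pT run]]] := H loc m' k.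
  by move=> i im; apply: loc_lt; lia.
exists c, T; split=> // X st d e s [w r rc]; apply: run; split=> // i im.
by have := rc i (ltnW im); rewrite /= ltn_eqF.
Qed.

Lemma definable_unary lim m (P Q : ctx m -> env -> tables -> nat -> nat -> R -> Prop) final :
  definable lim P ->
  (forall m' k X (st : env) d e s B, bounded_input X st -> represents lim st d s ->
     P e st d B (nmem s nat_stack k) (rmem s real_stack k) ->
     runs (oracle st) (final k) s (3 * B + X + 4 * k + 20) (fun s' => preserves m' k s s' /\
       Q e st d (4 * B + X + 4 * k + 21) (nmem s' nat_stack k) (rmem s' real_stack k))) ->
  definable lim Q.
Proof.
move=> H run_final loc m' k loc_lt; have [c [T [pT run]]] := H loc m' k loc_lt.
exists (CSeq c (final k)), (fun X => 4 * T X + X + 4 * k + 21); split.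
  by solve_poly_bounded.
move=> X st d e s V; have [w r _] := V.
apply: (runs_weak _ (fun _ q => q) (runs_seq (run X st d e s V) _)); last first.
  move=> s1 [P1 p1]; have r1 := represents_preserves P1 r.
  apply: (runs_weak (leqnn _) _ (run_final m' k X st d e s1 (T X) w r1 p1)) => s2 [P2 p2].
  by split; [exact: preserves_trans P1 P2|].
lia.
Qed.

Lemma definable_binary lim m (P1 P2 Q : ctx m -> env -> tables -> nat -> nat -> R -> Prop) final :
  definable lim P1 -> definable lim P2 ->
  (forall m' k (st : env) d e s B1 B2,
     P1 e st d B1 (nmem s nat_stack k) (rmem s real_stack k) ->
     P2 e st d B2 (nmem s nat_stack k.+1) (rmem s real_stack k.+1) ->
     runs (oracle st) (final k) s (3 * (B1 + B2) + 6 * k + 40) (fun s' => preserves m' k s s' /\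
       Q e st d (4 * (B1 + B2) + 6 * k + 42) (nmem s' nat_stack k) (rmem s' real_stack k))) ->
  definable lim Q.
Proof.
move=> def1 def2 run_final loc m' k loc_lt.
have [c1 [T1 [p1 run1]]] := def1 loc m' k loc_lt.
have [c2 [T2 [p2 run2]]] := def2 loc m' k.+1 loc_lt.
exists (CSeq c1 (CSeq c2 (final k))), (fun X => 4 * (T1 X + T2 X) + 6 * k + 42); split.
  by solve_poly_bounded.
move=> X st d e s V.
apply: (runs_weak _ (fun _ q => q) (runs_seq (run1 X st d e s V) _)); last first.
  move=> s1 [P1' q1]; have V1 := valid_preserves loc_lt P1' V.
  apply: (runs_seq (run2 X st d e s1 V1)) => s2 [P2' q2].
  have [nat_stackE real_stackE] := preserves_stack P2'; rewrite -nat_stackE -real_stackE in q1.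
  apply: (runs_weak (leqnn _) _ (run_final m' k st d e s2 _ _ q1 q2)) => s3 [P3 q3].
  split=> //; apply: preserves_trans P1' (preserves_trans _ P3).
  exact: preserves_weak P2'.
lia.
Qed.

Lemma definable_const lim m v : @nat_definable lim m (fun _ _ _ => v).
Proof.
move=> loc m' k loc_lt; exists (CSetN nat_stack (ANat k) (ANat v)), (fun X => k + v + 5).
split=> [|X st d e s _]; first by solve_poly_bounded.
apply: runs_set_nat => //; first by rewrite /=; have := bitlen_leS k; have := bitlen_leS v; lia.
split; first by apply: preserves_set_nat; rewrite eqxx leqnn.
rewrite /= /upd !eqxx; split=> //.
by apply: leq_trans (ltnW (ltn_expl v (ltnSn 1))) _; rewrite leq_exp2l //; lia.
Qed.

Lemma definable_var lim m : @nat_definable lim m.+1 (fun e _ _ => e.2).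
Proof.
move=> loc m' k loc_lt.
exists (CSetN nat_stack (ANat k) (AGet loop_vars (ANat (loc m)))), (fun X => k + loc m + X + 5).
split=> [|X st d e s [_ _ rc]]; first by solve_poly_bounded.
have := rc m (leqnn _); rewrite /= eqxx => -[E B].
apply: runs_set_nat => //.
  rewrite /= E; have := bitlen_leS k; have := bitlen_leS (loc m); have := bitlen_le B; lia.
split; first by apply: preserves_set_nat; rewrite eqxx leqnn.
rewrite /= /upd !eqxx E; split=> //.
by apply: leq_trans B _; rewrite leq_exp2l //; lia.
Qed.

Lemma definable_arith o lim m (phi psi : ctx m -> env -> tables -> nat) :
  nat_definable lim phi -> nat_definable lim psi ->
  nat_definable lim (fun e st d => arith_val o (phi e st d) (psi e st d)).
Proof.
move=> def1 def2; apply: (definable_binary (final := fun k => CSetN nat_stack (ANat k)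
  (arith_exp o (AGet nat_stack (ANat k)) (AGet nat_stack (ANat k.+1)))) def1 def2).
move=> m' k st d e s B1 B2 [E1 b1] [E2 b2]; have b := arith_val_le o b1 b2.
apply: runs_set_nat; [by []|exact: aval_arith| |].
  rewrite acost_arith /= E1 E2; have := bitlen_leS k; have := bitlen_leS k.+1.
  by have := bitlen_le b1; have := bitlen_le b2; have := bitlen_le b; lia.
split; first by apply: preserves_set_nat; rewrite eqxx leqnn.
rewrite /= /upd !eqxx E1 E2; split=> //.
by apply: leq_trans b _; rewrite leq_exp2l //; lia.
Qed.

Lemma definable_input (A : nat) lim m (phi : ctx m -> env -> tables -> nat) :
  ~~ scratch A -> ~~ writable lim A -> nat_definable lim phi ->
  nat_definable lim (fun e st d => env_mem st A (phi e st d)).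
Proof.
move=> nsA nwA H; apply: (definable_unary (final := fun k => CSetN nat_stack (ANat k)
  (AGet A (AGet nat_stack (ANat k)))) H).
move=> m' k X st d e s B [_ _ _ stX] r [E b].
have V : nmem s A (phi e st d) = env_mem st A (phi e st d) by rewrite r.1 // (negPf nwA).
apply: runs_set_nat => //.
  rewrite /= E V; have := bitlen_leS k; have := bitlen_le b.
  by have := bitlen_le (stX A (phi e st d)); lia.
split; first by apply: preserves_set_nat; rewrite eqxx leqnn.
rewrite /= /upd !eqxx E V; split=> //.
by apply: leq_trans (stX _ _) _; rewrite leq_exp2l //; lia.
Qed.

Lemma definable_btab (A : nat) lim m (phi : ctx m -> env -> tables -> nat) :
  ~~ scratch A -> writable lim A -> nat_definable lim phi ->
  bool_definable lim (fun e st d => btab d A (phi e st d)).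
Proof.
move=> nsA wA H; apply: (definable_unary (final := fun k => CSetN nat_stack (ANat k)
  (AGet A (AGet nat_stack (ANat k)))) H).
move=> m' k X st d e s B _ r [E b].
have V : nmem s A (phi e st d) = btab d A (phi e st d) by rewrite r.1 // wA.
have le_1 : btab d A (phi e st d) <= 2 ^ 0 by case: btab.
apply: runs_set_nat => //.
  by rewrite /= E V; have := bitlen_leS k; have := bitlen_le b; have := bitlen_le le_1; lia.
split; first by apply: preserves_set_nat; rewrite eqxx leqnn.
rewrite /= /upd !eqxx E V; split=> //.
by apply: leq_trans le_1 _; rewrite leq_exp2l.
Qed.

Lemma definable_rtab (A : nat) lim m (phi : ctx m -> env -> tables -> nat) :
  real_buffer < A -> nat_definable lim phi ->
  real_definable lim (fun e st d => rtab d A (phi e st d)).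
Proof.
move=> A1 H; apply: (definable_unary (final := fun k => CSetR real_stack (ANat k)
  (RGet A (AGet nat_stack (ANat k)))) H).
move=> m' k X st d e s B _ r [E b]; apply: runs_set_real => //.
  by rewrite /= E; have := bitlen_leS k; have := bitlen_le b; lia.
split; first exact: preserves_set_real.
by rewrite /= /upd !eqxx E r.2.
Qed.

Lemma definable_oracle lim m (phi : ctx m -> env -> tables -> nat) :
  nat_definable lim phi -> real_definable lim (fun e st d => oracle st (phi e st d)).
Proof.
move=> H; apply: (definable_unary (final := fun k => CSetR real_stack (ANat k)
  (ROracle (AGet nat_stack (ANat k)))) H).
move=> m' k X st d e s B _ r [E b]; apply: runs_set_real => //.
  by rewrite /= E; have := bitlen_leS k; have := bitlen_le b; lia.
split; first exact: preserves_set_real.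
by rewrite /= /upd !eqxx E.
Qed.

Lemma definable_addr lim m (phi psi : ctx m -> env -> tables -> R) :
  real_definable lim phi -> real_definable lim psi ->
  real_definable lim (fun e st d => phi e st d + psi e st d)%R.
Proof.
move=> def1 def2; apply: (definable_binary (final := fun k => CSetR real_stack (ANat k)
  (RAdd (RGet real_stack (ANat k)) (RGet real_stack (ANat k.+1)))) def1 def2).
move=> m' k st d e s B1 B2 E1 E2; apply: runs_set_real => //.
  by rewrite /=; have := bitlen_leS k; have := bitlen_leS k.+1; lia.
split; first exact: preserves_set_real.
by rewrite /= /upd !eqxx E1 E2.
Qed.

Lemma definable_scale lim m (phi : ctx m -> env -> tables -> nat)
    (psi : ctx m -> env -> tables -> R) :
  nat_definable lim phi -> real_definable lim psi ->
  real_definable lim (fun e st d => (phi e st d)%:R * psi e st d)%R.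
Proof.
move=> def1 def2; apply: (definable_binary (final := fun k => CSetR real_stack (ANat k)
  (RScale (AGet nat_stack (ANat k)) (RGet real_stack (ANat k.+1)))) def1 def2).
move=> m' k st d e s B1 B2 [E1 b1] E2; apply: runs_set_real => //.
  by rewrite /= E1; have := bitlen_leS k; have := bitlen_leS k.+1; have := bitlen_le b1; lia.
split; first exact: preserves_set_real.
by rewrite /= /upd !eqxx E1 E2.
Qed.

Lemma definable_ler lim m (phi psi : ctx m -> env -> tables -> R) :
  real_definable lim phi -> real_definable lim psi ->
  bool_definable lim (fun e st d => phi e st d <= psi e st d)%R.
Proof.
move=> def1 def2; pose test k := BLeR (RGet real_stack (ANat k)) (RGet real_stack (ANat k.+1)).
apply: (definable_binary (final := fun k => CIf (test k)
  (CSetN nat_stack (ANat k) (ANat 1)) (CSetN nat_stack (ANat k) (ANat 0))) def1 def2).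
move=> m' k st d e s B1 B2 E1 E2; pose v : nat := (phi e st d <= psi e st d)%R.
have v_le1 : v <= 1 by rewrite /v; case: (_ <= _)%R.
apply: (runs_weak _ (fun _ q => q) (runs_if (T := 2 * k + 10) _)).
  by rewrite /=; have := bitlen_leS k; have := bitlen_leS k.+1; lia.
have -> : (if bval (oracle st) s (test k) then CSetN nat_stack (ANat k) (ANat 1)
    else CSetN nat_stack (ANat k) (ANat 0)) = CSetN nat_stack (ANat k) (ANat v).
  by rewrite /= E1 E2 /v; case: (_ <= _)%R.
apply: runs_set_nat => //; first by rewrite /=; have := bitlen_leS k; have := bitlen_leS v; lia.
split; first by apply: preserves_set_nat; rewrite eqxx leqnn.
rewrite /= /upd !eqxx; split=> //.
by apply: leq_trans v_le1 _; rewrite expn_gt0.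
Qed.

(** ** Loops *)

Lemma bound_expE lim X st d s b : 0 < lim -> bounded_input X st -> represents lim st d s ->
  [/\ aval s (bound_exp b) = bound_val b st, acost s (bound_exp b) <= bound_cost b X
    & bound_val b st <= bound_cost b X].
Proof.
move=> lim0 [X0 n1 k1 _] [rn _].
have read_only : writable lim 0 = false by rewrite /writable /= leqn0 eqn0Ngt lim0.
elim: b => [||c|b1 [A1 C1 V1] b2 [A2 ctx2 V2]|b1 [A1 C1 V1] b2 [A2 ctx2 V2]] /=.
- rewrite !rn // read_only; split=> //; last by rewrite /bound_val; lia.
  have := bitlen_leS (st 0 0); have := bitlen_leS 0; lia.
- rewrite !rn // read_only; split=> //; last by rewrite /bound_val; lia.
  have := bitlen_leS (st 0 1); have := bitlen_leS 1; lia.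
- by split=> //; rewrite ?addn0 ?bitlen_leS.
- rewrite A1 A2; split=> //; rewrite -/bound_val; last by rewrite {1}/bound_val -/bound_val; lia.
  have := bitlen_leS (bound_val b1 st + bound_val b2 st); lia.
- rewrite A1 A2; split=> //; rewrite -/bound_val; last by rewrite {1}/bound_val -/bound_val; nia.
  have := bitlen_leS (bound_val b1 st * bound_val b2 st); nia.
Qed.

Definition loop_loc (m : nat) (loc : nat -> nat) (m' i : nat) :=
  if i == m then m' else loc i.

Lemma loop_loc_lt m loc m' : (forall i, i < m -> loc i < m') ->
  forall i, i < m.+1 -> loop_loc m loc m' i < m'.+1.
Proof. by move=> loc_lt i im; rewrite /loop_loc; case: eqP => // ne; apply/leqW/loc_lt; lia. Qed.

(* The value of the loop variable has fewer bits than [bound_cost b X + X]. *)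
Lemma valid_loop lim X st d m loc (e : ctx m) m' s b x : 0 < lim ->
  valid X lim st d loc e s -> x < bound_val b st -> nmem s loop_vars m' = x ->
  valid (m := m.+1) (bound_cost b X + X) lim st d (loop_loc m loc m') (e, x) s.
Proof.
move=> lim0 [w r rc] xb V; split=> // [|i im].
  by apply: bounded_input_mono w; exact: leq_addl.
rewrite /= /loop_loc; case: eqP => [_|ne].
  split => //; apply: leq_trans (ltnW xb) _; have [_ _ vb] := bound_expE b lim0 w r.
  apply: leq_trans vb _; apply: leq_trans (ltnW (ltn_expl _ (ltnSn 1))) _.
  by rewrite leq_exp2l ?leq_addr.
have [|-> B] := rc i; first by lia.
by split=> //; apply: leq_trans B _; rewrite leq_exp2l ?leq_addl.
Qed.

Definition loop_cost b m' Tc X :=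
  (bound_cost b X + 1) * (Tc + bound_cost b X + 4 * bound_cost b X + 8 * m' + 50).

Lemma poly_bounded_loop_cost b m' Tc :
  poly_bounded Tc -> poly_bounded (fun X => loop_cost b m' (Tc X) X).
Proof.
by move=> pT; rewrite /loop_cost; have := poly_bounded_bound_cost b => pb; solve_poly_bounded.
Qed.

Lemma runs_loop lim f X st b m' c s Tc (Inv : nat -> state -> Prop) :
  0 < lim -> bounded_input X st ->
  (forall x s, Inv x s -> exists d, represents lim st d s) ->
  (forall x s, x < bound_val b st -> nmem s loop_vars m' = x -> Inv x s ->
     runs f c s Tc (fun s' =>
       nmem s' loop_vars m' = x /\ Inv x.+1 (set_nat s' loop_vars m' x.+1))) ->
  Inv 0 (set_nat s loop_vars m' 0) ->
  runs f (CFor b m' c) s (loop_cost b m' Tc X) (Inv (bound_val b st)).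
Proof.
move=> lim0 w inv_rep run_step inv0; set N := bound_val b st in run_step *.
have N_le : N <= bound_cost b X.
  by have [d r] := inv_rep _ _ inv0; have [] := bound_expE b lim0 w r.
pose Inv' x s := nmem s loop_vars m' = x /\ Inv x s.
apply: (@runs_weak _ _ _ _ (N.+1 * (Tc + bound_cost b X + 4 * N + 8 * m' + 50)) _ (Inv' N)).
- by rewrite /loop_cost addn1 leq_mul //; lia.
- by move=> s' [].
apply: runs_for.
- move=> x s1 _ [V I]; have [d r] := inv_rep _ _ I.
  by have [-> C _] := bound_expE b lim0 w r.
- move=> x s1 xN [V I]; apply: (runs_weak (leqnn _) _ (run_step x s1 xN V I)) => s2 [V2 I2].
  by split=> //; split=> //; rewrite /= /upd !eqxx.
by split=> //; rewrite /= /upd !eqxx.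
Qed.

(* An accumulator in the cells [k] of the stacks is updated with the result of [P] in the
   cells [k.+1]. *)
Lemma definable_loop b lim m (P : ctx m.+1 -> env -> tables -> nat -> nat -> R -> Prop)
    (Acc : ctx m -> env -> tables -> nat -> nat -> nat -> R -> Prop)
    (Q : ctx m -> env -> tables -> nat -> nat -> R -> Prop) i0 init step :
  0 < lim -> definable lim P ->
  (forall m' k (st : env) d e s B,
     runs (oracle st) (init k) s (4 * k + i0 + 20) (fun s' => preserves m' k s s' /\
       Acc e st d B 0 (nmem s' nat_stack k) (rmem s' real_stack k))) ->
  (forall m' k (st : env) d e x s B,
     Acc e st d B x (nmem s nat_stack k) (rmem s real_stack k) ->
     P (e, x) st d B (nmem s nat_stack k.+1) (rmem s real_stack k.+1) ->
     runs (oracle st) (step k) s (3 * B + 3 * (x.+1 * (B + 2) + i0) + 4 * k + 30) (fun s' =>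
       preserves m' k s s' /\ Acc e st d B x.+1 (nmem s' nat_stack k) (rmem s' real_stack k))) ->
  (forall (st : env) d e B C v r, Acc e st d B (bound_val b st) v r ->
     bound_val b st * (B + 2) + i0 <= C -> Q e st d C v r) ->
  definable lim Q.
Proof.
move=> lim0 H run_init run_step acc_end loc m' k loc_lt.
have [c [T [pT run]]] := H (loop_loc m loc m') m'.+1 k.+1 (loop_loc_lt loc_lt).
pose T' X := T (bound_cost b X + X); have pT' : poly_bounded T' by exact: poly_bounded_loop_input.
pose size X := bound_cost b X * (T' X + 2) + i0.
pose Tc X := 1 + T' X + (3 * T' X + 3 * size X + 4 * k + 30).
exists (CSeq (init k) (CFor b m' (CSeq c (step k)))).
exists (fun X => 1 + (4 * k + i0 + 20) + loop_cost b m' (Tc X) X); split.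
  have pTc : poly_bounded Tc.
    by rewrite /Tc /size; have := poly_bounded_bound_cost b => pb; solve_poly_bounded.
  by have pL := poly_bounded_loop_cost b m' pTc; solve_poly_bounded.
move=> X st d e s V; have [w r _] := V; have [_ _ N_le] := bound_expE b lim0 w r.
apply: (runs_seq (run_init m' k st d e s (T' X))) => s0 [P0 A0].
pose Inv x s1 := preserves m' k s s1 /\
  Acc e st d (T' X) x (nmem s1 nat_stack k) (rmem s1 real_stack k).
have loop_var x s1 s2 : preserves m' k s s1 -> preserves m' k s1 s2 ->
    Acc e st d (T' X) x (nmem s2 nat_stack k) (rmem s2 real_stack k) ->
    Inv x (set_nat s2 loop_vars m' x).
  move=> P1 P2 A2; split=> //; apply: preserves_trans P1 (preserves_trans P2 _).
  by apply: preserves_set_nat; rewrite eqxx leqnn.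
apply: (runs_weak (leqnn _) _ (runs_loop (Inv := Inv) lim0 w _ _ _)) => [s1 [P1 A1]|||].
- split=> //; apply: acc_end A1 _; rewrite /loop_cost /Tc.
  have : bound_val b st * (T' X + 2) <= bound_cost b X * (T' X + 2) by rewrite leq_mul.
  by rewrite /size; nia.
- by move=> x s1 [P1 _]; exists d; exact: represents_preserves P1 r.
- move=> x s1 xN V1 [P1 A1]; have valid1 := valid_loop lim0 (valid_preserves loc_lt P1 V) xN V1.
  apply: (runs_weak _ (fun _ q => q) (runs_seq (run _ st d (e, x) s1 valid1) _)); last first.
    move=> s2 [P2 p2]; have [nat_stackE real_stackE] := preserves_stack P2.
    rewrite -nat_stackE -real_stackE in A1.
    apply: (runs_weak (leqnn _) _ (run_step m'.+1 k st d e x s2 _ A1 p2)) => s3 [P3 A3].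
    split; first by rewrite (preserves_var P3) // (preserves_var P2).
    apply: (loop_var _ s1) => //.
    by apply: preserves_trans (preserves_weak _ _ P2) (preserves_weak _ _ P3).
  have xB : x.+1 * (T' X + 2) <= bound_cost b X * (T' X + 2).
    by rewrite leq_mul // (leq_trans xN).
  by rewrite -/(T' X) /Tc /size; lia.
exact: (loop_var _ s0).
Qed.

End Definable.

(** ** Closure properties *)

Definition sumR (R : realType) n (F : nat -> R) : R := (\sum_(i < n) F i)%R.

Section Closure.
Variable R : realType.
Local Notation env := (env R).
Local Notation tables := (tables R).
Variables (lim m : nat).
Implicit Types (phi psi : ctx m -> env -> tables -> nat) (p q : ctx m -> env -> tables -> bool).

Lemma eq_nat_definable phi psi : (forall e st d, phi e st d = psi e st d) ->
  nat_definable lim phi -> nat_definable lim psi.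
Proof.
move=> E H loc m' k loc_lt; have [c [T [pT run]]] := H loc m' k loc_lt.
exists c, T; split=> // X st d e s V; apply: runs_weak (run X st d e s V) => // s'.
by rewrite E.
Qed.

Lemma eq_bool_definable p q : (forall e st d, p e st d = q e st d) ->
  bool_definable lim p -> bool_definable lim q.
Proof. by move=> E; apply: eq_nat_definable => e st d; rewrite E. Qed.

Lemma definable_add phi psi : nat_definable lim phi -> nat_definable lim psi ->
  nat_definable lim (fun e st d => phi e st d + psi e st d).
Proof. exact: (definable_arith OAdd). Qed.

Lemma definable_sub phi psi : nat_definable lim phi -> nat_definable lim psi ->
  nat_definable lim (fun e st d => phi e st d - psi e st d).
Proof. exact: (definable_arith OSub). Qed.

Lemma definable_mul phi psi : nat_definable lim phi -> nat_definable lim psi ->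
  nat_definable lim (fun e st d => phi e st d * psi e st d).
Proof. exact: (definable_arith OMul). Qed.

Lemma definable_div phi psi : nat_definable lim phi -> nat_definable lim psi ->
  nat_definable lim (fun e st d => phi e st d %/ psi e st d).
Proof. exact: (definable_arith ODiv). Qed.

Lemma definable_mod phi psi : nat_definable lim phi -> nat_definable lim psi ->
  nat_definable lim (fun e st d => phi e st d %% psi e st d).
Proof. exact: (definable_arith OMod). Qed.

Lemma definable_succ phi :
  nat_definable lim phi -> nat_definable lim (fun e st d => (phi e st d).+1).
Proof.
move=> H; apply: eq_nat_definable (definable_add H (@definable_const R lim m 1)) => e st d.
exact: addn1.
Qed.

Lemma definable_bound b :
  output_array < lim ->
  nat_definable lim (fun (_ : ctx m) (st : env) (_ : tables) => bound_val b st).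
Proof.
move=> lim5; have read_only : ~~ writable lim 0 by rewrite /writable /= -ltnNge; lia.
elim: b => [||c|b1 IH1 b2 IH2|b1 IH1 b2 IH2].
- exact: (definable_input (A := 0) isT read_only (@definable_const R lim m 0)).
- exact: (definable_input (A := 0) isT read_only (@definable_const R lim m 1)).
- exact: definable_const.
- exact: definable_add IH1 IH2.
- exact: definable_mul IH1 IH2.
Qed.

Lemma definable_and p q : bool_definable lim p -> bool_definable lim q ->
  bool_definable lim (fun e st d => p e st d && q e st d).
Proof.
by move=> def_p def_q; apply: eq_nat_definable (definable_mul def_p def_q) => e st d; rewrite mulnb.
Qed.

Lemma definable_neg p : bool_definable lim p -> bool_definable lim (fun e st d => ~~ p e st d).
Proof.
move=> def_p; apply: eq_nat_definable (definable_sub (@definable_const R lim m 1) def_p) => e st d.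
by case: (p e st d).
Qed.

Lemma definable_or p q : bool_definable lim p -> bool_definable lim q ->
  bool_definable lim (fun e st d => p e st d || q e st d).
Proof.
move=> def_p def_q.
have := definable_neg (definable_and (definable_neg def_p) (definable_neg def_q)).
apply: eq_bool_definable.
by move=> e st d; rewrite negb_and !negbK.
Qed.

Lemma definable_implb p q : bool_definable lim p -> bool_definable lim q ->
  bool_definable lim (fun e st d => p e st d ==> q e st d).
Proof.
move=> def_p def_q; apply: eq_bool_definable (definable_or (definable_neg def_p) def_q) => e st d.
by rewrite implybE.
Qed.

Lemma definable_if p phi psi : bool_definable lim p ->
  nat_definable lim phi -> nat_definable lim psi ->
  nat_definable lim (fun e st d => if p e st d then phi e st d else psi e st d).
Proof.
move=> def_p def1 def2.
have := definable_add (definable_mul def_p def1) (definable_mul (definable_neg def_p) def2).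
by apply: eq_nat_definable => e st d; case: (p e st d); rewrite /= ?mul1n ?mul0n ?addn0.
Qed.

Lemma definable_ifb p q r : bool_definable lim p -> bool_definable lim q -> bool_definable lim r ->
  bool_definable lim (fun e st d => if p e st d then q e st d else r e st d).
Proof.
move=> def_p def_q def_r; apply: eq_nat_definable (definable_if def_p def_q def_r) => e st d.
by case: ifP.
Qed.

Lemma definable_leq phi psi : nat_definable lim phi -> nat_definable lim psi ->
  bool_definable lim (fun e st d => phi e st d <= psi e st d).
Proof.
move=> def1 def2; have := definable_sub (@definable_const R lim m 1) (definable_sub def1 def2).
by apply: eq_nat_definable => e st d; case: leqP => /= ?; lia.
Qed.

Lemma definable_eqn phi psi : nat_definable lim phi -> nat_definable lim psi ->
  bool_definable lim (fun e st d => phi e st d == psi e st d).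
Proof.
move=> def1 def2.
apply: eq_bool_definable (definable_and (definable_leq def1 def2) (definable_leq def2 def1)).
by move=> e st d; rewrite eqn_leq.
Qed.

Lemma definable_eqb p q : bool_definable lim p -> bool_definable lim q ->
  bool_definable lim (fun e st d => p e st d == q e st d).
Proof.
by move=> def_p def_q; apply: eq_bool_definable (definable_eqn def_p def_q) => e st d;
  case: (p e st d); case: (q e st d).
Qed.

End Closure.

Section BigOperators.
Variable R : realType.
Local Notation env := (env R).
Local Notation tables := (tables R).
Variables (lim m : nat).
Hypothesis lim_gt0 : 0 < lim.
Variable b : bound.

Lemma definable_big o i0 (phi : ctx m -> nat -> env -> tables -> nat)
    (acc : ctx m -> env -> tables -> nat -> nat) :
  (forall e st d, acc e st d 0 = i0) ->
  (forall e st d x, acc e st d x.+1 = arith_val o (acc e st d x) (phi e x st d)) ->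
  nat_definable (m := m.+1) lim (fun e st d => phi e.1 e.2 st d) ->
  nat_definable lim (fun e st d => acc e st d (bound_val b st)).
Proof.
move=> acc0 accS H; apply: (definable_loop (b := b) (i0 := i0)
  (Acc := fun e st d B x v _ => v = acc e st d x /\ v <= 2 ^ (x * (B + 2) + i0))
  (init := fun k => CSetN nat_stack (ANat k) (ANat i0))
  (step := fun k => CSetN nat_stack (ANat k)
    (arith_exp o (AGet nat_stack (ANat k)) (AGet nat_stack (ANat k.+1)))) _ H) => //.
- move=> m' k st d e s B; apply: runs_set_nat => //.
    by rewrite /=; have := bitlen_leS k; have := bitlen_leS i0; lia.
  split; first by apply: preserves_set_nat; rewrite eqxx leqnn.
  by rewrite /= /upd !eqxx acc0 mul0n; split=> //; exact: ltnW (ltn_expl _ _).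
- move=> m' k st d e x s B [Ea Ba] [Ep Bp]; rewrite Ea in Ba.
  have acc_le_arith := arith_val_le o Ba Bp; rewrite -accS in acc_le_arith.
  have acc_le : acc e st d x.+1 <= 2 ^ (x.+1 * (B + 2) + i0).
    by apply: leq_trans acc_le_arith _; rewrite leq_exp2l //; lia.
  apply: runs_set_nat; [by []|exact: aval_arith| |].
    rewrite acost_arith /= Ea Ep -accS; have := bitlen_leS k; have := bitlen_leS k.+1.
    by have := bitlen_le Ba; have := bitlen_le Bp; have := bitlen_le acc_le; lia.
  split; first by apply: preserves_set_nat; rewrite eqxx leqnn.
  by rewrite /= /upd !eqxx Ea Ep -accS.
move=> st d e B C v r [-> le] BC; split=> //.
by apply: leq_trans le _; rewrite leq_exp2l.
Qed.

Lemma definable_sumN (phi : ctx m -> nat -> env -> tables -> nat) :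
  nat_definable (m := m.+1) lim (fun e st d => phi e.1 e.2 st d) ->
  nat_definable lim (fun e st d => sumN (bound_val b st) (fun x => phi e x st d)).
Proof.
apply: (@definable_big OAdd 0 phi (fun e st d N => sumN N (fun x => phi e x st d))) => e st d.
  exact: big_ord0.
by move=> x; exact: big_ord_recr.
Qed.

Lemma definable_prodN (phi : ctx m -> nat -> env -> tables -> nat) :
  nat_definable (m := m.+1) lim (fun e st d => phi e.1 e.2 st d) ->
  nat_definable lim (fun e st d => prodN (bound_val b st) (fun x => phi e x st d)).
Proof.
apply: (@definable_big OMul 1 phi (fun e st d N => prodN N (fun x => phi e x st d))) => e st d.
  exact: big_ord0.
by move=> x; exact: big_ord_recr.
Qed.

Lemma definable_hasN (p : ctx m -> nat -> env -> tables -> bool) :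
  bool_definable (m := m.+1) lim (fun e st d => p e.1 e.2 st d) ->
  bool_definable lim (fun e st d => hasN (bound_val b st) (fun x => p e x st d)).
Proof.
move=> /(@definable_sumN (fun e x st d => p e x st d)) H.
have := definable_leq (@definable_const R lim m 1) H.
apply: eq_bool_definable => e st d; rewrite sumN_gt0.
by apply: eq_has => x; rewrite lt0b.
Qed.

Lemma definable_allN (p : ctx m -> nat -> env -> tables -> bool) :
  bool_definable (m := m.+1) lim (fun e st d => p e.1 e.2 st d) ->
  bool_definable lim (fun e st d => allN (bound_val b st) (fun x => p e x st d)).
Proof.
move=> H; have := @definable_hasN (fun e x st d => ~~ p e x st d) (definable_neg H).
by move=> /definable_neg; apply: eq_bool_definable => e st d; rewrite /hasN has_predC negbK.
Qed.

Lemma definable_sumR (phi : ctx m -> nat -> env -> tables -> R) :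
  real_definable (m := m.+1) lim (fun e st d => phi e.1 e.2 st d) ->
  real_definable lim (fun e st d => sumR (bound_val b st) (fun x => phi e x st d)).
Proof.
move=> H; pose zero k := RSub (RGet real_stack (ANat k)) (RGet real_stack (ANat k)).
apply: (definable_loop (b := b) (i0 := 0)
  (Acc := fun e st d _ x _ r => r = sumR x (fun x => phi e x st d))
  (init := fun k => CSetR real_stack (ANat k) (zero k))
  (step := fun k => CSetR real_stack (ANat k)
    (RAdd (RGet real_stack (ANat k)) (RGet real_stack (ANat k.+1)))) _ H) => //.
- move=> m' k st d e s _; apply: runs_set_real => //.
    by rewrite /=; have := bitlen_leS k; lia.
  split; first exact: preserves_set_real.
  by rewrite /= /upd !eqxx subrr /sumR big_ord0.
move=> m' k st d e x s B Ea Ep; apply: runs_set_real => //.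
  by rewrite /=; have := bitlen_leS k; have := bitlen_leS k.+1; lia.
split; first exact: preserves_set_real.
by rewrite /= /upd !eqxx Ea Ep /sumR big_ord_recr.
Qed.

End BigOperators.

(** ** Programs that transform the tables *)

Section Steps.
Variable R : realType.
Local Notation env := (env R).
Local Notation tables := (tables R).
Local Notation state := (state R).

Definition set_btab (d : tables) A g :=
  Tables (fun B j => if B == A then g j else btab d B j) (rtab d).
Definition set_rtab (d : tables) A g :=
  Tables (btab d) (fun B j => if B == A then g j else rtab d B j).

Definition fill_btab A N (phi : nat -> tables -> bool) d :=
  set_btab d A (fun j => if j < N then phi j d else btab d A j).
Definition fill_rtab A N (phi : nat -> tables -> R) d :=
  set_rtab d A (fun j => if j < N then phi j d else rtab d A j).

Definition iterate N (F : nat -> tables -> tables) d := foldl (fun d x => F x d) d (iota 0 N).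

Lemma iterateS N F d : iterate N.+1 F d = F N (iterate N F d).
Proof. by rewrite /iterate -addn1 iotaD foldl_cat. Qed.

Lemma iterate_ind (Q : tables -> Prop) N F d :
  (forall x d, x < N -> Q d -> Q (F x d)) -> Q d -> Q (iterate N F d).
Proof.
elim: N => // N IH H Qd; rewrite iterateS; apply: (H) => //; apply: IH => // x d1 xN.
by apply: H; exact: ltnW.
Qed.

Lemma iterate_reach (Q : tables -> Prop) N F d x0 : x0 < N ->
  (forall d, Q (F x0 d)) -> (forall x d, Q d -> Q (F x d)) -> Q (iterate N F d).
Proof.
move=> lt H0 H; elim: N lt => // N IH; rewrite ltnS leq_eqVlt iterateS => /predU1P[<-//|lt].
by apply: H; exact: IH.
Qed.

Definition preserves_ctx m (s s' : state) := coins s' = coins s /\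
  forall i, i < m -> nmem s' loop_vars i = nmem s loop_vars i.

Lemma preserves_ctx_trans m s1 s2 s3 :
  preserves_ctx m s1 s2 -> preserves_ctx m s2 s3 -> preserves_ctx m s1 s3.
Proof. by move=> [c1 v1] [c2 v2]; split=> [|i im]; rewrite ?c2 // v2 ?v1. Qed.

Lemma preserves_ctxS m s s' : preserves_ctx m.+1 s s' ->
  preserves_ctx m s s' /\ nmem s' loop_vars m = nmem s loop_vars m.
Proof. by move=> [c v]; split; [split=> // i im; rewrite v // ltnW|exact: v]. Qed.

Lemma preserves_preserves_ctx m k s s' : preserves m k s s' -> preserves_ctx m s s'.
Proof. by move=> P; split=> [|i im]; [case: P|exact: preserves_var P im]. Qed.

Lemma preserves_ctx_set_nat m s (A i v : nat) :
  (A == loop_vars) ==> (m <= i) -> preserves_ctx m s (set_nat s A i v).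
Proof.
move=> /implyP H; split=> // j jm; rewrite /= /upd.
case: eqP => //= E; rewrite ltn_eqF // (leq_trans jm) // H //.
by rewrite -E.
Qed.

Lemma valid_preserves_ctx X lim st d d' m loc (e : ctx m) m' s s' :
  (forall i, i < m -> loc i < m') ->
  preserves_ctx m' s s' -> represents lim st d' s' ->
  valid X lim st d loc e s -> valid X lim st d' loc e s'.
Proof. by move=> loc_lt [_ v] r' [w _ rc]; split=> // i im; rewrite v ?loc_lt //; exact: rc. Qed.

Definition step_definable lim m (F : ctx m -> env -> tables -> tables) :=
  forall loc m', (forall i, i < m -> loc i < m') ->
  exists c T, poly_bounded T /\ forall X (st : env) d e s, valid X lim st d loc e s ->
    runs (oracle st) c s (T X) (fun s' =>
      preserves_ctx m' s s' /\ represents lim st (F e st d) s').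

Lemma definable_step_seq lim m (F G : ctx m -> env -> tables -> tables) :
  step_definable lim F -> step_definable lim G ->
  step_definable lim (fun e st d => G e st (F e st d)).
Proof.
move=> def1 def2 loc m' loc_lt.
have [c1 [T1 [p1 run1]]] := def1 loc m' loc_lt; have [c2 [T2 [p2 run2]]] := def2 loc m' loc_lt.
exists (CSeq c1 c2), (fun X => 1 + T1 X + T2 X); split; first by solve_poly_bounded.
move=> X st d e s V; apply: (runs_seq (run1 X st d e s V)) => s1 [P1 r1].
have V1 := valid_preserves_ctx loc_lt P1 r1 V.
apply: (runs_weak (leqnn _) _ (run2 X st _ e s1 V1)) => s2 [P2 r2].
by split=> //; exact: preserves_ctx_trans P1 P2.
Qed.

Lemma definable_step_for b lim m (F : ctx m -> nat -> env -> tables -> tables) : 0 < lim ->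
  step_definable (m := m.+1) lim (fun e st d => F e.1 e.2 st d) ->
  step_definable lim (fun e st d => iterate (bound_val b st) (fun x => F e x st) d).
Proof.
move=> lim0 H loc m' loc_lt; have [c [T [pT run]]] := H _ _ (loop_loc_lt loc_lt).
have pT' := poly_bounded_loop_input b pT.
exists (CFor b m' c), (fun X => loop_cost b m' (T (bound_cost b X + X)) X); split.
  exact: poly_bounded_loop_cost.
move=> X st d e s V; have [w _ _] := V.
pose Inv x s1 := preserves_ctx m' s s1 /\ represents lim st (iterate x (fun x => F e x st) d) s1.
have set_var x v s1 : Inv x s1 -> Inv x (set_nat s1 loop_vars m' v).
  move=> [P1 r1]; split; last exact: represents_set_nat.
  by apply: preserves_ctx_trans P1 _; apply: preserves_ctx_set_nat; rewrite leqnn.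
apply: (runs_loop (Inv := Inv) lim0 w) => [x s1 [_ r1]|x s1 xN V1 [P1 r1]|].
  by eexists; exact: r1.
  have valid1 := valid_loop lim0 (valid_preserves_ctx loc_lt P1 r1 V) xN V1.
  apply: (runs_weak (leqnn _) _ (run _ st _ (e, x) s1 valid1)) => s2 [/preserves_ctxS[P2 V2] r2].
  split; first by rewrite V2.
  by apply: set_var; split; [exact: preserves_ctx_trans P1 P2|rewrite iterateS].
by apply: set_var; split=> //; case: V.
Qed.

(* A table is filled in two passes, through a buffer, so that all new values are computed
   from the old table. *)
Section Fill.
Variables (lim m : nat) (b : bound).
Hypothesis lim_gt0 : 0 < lim.
Variables (X m' : nat) (st : env) (d : tables) (loc : nat -> nat) (e : ctx m).
Hypothesis loc_lt : forall i, i < m -> loc i < m'.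

Definition same_but_buffers x (s s' : state) := [/\ coins s' = coins s,
  forall A i, (A != nat_buffer) || (i != x) -> nmem s' A i = nmem s A i &
  forall A i, (A != real_buffer) || (i != x) -> rmem s' A i = rmem s A i].

Lemma same_but_buffers_represents x s s' :
  same_but_buffers x s s' -> represents lim st d s -> represents lim st d s'.
Proof.
move=> [_ Hn def_r] [rn rr]; split=> A j H.
  by rewrite Hn ?rn //; move: H; rewrite /scratch !negb_or => /and3P[_ _ ->].
by rewrite def_r ?rr // neq_ltn H orbT.
Qed.

Lemma same_but_buffers_ctx x s s' : same_but_buffers x s s' -> preserves_ctx m'.+1 s s'.
Proof. by move=> [c Hn _]; split=> // i _; exact: Hn. Qed.

Lemma runs_buffer_loop s c store T0 (P : nat -> nat -> R -> Prop) (Buf : nat -> nat -> R -> Prop) :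
  valid X lim st d loc e s ->
  (forall x s1, x < bound_val b st ->
     valid (m := m.+1) (bound_cost b X + X) lim st d (loop_loc m loc m') (e, x) s1 ->
     runs (oracle st) c s1 T0 (fun s2 => preserves m'.+1 0 s1 s2 /\
       P x (nmem s2 nat_stack 0) (rmem s2 real_stack 0))) ->
  (forall x s1, nmem s1 loop_vars m' = x -> P x (nmem s1 nat_stack 0) (rmem s1 real_stack 0) ->
     runs (oracle st) store s1 (T0 + x + m' + 20) (fun s2 => same_but_buffers x s1 s2 /\
       Buf x (nmem s2 nat_buffer x) (rmem s2 real_buffer x))) ->
  runs (oracle st) (CFor b m' (CSeq c store)) s
    (loop_cost b m' (2 * T0 + bound_cost b X + m' + 30) X) (fun s' =>
      [/\ preserves_ctx m' s s', represents lim st d s'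
        & forall j, j < bound_val b st -> Buf j (nmem s' nat_buffer j) (rmem s' real_buffer j)]).
Proof.
move=> V Hc run_store; have [w r _] := V; have [_ _ N_le] := bound_expE b lim_gt0 w r.
pose Inv x s1 := [/\ preserves_ctx m' s s1, represents lim st d s1
  & forall j, j < x -> Buf j (nmem s1 nat_buffer j) (rmem s1 real_buffer j)].
have set_var x v s1 : Inv x s1 -> Inv x (set_nat s1 loop_vars m' v).
  move=> [P1 r1 B1]; split=> //; last exact: represents_set_nat.
  by apply: preserves_ctx_trans P1 _; apply: preserves_ctx_set_nat; rewrite leqnn.
apply: (runs_loop (Inv := Inv) lim_gt0 w) => [x s1 [_ r1 _]|x s1 xN V1 [P1 r1 B1]|].
- by exists d.
- have valid1 := valid_loop lim_gt0 (valid_preserves_ctx loc_lt P1 r1 V) xN V1.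
  apply: (runs_weak _ (fun _ q => q) (runs_seq (Hc x s1 xN valid1) _)); last first.
    move=> s2 [P2 p2]; have V2 : nmem s2 loop_vars m' = x by rewrite (preserves_var P2).
    apply: (runs_weak (leqnn _) _ (run_store x s2 V2 p2)) => s3 [S3 B3].
    have ctx3 := preserves_ctxS (same_but_buffers_ctx S3); rewrite V2 in ctx3.
    split; first by case: ctx3.
    have [ctx2 _] := preserves_ctxS (preserves_preserves_ctx P2).
    apply: set_var; split=> [||j].
    + exact: preserves_ctx_trans P1 (preserves_ctx_trans ctx2 ctx3.1).
    + exact: same_but_buffers_represents S3 (represents_preserves P2 r1).
    rewrite ltnS leq_eqVlt => /predU1P[-> //|jx]; have [_ n3 q3] := S3; have [_ n2 q2] := P2.
    by rewrite n3 ?q3 ?n2 ?q2 ?(ltn_eqF jx) //; exact: B1.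
  by lia.
by apply: set_var; split=> //.
Qed.

Lemma runs_copy_loop s copy (D : nat -> tables) (Buf : nat -> nat -> R -> Prop) :
  bounded_input X st -> represents lim st (D 0) s ->
  (forall j, j < bound_val b st -> Buf j (nmem s nat_buffer j) (rmem s real_buffer j)) ->
  (forall x s1, nmem s1 loop_vars m' = x -> Buf x (nmem s1 nat_buffer x) (rmem s1 real_buffer x) ->
     represents lim st (D x) s1 ->
     runs (oracle st) copy s1 (2 * x + 2 * m' + 20) (fun s2 =>
       [/\ preserves_ctx m'.+1 s1 s2, represents lim st (D x.+1) s2,
         forall j, nmem s2 nat_buffer j = nmem s1 nat_buffer j
       & forall j, rmem s2 real_buffer j = rmem s1 real_buffer j])) ->
  runs (oracle st) (CFor b m' copy) s (loop_cost b m' (2 * bound_cost b X + 2 * m' + 20) X)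
    (fun s' => preserves_ctx m' s s' /\ represents lim st (D (bound_val b st)) s').
Proof.
move=> w r0 B0 run_copy; have [_ _ N_le] := bound_expE b lim_gt0 w r0.
pose Inv x s1 := [/\ preserves_ctx m' s s1, represents lim st (D x) s1
  & forall j, j < bound_val b st -> Buf j (nmem s1 nat_buffer j) (rmem s1 real_buffer j)].
have set_var x v s1 : Inv x s1 -> Inv x (set_nat s1 loop_vars m' v).
  move=> [P1 r1 B1]; split=> //; last exact: represents_set_nat.
  by apply: preserves_ctx_trans P1 _; apply: preserves_ctx_set_nat; rewrite leqnn.
apply: (@runs_weak _ _ _ _ _ _ (Inv (bound_val b st)) _ (leqnn _)) => [s' [] //|].
apply: (runs_loop (Inv := Inv) lim_gt0 w) => [x s1 [_ r1 _]|x s1 xN V1 [P1 r1 B1]|].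
- by exists (D x).
- apply: (runs_weak _ _ (run_copy x s1 V1 (B1 x xN) r1)) => [|s2 [/preserves_ctxS[P2 V2] r2 n2 q2]].
    by lia.
  split; first by rewrite V2.
  apply: set_var; split=> //; first exact: preserves_ctx_trans P1 P2.
  by move=> j jN; rewrite n2 q2; exact: B1.
exact: set_var.
Qed.

End Fill.

Lemma definable_fill b lim m (P : ctx m.+1 -> env -> tables -> nat -> nat -> R -> Prop)
    (store copy : nat -> cmd) (Buf : ctx m -> env -> tables -> nat -> nat -> R -> Prop)
    (D : ctx m -> env -> tables -> nat -> tables) :
  0 < lim -> definable lim P ->
  (forall m' (st : env) d e x s B, nmem s loop_vars m' = x ->
     P (e, x) st d B (nmem s nat_stack 0) (rmem s real_stack 0) ->
     runs (oracle st) (store m') s (B + x + m' + 20) (fun s' => same_but_buffers x s s' /\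
       Buf e st d x (nmem s' nat_buffer x) (rmem s' real_buffer x))) ->
  (forall m' (st : env) d e x s, nmem s loop_vars m' = x ->
     Buf e st d x (nmem s nat_buffer x) (rmem s real_buffer x) ->
     represents lim st (D e st d x) s ->
     runs (oracle st) (copy m') s (2 * x + 2 * m' + 20) (fun s' =>
       [/\ preserves_ctx m'.+1 s s', represents lim st (D e st d x.+1) s',
         forall j, nmem s' nat_buffer j = nmem s nat_buffer j
       & forall j, rmem s' real_buffer j = rmem s real_buffer j])) ->
  (forall (st : env) d e s, represents lim st d s -> represents lim st (D e st d 0) s) ->
  step_definable lim (fun e st d => D e st d (bound_val b st)).
Proof.
move=> lim0 H run_store run_copy D0 loc m' loc_lt.
have [c [T [pT run]]] := H _ _ 0 (loop_loc_lt loc_lt).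
pose T' X := T (bound_cost b X + X); have pT' : poly_bounded T' by exact: poly_bounded_loop_input.
exists (CSeq (CFor b m' (CSeq c (store m'))) (CFor b m' (copy m'))).
exists (fun X => 1 + loop_cost b m' (2 * T' X + bound_cost b X + m' + 30) X +
  loop_cost b m' (2 * bound_cost b X + 2 * m' + 20) X); split.
  have pb := poly_bounded_bound_cost b.
  by apply: poly_bounded_add; [apply: poly_bounded_add; first exact: poly_bounded_const|];
    apply: poly_bounded_loop_cost; solve_poly_bounded.
move=> X st d e s V; have [w _ _] := V.
apply: (runs_seq (@runs_buffer_loop lim m b lim0 X m' st d loc e loc_lt s c (store m') (T' X)
  (fun x v r => P (e, x) st d (T' X) v r) (Buf e st d) V _ _)) => [x s1 xN valid1|x s1|].
- exact: (run _ st d (e, x) s1 valid1).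
- exact: run_store.
move=> s1 [P1 r1 B1].
apply: (runs_weak (leqnn _) _
  (runs_copy_loop (D := D e st d) lim0 w (D0 st d e s1 r1) B1 _)) => [s2 [P2 r2]|].
  by split=> //; exact: preserves_ctx_trans P1 P2.
by move=> x s2; exact: run_copy.
Qed.

Lemma definable_fill_btab A b lim m (phi : ctx m -> nat -> env -> tables -> bool) :
  0 < lim -> ~~ scratch A -> writable lim A ->
  bool_definable (m := m.+1) lim (fun e st d => phi e.1 e.2 st d) ->
  step_definable lim (fun e st d => fill_btab A (bound_val b st) (fun x => phi e x st) d).
Proof.
move=> lim0 nsA wA H; have [A7 A9] : A != loop_vars /\ nat_buffer != A.
  by move: nsA; rewrite /scratch !negb_or => /and3P[_ -> A9]; rewrite eq_sym.
apply: (@definable_fill b lim m _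
  (fun m' => CSetN nat_buffer (AGet loop_vars (ANat m')) (AGet nat_stack (ANat 0)))
  (fun m' => CSetN A (AGet loop_vars (ANat m')) (AGet nat_buffer (AGet loop_vars (ANat m'))))
  (fun e st d x v _ => v = phi e x st d)
  (fun e st d x => set_btab d A (fun j => if j < x then phi e j st d else btab d A j)) lim0 H).
- move=> m' st d e x s B Vx [Ev Bv]; apply: runs_set_nat; [exact: Vx|exact: Ev| |].
    rewrite /= Vx Ev; have := bitlen_leS m'; have := bitlen_leS x; have := bitlen_leS 0.
    by have := bitlen_le Bv; lia.
  split; last by rewrite /= /upd !eqxx.
  split=> // A' i /=; rewrite /upd; case: eqP => //= _; case: eqP => //.
- move=> m' st d e x s Vx Ev [rn rr]; apply: (@runs_set_nat _ _ _ _ _ _ x (phi e x st d)) => //.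
  + by rewrite /= Vx.
  + rewrite /= Vx Ev; have := bitlen_leS m'; have := bitlen_leS x.
    have : bitlen (phi e x st d) <= 2 by apply: (@bitlen_le _ 1); case: (phi e x st d).
    lia.
  split=> //; first by apply: preserves_ctx_set_nat; rewrite (negPf A7).
    split=> // A' j nsA'; rewrite /= /upd; case: (A' =P A) => [->|nA] /=; last first.
      by rewrite rn //=; case: eqP.
    rewrite wA ltnS leq_eqVlt; case: (j =P x) => [->//|_] /=.
    by rewrite rn // wA /= eqxx.
  by move=> j; rewrite /= /upd (negPf A9).
by move=> st d e s [rn rr]; split=> // A' j nsA'; rewrite rn //=; case: eqP => // ->.
Qed.

Lemma definable_fill_rtab A b lim m (phi : ctx m -> nat -> env -> tables -> R) :
  0 < lim -> real_buffer < A ->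
  real_definable (m := m.+1) lim (fun e st d => phi e.1 e.2 st d) ->
  step_definable lim (fun e st d => fill_rtab A (bound_val b st) (fun x => phi e x st) d).
Proof.
move=> lim0 A1 H; have A1' : real_buffer != A by rewrite neq_ltn A1.
apply: (@definable_fill b lim m _
  (fun m' => CSetR real_buffer (AGet loop_vars (ANat m')) (RGet real_stack (ANat 0)))
  (fun m' => CSetR A (AGet loop_vars (ANat m')) (RGet real_buffer (AGet loop_vars (ANat m'))))
  (fun e st d x _ r => r = phi e x st d)
  (fun e st d x => set_rtab d A (fun j => if j < x then phi e j st d else rtab d A j)) lim0 H).
- move=> m' st d e x s B Vx Ev; apply: runs_set_real; [exact: Vx|exact: Ev| |].
    by rewrite /= Vx; have := bitlen_leS m'; have := bitlen_leS x; have := bitlen_leS 0; lia.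
  split; last by rewrite /= /upd !eqxx.
  split=> // A' i /=; rewrite /upd; case: eqP => //= _; case: eqP => //.
- move=> m' st d e x s Vx Ev [rn rr]; apply: (@runs_set_real _ _ _ _ _ _ x (phi e x st d)) => //.
  + by rewrite /= Vx.
  + by rewrite /= Vx; have := bitlen_leS m'; have := bitlen_leS x; lia.
  split=> //; last by move=> j; rewrite /= /upd (negPf A1').
  split=> // A' j A'1; rewrite /= /upd; case: (A' =P A) => [->|nA] /=; last first.
    by rewrite rr //=; case: eqP.
  rewrite ltnS leq_eqVlt; case: (j =P x) => [->//|_] /=.
  by rewrite rr //= eqxx.
by move=> st d e s [rn rr]; split=> // A' j A'1; rewrite rr //=; case: eqP => // ->.
Qed.

End Steps.

(** * The algorithm *)

Notation adjacency_array := 1 (only parsing).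
Notation path_array := 2 (only parsing).
Notation limit_array := 3 (only parsing).
Notation weight_array := 4 (only parsing).
Notation coin_array := 8 (only parsing).
Notation distance_array := 10 (only parsing).
Notation ancestor_array := 11 (only parsing).
Notation candidate_array := 20 (only parsing).
Notation comp_best_array := 21 (only parsing).
Notation union_array := 22 (only parsing).
Notation best_array := 23 (only parsing).
Notation flag_array := 24 (only parsing).
Notation value_array := 2 (only parsing).
Notation search_arrays := 12 (only parsing).

Section InputNotions.
Variable st : memory nat.
Local Notation n := (bound_val BSize st).

Definition depth_of v := sumN n (fun t => st distance_array (t * n + v) == 0).

Definition parent_of v w := [&& v < n, w < n, st adjacency_array (v * n + w) != 0
  & depth_of w < depth_of v].

Definition ancestor_of v w := [&& v < n, w < n & st ancestor_array (v * n + w) != 0].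

Definition tree_of := Tree n ancestor_of parent_of.

Definition level_of b l := separator_level tree_of (powN n b l) (powN n b l.+1).

Definition coin v := st coin_array v != 0.

Definition on_path i v :=
  hasN n (fun w => parent_of v w && (st path_array ((i * n + v) * n + w) != 0)).

Definition path_load (F : pred nat) i := sumN n (fun v => on_path i v && F v).

Definition in_comp L c i :=
  allN n (fun v => on_path i v ==> conn L c v) && hasN n (fun v => on_path i v).

End InputNotions.

Section Program.
Variables (R : realType) (f : nat -> R) (st : memory nat).
Implicit Types (d : tables R) (L : level).
Local Notation n := (bound_val BSize st).
Local Notation k := (bound_val BCount st).

Definition commodity_revenue (F : pred nat) i : R :=
  (((path_load st F i <= st limit_array i) * st weight_array i)%:R * f (path_load st F i))%R.

Definition total_revenue F : R := sumR k (commodity_revenue F).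

Definition comp_revenue L c F : R :=
  sumR k (fun i => ((in_comp st L c i)%:R * commodity_revenue F i)%R).

(* The dynamic program on a forest: [value v j] is the maximal revenue of the commodities
   served at or below [v] if [j] vertices are chosen among [v] and the vertices above it. *)
Definition value_of d v j := rtab d value_array (v * (n + 1) + j).

Definition increments (Cap : nat -> pred nat) v j d :=
  [&& Cap v j.+1, j < n & (value_of d v j <= value_of d v j.+1)%R].

Definition best_value Cap v j d : R :=
  ((increments Cap v j d)%:R * value_of d v j.+1 +
   (~~ increments Cap v j d)%:R * value_of d v j)%R.

Definition local_revenue (served : nat -> nat -> pred nat) v j : R :=
  sumR k (fun i => ((served i v j * st weight_array i)%:R * f j)%R).

Definition value_step (next : rel nat) Cap served :=
  fill_rtab value_array (bound_val (BMul BSize (BAdd BSize (BConst 1))) st) (fun q d =>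
    (local_revenue served (q %/ (n + 1))%N (q %% (n + 1))%N +
     sumR n (fun c => (next c (q %/ (n + 1))%N)%:R * best_value Cap c (q %% (n + 1))%N d))%R).

Definition choice_step (N : pred nat) (above : rel nat) Cap :=
  fill_btab candidate_array n (fun v d => N v &&
    increments Cap v (sumN n (fun w => above v w && btab d candidate_array w)) d).

(* The recursions of the dynamic program are run by iterating the defining equations
   until they are stable. *)
Definition solve N next above Cap served d :=
  iterate n (fun _ => choice_step N above Cap)
    (iterate n (fun _ => value_step next Cap served) d).

Definition solve_sides L :=
  solve (side_vertex L (coin st)) (side_next L (coin st)) (side_above L (coin st))
    (fun _ _ => true)
    (fun i => side_served L (coin st) (on_path st i) (st limit_array i)).

Definition solve_segs up L c g :=
  solve (seg_vertex L (seg_budget L c g) c) (seg_next L (seg_budget L c g) c up)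
    (seg_ahead L (seg_budget L c g) c up) (seg_capacity L (seg_budget L c g))
    (fun i => seg_served L (seg_budget L c g) c up (on_path st i) (st limit_array i)).

(* The comparison goes through a flag because it has to be evaluated before [A] is
   overwritten. *)
Definition keep_better A (obj : pred nat -> R) d :=
  fill_btab A n (fun v d => if btab d flag_array 0 then btab d candidate_array v else btab d A v)
    (fill_btab flag_array (bound_val (BConst 1) st)
      (fun _ d => obj (btab d A) <= obj (btab d candidate_array))%R d).

Definition keep_comp L c := keep_better comp_best_array (comp_revenue L c).

Definition try_code L c g d :=
  keep_comp L c (fill_btab candidate_array n (fun v _ => lowest L (seg_budget L c g) c v)
    (keep_comp L c (solve_segs false L c g (keep_comp L c (solve_segs true L c g d))))).

Definition try_codes L c d :=
  iterate (bound_val (BMul (BConst 64) (BMul BSize BSize)) st) (fun g => try_code L c g)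
    (fill_btab comp_best_array n (fun _ _ => false) d).

Definition try_comp L c d :=
  fill_btab union_array n (fun v d =>
      if comp_top L c && conn L c v then btab d comp_best_array v else btab d union_array v)
    (try_codes L c d).

Definition try_level L d :=
  keep_better best_array total_revenue
    (fill_btab candidate_array n (fun v d => btab d union_array v)
      (iterate n (fun c => try_comp L c) (fill_btab union_array n (fun _ _ => false)
        (keep_better best_array total_revenue (solve_sides L d))))).

Definition best_search d :=
  iterate (bound_val (BAdd BSize (BConst 8)) st)
    (fun b => iterate n (fun l => try_level (level_of st b l)))
    (fill_btab best_array n (fun _ _ => false) d).

Definition write_output d :=
  fill_btab output_array (bound_val (BMul BSize BSize) st) (fun j d =>
    parent_of st (j %/ n) (j %% n) && btab d best_array (j %/ n)) d.

Definition distance_table d :=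
  iterate n (fun _ => fill_btab distance_array (bound_val (BMul BSize BSize) st) (fun j d =>
    if j %/ n == 0 then j %% n == 0 else
      btab d distance_array ((j %/ n - 1) * n + j %% n) ||
      hasN n (fun w => (st adjacency_array (w * n + j %% n) != 0) &&
         btab d distance_array ((j %/ n - 1) * n + w)))) d.

Definition ancestor_table d :=
  iterate n (fun _ => fill_btab ancestor_array (bound_val (BMul BSize BSize) st) (fun j d =>
    (j %/ n == j %% n) ||
    hasN n (fun p => parent_of st (j %% n) p && btab d ancestor_array (j %/ n * n + p)))) d.

End Program.

(** * Definability of the algorithm *)

Create HintDb definability.

Ltac definable_side := first [by [] | assumption | (rewrite /writable /=; lia)].

(* Goals about the context variables of an outer loop. *)
Ltac definable_outer :=
  lazymatch goal with
  | |- @nat_definable ?R ?lim (S ?m) ?F =>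
    let H := constr:(fun (q : ctx m) (x : nat) (st : env R) (d : tables R) => F (q, x) st d) in
    let H' := eval cbn [fst snd] in H in
    lazymatch H' with
    | fun q x st d => @?P q st d => refine (definable_weak (_ : @nat_definable R lim m P)); cbv beta
    end
  end.

Ltac definability := cbv beta; auto 200 with definability nocore.

Section Definability.
Variable R : realType.
Local Notation natfun m := (ctx m -> env R -> tables R -> nat).

#[local] Hint Extern 1 (nat_definable _ (fun _ _ _ => addn _ _)) =>
  apply: definable_add : definability.
#[local] Hint Extern 1 (nat_definable _ (fun _ _ _ => subn _ _)) =>
  apply: definable_sub : definability.
#[local] Hint Extern 1 (nat_definable _ (fun _ _ _ => muln _ _)) =>
  apply: definable_mul : definability.
#[local] Hint Extern 1 (nat_definable _ (fun _ _ _ => divn _ _)) =>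
  apply: definable_div : definability.
#[local] Hint Extern 1 (nat_definable _ (fun _ _ _ => modn _ _)) =>
  apply: definable_mod : definability.
#[local] Hint Extern 1 (nat_definable _ (fun _ _ _ => S _)) =>
  apply: definable_succ : definability.
#[local] Hint Extern 1 (nat_definable _ (fun _ _ _ => nat_of_bool _)) =>
  refine (_ : bool_definable _ _) : definability.
#[local] Hint Extern 1 (nat_definable _ (fun _ st _ => bound_val _ (env_mem st))) =>
  (apply: definable_bound; definable_side) : definability.
#[local] Hint Extern 1 (nat_definable _ (fun _ _ _ => sumN (bound_val _ _) _)) =>
  (apply: definable_sumN; [definable_side|cbv beta]) : definability.
#[local] Hint Extern 1 (nat_definable _ (fun _ _ _ => sumN (tree_size _) _)) =>
  (apply: (definable_sumN _ BSize); [definable_side|cbv beta]) : definability.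
#[local] Hint Extern 1 (nat_definable _ (fun _ _ _ => prodN (bound_val _ _) _)) =>
  (apply: definable_prodN; [definable_side|cbv beta]) : definability.
#[local] Hint Extern 1 (nat_definable _ (fun _ _ _ => if _ then _ else _)) =>
  apply: definable_if : definability.
#[local] Hint Extern 1 (nat_definable _ (fun e _ _ => snd e)) =>
  exact: definable_var : definability.
#[local] Hint Extern 1 (nat_definable _ (fun _ st _ => env_mem st ?A _)) =>
  (apply: (definable_input (A := A)); [by []|definable_side|]) : definability.
#[local] Hint Extern 1 (nat_definable _ (fun _ _ _ => ?c)) =>
  exact: definable_const : definability.
#[local] Hint Extern 9 (nat_definable _ _) => definable_outer : definability.

#[local] Hint Extern 1 (bool_definable _ (fun _ _ _ => andb _ _)) =>
  apply: definable_and : definability.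
#[local] Hint Extern 1 (bool_definable _ (fun _ _ _ => orb _ _)) =>
  apply: definable_or : definability.
#[local] Hint Extern 1 (bool_definable _ (fun _ _ _ => negb _)) =>
  apply: definable_neg : definability.
#[local] Hint Extern 1 (bool_definable _ (fun _ _ _ => implb _ _)) =>
  apply: definable_implb : definability.
#[local] Hint Extern 1 (bool_definable _ (fun _ _ _ => leq _ _)) =>
  apply: definable_leq : definability.
#[local] Hint Extern 1 (bool_definable _ (fun _ _ _ => @eq_op _ _ _)) =>
  first [apply: definable_eqn | apply: definable_eqb] : definability.
#[local] Hint Extern 1 (bool_definable _ (fun _ _ _ => if _ then _ else _)) =>
  apply: definable_ifb : definability.
#[local] Hint Extern 1 (bool_definable _ (fun _ _ _ => hasN (bound_val _ _) _)) =>
  (apply: definable_hasN; [definable_side|cbv beta]) : definability.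
#[local] Hint Extern 1 (bool_definable _ (fun _ _ _ => hasN (tree_size _) _)) =>
  (apply: (definable_hasN _ BSize); [definable_side|cbv beta]) : definability.
#[local] Hint Extern 1 (bool_definable _ (fun _ _ _ => allN (bound_val _ _) _)) =>
  (apply: definable_allN; [definable_side|cbv beta]) : definability.
#[local] Hint Extern 1 (bool_definable _ (fun _ _ _ => allN (tree_size _) _)) =>
  (apply: (definable_allN _ BSize); [definable_side|cbv beta]) : definability.
#[local] Hint Extern 1 (bool_definable _ (fun _ _ d => btab d ?A _)) =>
  (apply: (definable_btab (A := A)); [definable_side|definable_side|]) : definability.
#[local] Hint Extern 1 (bool_definable _ (fun _ _ _ => Order.le _ _)) =>
  apply: definable_ler : definability.
#[local] Hint Extern 1 (bool_definable ?lim (fun _ _ _ => ?c)) =>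
  exact: (@definable_const _ lim _ (nat_of_bool c)) : definability.

#[local] Hint Extern 1 (real_definable _ (fun _ _ _ => GRing.add _ _)) =>
  apply: definable_addr : definability.
#[local] Hint Extern 1 (real_definable _ (fun _ _ _ => GRing.mul (GRing.natmul _ _) _)) =>
  apply: definable_scale : definability.
#[local] Hint Extern 1 (real_definable _ (fun _ _ _ => sumR (bound_val _ _) _)) =>
  (apply: definable_sumR; [definable_side|cbv beta]) : definability.
#[local] Hint Extern 1 (real_definable _ (fun _ _ d => rtab d ?A _)) =>
  (apply: (definable_rtab (A := A)); [by []|]) : definability.
#[local] Hint Extern 1 (real_definable _ (fun _ st _ => oracle st _)) =>
  apply: definable_oracle : definability.

Lemma definable_parent lim m (v w : natfun m) : distance_array < lim ->
  nat_definable lim v -> nat_definable lim w ->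
  bool_definable lim (fun e st d => parent_of st (v e st d) (w e st d)).
Proof. by move=> ltlim *; rewrite /parent_of /depth_of; definability. Qed.

#[local] Hint Extern 1 (bool_definable _ (fun _ _ _ => parent_of _ _ _)) =>
  (apply: definable_parent; [definable_side| |]) : definability.
#[local] Hint Extern 1 (bool_definable _ (fun _ _ _ => child _ _ _)) =>
  (apply: definable_parent; [definable_side| |]) : definability.

Lemma definable_ancestor m (v w : natfun m) :
  nat_definable search_arrays v -> nat_definable search_arrays w ->
  @bool_definable R search_arrays m (fun e st d => ancestor_of st (v e st d) (w e st d)).
Proof. by move=> *; rewrite /ancestor_of; definability. Qed.

#[local] Hint Extern 1 (bool_definable _ (fun _ _ _ => ancestor_of _ _ _)) =>
  apply: definable_ancestor : definability.
#[local] Hint Extern 1 (bool_definable _ (fun _ _ _ => anc _ _ _)) =>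
  apply: definable_ancestor : definability.

Lemma definable_coin m (v : natfun m) :
  nat_definable search_arrays v ->
  @bool_definable R search_arrays m (fun e st d => coin st (v e st d)).
Proof. by move=> *; rewrite /coin; definability. Qed.

#[local] Hint Extern 1 (bool_definable _ (fun _ _ _ => coin _ _)) =>
  apply: definable_coin : definability.

Lemma definable_on_path m (i v : natfun m) :
  nat_definable search_arrays i -> nat_definable search_arrays v ->
  @bool_definable R search_arrays m (fun e st d => on_path st (i e st d) (v e st d)).
Proof. by move=> *; rewrite /on_path; definability. Qed.

#[local] Hint Extern 1 (bool_definable _ (fun _ _ _ => on_path _ _ _)) =>
  apply: definable_on_path : definability.

Lemma definable_powN m (b l : natfun m) :
  nat_definable search_arrays b -> nat_definable search_arrays l ->
  @nat_definable R search_arrays m (fun e st d => powN (bound_val BSize st) (b e st d) (l e st d)).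
Proof. by move=> *; rewrite /powN; definability. Qed.

#[local] Hint Extern 1 (nat_definable _ (fun _ _ _ => powN _ _ _)) =>
  apply: definable_powN : definability.

Lemma definable_log2N m :
  @nat_definable R search_arrays m (fun e st d => log2N (bound_val BSize st)).
Proof. by rewrite /log2N; definability. Qed.

#[local] Hint Extern 1 (nat_definable _ (fun _ _ _ => log2N _)) =>
  apply: definable_log2N : definability.

Lemma definable_subtree_size m (v : natfun m) :
  nat_definable search_arrays v ->
  @nat_definable R search_arrays m (fun e st d => subtree_size (tree_of st) (v e st d)).
Proof. by move=> *; rewrite /subtree_size; definability. Qed.

#[local] Hint Extern 1 (nat_definable _ (fun _ _ _ => subtree_size _ _)) =>
  apply: definable_subtree_size : definability.

Local Notation nat_def phi := (nat_definable search_arrays phi).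
Local Notation level_at b l e st d := (level_of st (b e st d) (l e st d)).
Local Notation budget_at b l c g e st d :=
  (seg_budget (level_at b l e st d) (c e st d) (g e st d)).

Lemma definable_separator m (q v : natfun m) :
  nat_def q -> nat_def v ->
  bool_definable search_arrays (fun e st d => separator (tree_of st) (q e st d) (v e st d)).
Proof. by move=> *; rewrite /separator; definability. Qed.

#[local] Hint Extern 1 (bool_definable _ (fun _ _ _ => separator _ _ _)) =>
  apply: definable_separator : definability.

Lemma definable_free m (b l v : natfun m) :
  nat_def b -> nat_def l -> nat_def v ->
  bool_definable search_arrays (fun e st d => free (level_at b l e st d) (v e st d)).
Proof. by move=> *; rewrite /level_of /=; definability. Qed.

#[local] Hint Extern 1 (bool_definable _ (fun _ _ _ => free _ _)) =>
  apply: definable_free : definability.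

Lemma definable_mark m (b l v : natfun m) :
  nat_def b -> nat_def l -> nat_def v ->
  bool_definable search_arrays (fun e st d => mark (level_at b l e st d) (v e st d)).
Proof. by move=> *; rewrite /level_of /=; definability. Qed.

#[local] Hint Extern 1 (bool_definable _ (fun _ _ _ => mark _ _)) =>
  apply: definable_mark : definability.

Lemma definable_conn m (b l v w : natfun m) :
  nat_def b -> nat_def l -> nat_def v -> nat_def w ->
  bool_definable search_arrays (fun e st d => conn (level_at b l e st d) (v e st d) (w e st d)).
Proof. by move=> *; rewrite /conn; definability. Qed.

#[local] Hint Extern 1 (bool_definable _ (fun _ _ _ => conn _ _ _)) =>
  apply: definable_conn : definability.

Lemma definable_comp_top m (b l v : natfun m) :
  nat_def b -> nat_def l -> nat_def v ->
  bool_definable search_arrays (fun e st d => comp_top (level_at b l e st d) (v e st d)).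
Proof. by move=> *; rewrite /comp_top; definability. Qed.

#[local] Hint Extern 1 (bool_definable _ (fun _ _ _ => comp_top _ _)) =>
  apply: definable_comp_top : definability.

Lemma definable_skeleton m (b l v : natfun m) :
  nat_def b -> nat_def l -> nat_def v ->
  bool_definable search_arrays (fun e st d => skeleton (level_at b l e st d) (v e st d)).
Proof. by move=> *; rewrite /skeleton; definability. Qed.

#[local] Hint Extern 1 (bool_definable _ (fun _ _ _ => skeleton _ _)) =>
  apply: definable_skeleton : definability.

Lemma definable_seg_end m (b l v : natfun m) :
  nat_def b -> nat_def l -> nat_def v ->
  bool_definable search_arrays (fun e st d => seg_end (level_at b l e st d) (v e st d)).
Proof. by move=> *; rewrite /seg_end; definability. Qed.

#[local] Hint Extern 1 (bool_definable _ (fun _ _ _ => seg_end _ _)) =>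
  apply: definable_seg_end : definability.

Lemma definable_in_seg m (b l v z : natfun m) :
  nat_def b -> nat_def l -> nat_def v -> nat_def z ->
  bool_definable search_arrays (fun e st d => in_seg (level_at b l e st d) (v e st d) (z e st d)).
Proof. by move=> *; rewrite /in_seg; definability. Qed.

#[local] Hint Extern 1 (bool_definable _ (fun _ _ _ => in_seg _ _ _)) =>
  apply: definable_in_seg : definability.

Lemma definable_same_seg m (b l v w : natfun m) :
  nat_def b -> nat_def l -> nat_def v -> nat_def w ->
  bool_definable search_arrays (fun e st d => same_seg (level_at b l e st d) (v e st d) (w e st d)).
Proof. by move=> *; rewrite /same_seg; definability. Qed.

#[local] Hint Extern 1 (bool_definable _ (fun _ _ _ => same_seg _ _ _)) =>
  apply: definable_same_seg : definability.

Lemma definable_hanging_root m (b l v y : natfun m) :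
  nat_def b -> nat_def l -> nat_def v -> nat_def y ->
  bool_definable search_arrays (fun e st d =>
    hanging_root (level_at b l e st d) (v e st d) (y e st d)).
Proof. by move=> *; rewrite /hanging_root; definability. Qed.

#[local] Hint Extern 1 (bool_definable _ (fun _ _ _ => hanging_root _ _ _)) =>
  apply: definable_hanging_root : definability.

Lemma definable_side_vertex m (b l v : natfun m) :
  nat_def b -> nat_def l -> nat_def v ->
  bool_definable search_arrays (fun e st d =>
    side_vertex (level_at b l e st d) (coin st) (v e st d)).
Proof. by move=> *; rewrite /side_vertex; definability. Qed.

#[local] Hint Extern 1 (bool_definable _ (fun _ _ _ => side_vertex _ _ _)) =>
  apply: definable_side_vertex : definability.

Lemma definable_side_next m (b l v w : natfun m) :
  nat_def b -> nat_def l -> nat_def v -> nat_def w ->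
  bool_definable search_arrays (fun e st d =>
    side_next (level_at b l e st d) (coin st) (v e st d) (w e st d)).
Proof. by move=> *; rewrite /side_next /chain_next /side_linked /next_vertex; definability. Qed.

#[local] Hint Extern 1 (bool_definable _ (fun _ _ _ => side_next _ _ _ _)) =>
  apply: definable_side_next : definability.

Lemma definable_side_above m (b l v w : natfun m) :
  nat_def b -> nat_def l -> nat_def v -> nat_def w ->
  bool_definable search_arrays (fun e st d =>
    side_above (level_at b l e st d) (coin st) (v e st d) (w e st d)).
Proof. by move=> *; rewrite /side_above /chain_ahead /side_linked /ahead; definability. Qed.

#[local] Hint Extern 1 (bool_definable _ (fun _ _ _ => side_above _ _ _ _)) =>
  apply: definable_side_above : definability.

Lemma definable_side_served m (b l i u v j : natfun m) :
  nat_def b -> nat_def l -> nat_def i -> nat_def u -> nat_def v -> nat_def j ->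
  bool_definable search_arrays (fun e st d =>
    side_served (level_at b l e st d) (coin st) (on_path st (i e st d)) (u e st d)
      (v e st d) (j e st d)).
Proof. by move=> *; rewrite /side_served; definability. Qed.

#[local] Hint Extern 1 (bool_definable _ (fun _ _ _ => side_served _ _ _ _ _ _)) =>
  apply: definable_side_served : definability.

Lemma definable_seg_index m (b l c z : natfun m) :
  nat_def b -> nat_def l -> nat_def c -> nat_def z ->
  nat_definable search_arrays (fun e st d => seg_index (level_at b l e st d) (c e st d) (z e st d)).
Proof. by move=> *; rewrite /seg_index; definability. Qed.

#[local] Hint Extern 1 (nat_definable _ (fun _ _ _ => seg_index _ _ _)) =>
  apply: definable_seg_index : definability.

Lemma definable_seg_digit m (b l c g z : natfun m) :
  nat_def b -> nat_def l -> nat_def c -> nat_def g -> nat_def z ->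
  nat_definable search_arrays (fun e st d =>
    seg_digit (level_at b l e st d) (c e st d) (g e st d) (z e st d)).
Proof. by move=> *; rewrite /seg_digit; definability. Qed.

#[local] Hint Extern 1 (nat_definable _ (fun _ _ _ => seg_digit _ _ _ _)) =>
  apply: definable_seg_digit : definability.

Lemma definable_seg_budget m (b l c g z : natfun m) :
  nat_def b -> nat_def l -> nat_def c -> nat_def g -> nat_def z ->
  nat_definable search_arrays (fun e st d =>
    seg_budget (level_at b l e st d) (c e st d) (g e st d) (z e st d)).
Proof. by move=> *; rewrite /seg_budget; definability. Qed.

#[local] Hint Extern 1 (nat_definable _ (fun _ _ _ => seg_budget _ _ _ _)) =>
  apply: definable_seg_budget : definability.

Lemma definable_seg_vertex m (b l c g v : natfun m) :
  nat_def b -> nat_def l -> nat_def c -> nat_def g -> nat_def v ->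
  bool_definable search_arrays (fun e st d =>
    seg_vertex (level_at b l e st d) (budget_at b l c g e st d) (c e st d) (v e st d)).
Proof. by move=> *; rewrite /seg_vertex; definability. Qed.

#[local] Hint Extern 1 (bool_definable _ (fun _ _ _ => seg_vertex _ _ _ _)) =>
  apply: definable_seg_vertex : definability.

Lemma definable_seg_capacity m (b l c g v j : natfun m) :
  nat_def b -> nat_def l -> nat_def c -> nat_def g -> nat_def v -> nat_def j ->
  bool_definable search_arrays (fun e st d =>
    seg_capacity (level_at b l e st d) (budget_at b l c g e st d) (v e st d) (j e st d)).
Proof. by move=> *; rewrite /seg_capacity; definability. Qed.

#[local] Hint Extern 1 (bool_definable _ (fun _ _ _ => seg_capacity _ _ _ _)) =>
  apply: definable_seg_capacity : definability.

Lemma definable_lowest m (b l c g v : natfun m) :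
  nat_def b -> nat_def l -> nat_def c -> nat_def g -> nat_def v ->
  bool_definable search_arrays (fun e st d =>
    lowest (level_at b l e st d) (budget_at b l c g e st d) (c e st d) (v e st d)).
Proof. by move=> *; rewrite /lowest /lower_count; definability. Qed.

#[local] Hint Extern 1 (bool_definable _ (fun _ _ _ => lowest _ _ _ _)) =>
  apply: definable_lowest : definability.

Lemma definable_other_load m (b l c g i v : natfun m) :
  nat_def b -> nat_def l -> nat_def c -> nat_def g -> nat_def i -> nat_def v ->
  nat_definable search_arrays (fun e st d =>
    other_load (level_at b l e st d) (budget_at b l c g e st d) (c e st d)
      (on_path st (i e st d)) (v e st d)).
Proof. by move=> *; rewrite /other_load; definability. Qed.

#[local] Hint Extern 1 (nat_definable _ (fun _ _ _ => other_load _ _ _ _ _)) =>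
  apply: definable_other_load : definability.

Lemma definable_seg_next up m (b l c g v w : natfun m) :
  nat_def b -> nat_def l -> nat_def c -> nat_def g -> nat_def v -> nat_def w ->
  bool_definable search_arrays (fun e st d =>
    seg_next (level_at b l e st d) (budget_at b l c g e st d) (c e st d) up (v e st d) (w e st d)).
Proof. by case: up => *; rewrite /seg_next /chain_next /next_vertex; definability. Qed.

#[local] Hint Extern 1 (bool_definable _ (fun _ _ _ => seg_next _ _ _ _ _ _)) =>
  apply: definable_seg_next : definability.

Lemma definable_seg_ahead up m (b l c g v w : natfun m) :
  nat_def b -> nat_def l -> nat_def c -> nat_def g -> nat_def v -> nat_def w ->
  bool_definable search_arrays (fun e st d =>
    seg_ahead (level_at b l e st d) (budget_at b l c g e st d) (c e st d) up (v e st d) (w e st d)).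
Proof. by case: up => *; rewrite /seg_ahead /chain_ahead /ahead; definability. Qed.

#[local] Hint Extern 1 (bool_definable _ (fun _ _ _ => seg_ahead _ _ _ _ _ _)) =>
  apply: definable_seg_ahead : definability.

Lemma definable_seg_fits up m (b l c g i v : natfun m) :
  nat_def b -> nat_def l -> nat_def c -> nat_def g -> nat_def i -> nat_def v ->
  bool_definable search_arrays (fun e st d =>
    seg_fits (level_at b l e st d) (budget_at b l c g e st d) (c e st d) up
      (on_path st (i e st d)) (v e st d)).
Proof. by case: up => *; rewrite /seg_fits /ahead; definability. Qed.

#[local] Hint Extern 1 (bool_definable _ (fun _ _ _ => seg_fits _ _ _ _ _ _)) =>
  apply: definable_seg_fits : definability.

Lemma definable_seg_served up m (b l c g i u v j : natfun m) :
  nat_def b -> nat_def l -> nat_def c -> nat_def g -> nat_def i -> nat_def u ->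
  nat_def v -> nat_def j ->
  bool_definable search_arrays (fun e st d =>
    seg_served (level_at b l e st d) (budget_at b l c g e st d) (c e st d) up
      (on_path st (i e st d))     (u e st d) (v e st d) (j e st d)).
Proof. by move=> *; rewrite /seg_served; definability. Qed.

#[local] Hint Extern 1 (bool_definable _ (fun _ _ _ => seg_served _ _ _ _ _ _ _ _)) =>
  apply: definable_seg_served : definability.

Lemma definable_path_load A m (i : natfun m) : ~~ scratch A -> writable search_arrays A ->
  nat_def i ->
  nat_definable search_arrays (fun e st d => path_load st (btab d A) (i e st d)).
Proof. by move=> *; rewrite /path_load; definability. Qed.

#[local] Hint Extern 1 (nat_definable _ (fun _ _ _ => path_load _ _ _)) =>
  (apply: definable_path_load; [definable_side|definable_side|]) : definability.

Lemma definable_commodity_revenue A m (i : natfun m) :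
  ~~ scratch A -> writable search_arrays A -> nat_definable search_arrays i ->
  real_definable search_arrays (fun e st d =>
    commodity_revenue (oracle st) st (btab d A) (i e st d)).
Proof. by move=> *; rewrite /commodity_revenue; definability. Qed.

#[local] Hint Extern 1 (real_definable _ (fun _ _ _ => commodity_revenue _ _ _ _)) =>
  (apply: definable_commodity_revenue; [definable_side|definable_side|]) : definability.

(** ** The steps of the search *)

#[local] Hint Extern 1 (step_definable _ (fun _ st d => fill_btab ?A (bound_val _ _) _ d)) =>
  (apply: (definable_fill_btab (A := A)); [by []|by []|by []|cbv beta]) : definability.
#[local] Hint Extern 1 (step_definable _ (fun _ st d => fill_rtab ?A (bound_val _ _) _ d)) =>
  (apply: (definable_fill_rtab (A := A)); [by []|by []|cbv beta]) : definability.
#[local] Hint Extern 1 (step_definable _ (fun _ st d => iterate (bound_val _ _) _ d)) =>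
  (apply: definable_step_for; [by []|cbv beta]) : definability.

Lemma definable_distance_table :
  @step_definable R distance_array 0 (fun _ st d => distance_table st d).
Proof. by rewrite /distance_table; definability. Qed.

Lemma definable_ancestor_table :
  @step_definable R ancestor_array 0 (fun _ st d => ancestor_table st d).
Proof. by rewrite /ancestor_table; definability. Qed.

#[local] Hint Extern 2 (step_definable _ _) =>
  lazymatch goal with
  | |- @step_definable R ?lim ?m (fun e st d =>
         iterate (bound_val ?b (env_mem st)) (@?F e st) (@?G e st d)) =>
      refine (@definable_step_seq R lim m G
        (fun e st d => iterate (bound_val b (env_mem st)) (F e st) d) _ _); cbv beta
  | |- @step_definable R ?lim ?m (fun e st d =>
         fill_btab ?A (bound_val ?b (env_mem st)) (@?phi e st) (@?G e st d)) =>
      refine (@definable_step_seq R lim m G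
        (fun e st d => fill_btab A (bound_val b (env_mem st)) (phi e st) d) _ _); cbv beta
  end : definability.

Section SearchSteps.
Variables (m : nat) (b l : ctx m -> nat).
Hypothesis def_b : @nat_definable R search_arrays m (fun e _ _ => b e).
Hypothesis def_l : @nat_definable R search_arrays m (fun e _ _ => l e).

Lemma definable_solve_sides : @step_definable R search_arrays m (fun e st d =>
  solve_sides (oracle st) st (level_of st (b e) (l e)) d).
Proof.
rewrite /solve_sides /solve /choice_step /value_step /local_revenue /best_value /increments.
by rewrite /value_of; definability.
Qed.

Lemma definable_keep_better A (obj : ctx m -> env R -> pred nat -> R) :
  ~~ scratch A -> writable search_arrays A ->
  (forall B, ~~ scratch B -> writable search_arrays B ->
    @real_definable R search_arrays m (fun e st d => obj e st (btab d B))) ->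
  @step_definable R search_arrays m (fun e st d => keep_better st A (obj e st) d).
Proof.
move=> nsA wA def_obj; rewrite /keep_better.
have def_flag : @step_definable R search_arrays m (fun e st d =>
    fill_btab flag_array (bound_val (BConst 1) st)
      (fun _ d => obj e st (btab d A) <= obj e st (btab d candidate_array))%R d).
  apply: (definable_fill_btab (A := flag_array)) => //; apply: definable_ler.
    exact: (definable_weak (def_obj A nsA wA)).
  exact: (definable_weak (def_obj candidate_array isT isT)).
have def_copy : @step_definable R search_arrays m (fun e st d =>
    fill_btab A (bound_val BSize st) (fun v d =>
      if btab d flag_array 0 then btab d candidate_array v else btab d A v) d).
  by apply: (definable_fill_btab (A := A)) => //; definability.
exact: (definable_step_seq def_flag def_copy).
Qed.

Lemma definable_keep_total : @step_definable R search_arrays m (fun e st d =>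
  keep_better st best_array (total_revenue (oracle st) st) d).
Proof. by apply: definable_keep_better => // B *; rewrite /total_revenue; definability. Qed.

Variable c : ctx m -> nat.
Hypothesis def_c : @nat_definable R search_arrays m (fun e _ _ => c e).

Lemma definable_keep_comp : @step_definable R search_arrays m (fun e st d =>
  keep_comp (oracle st) st (level_of st (b e) (l e)) (c e) d).
Proof.
by apply: definable_keep_better => // B *; rewrite /comp_revenue /in_comp; definability.
Qed.

Variable g : ctx m -> nat.
Hypothesis def_g : @nat_definable R search_arrays m (fun e _ _ => g e).

Lemma definable_solve_segs up : @step_definable R search_arrays m (fun e st d =>
  solve_segs (oracle st) st up (level_of st (b e) (l e)) (c e) (g e) d).
Proof.
rewrite /solve_segs /solve /choice_step /value_step /local_revenue /best_value /increments.
by rewrite /value_of; definability.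
Qed.

Lemma definable_try_code : @step_definable R search_arrays m (fun e st d =>
  try_code (oracle st) st (level_of st (b e) (l e)) (c e) (g e) d).
Proof.
have K := definable_keep_comp.
have lows : @step_definable R search_arrays m (fun e st d =>
    fill_btab candidate_array (bound_val BSize st) (fun v _ =>
      lowest (level_of st (b e) (l e)) (seg_budget (level_of st (b e) (l e)) (c e) (g e))
        (c e) v) d).
  by definability.
exact: (definable_step_seq (definable_step_seq (definable_step_seq (definable_step_seq
  (definable_step_seq (definable_solve_segs true) K) (definable_solve_segs false)) K) lows) K).
Qed.

End SearchSteps.

#[local] Hint Extern 1 (step_definable _ (fun _ _ d => try_code _ _ _ _ _ d)) =>
  apply: definable_try_code : definability.

Lemma definable_try_comp m (b l c : ctx m -> nat) :
  @nat_definable R search_arrays m (fun e _ _ => b e) ->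
  @nat_definable R search_arrays m (fun e _ _ => l e) ->
  @nat_definable R search_arrays m (fun e _ _ => c e) ->
  @step_definable R search_arrays m (fun e st d =>
    try_comp (oracle st) st (level_of st (b e) (l e)) (c e) d).
Proof. by move=> *; rewrite /try_comp /try_codes; definability. Qed.

#[local] Hint Extern 1 (step_definable _ (fun _ _ d => try_comp _ _ _ _ d)) =>
  apply: definable_try_comp : definability.

Lemma definable_try_level m (b l : ctx m -> nat) :
  @nat_definable R search_arrays m (fun e _ _ => b e) ->
  @nat_definable R search_arrays m (fun e _ _ => l e) ->
  @step_definable R search_arrays m (fun e st d =>
    try_level (oracle st) st (level_of st (b e) (l e)) d).
Proof.
move=> Hb Hl; have K := @definable_keep_total m.
have union : @step_definable R search_arrays m (fun e st d =>
    fill_btab candidate_array (bound_val BSize st) (fun v d => btab d union_array v)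
      (iterate (bound_val BSize st)
        (fun c => try_comp (oracle st) st (level_of st (b e) (l e)) c)
        (fill_btab union_array (bound_val BSize st) (fun _ _ => false) d))).
  by definability.
exact: (definable_step_seq (definable_step_seq (definable_step_seq
  (definable_solve_sides Hb Hl) K) union) K).
Qed.

#[local] Hint Extern 1 (step_definable _ (fun _ _ d => try_level _ _ _ d)) =>
  apply: definable_try_level : definability.

Lemma definable_search : @step_definable R search_arrays 0 (fun _ st d =>
  write_output st (best_search (oracle st) st d)).
Proof. by rewrite /write_output /best_search; definability. Qed.

End Definability.

(** * Correctness of the dynamic program *)

Section Solve.
Variables (R : realType) (f : nat -> R) (st : memory nat).
Local Notation n := (bound_val BSize st).
Variables (N : pred nat) (next above : rel nat) (Cap : nat -> pred nat).
Variables (served : nat -> nat -> pred nat) (rank : nat -> nat).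
Hypothesis FR : forest n N next above rank.
Variable d : tables R.
Let dV := iterate n (fun _ => value_step f st next Cap served) d.
Let dF := solve f st N next above Cap served d.
Local Notation value v j := (value_of st dV v j).
Local Notation inc v j := (increments st Cap v j dV).
Local Notation best v j := (best_value st Cap v j dV).
Local Notation local := (local_revenue f st served).
Let F := btab dF candidate_array.
Local Notation above_count := (above_count n above).
Local Notation chain_count := (chain_count n above).

Lemma rtab_choice_step t (d1 : tables R) :
  rtab (iterate t (fun _ => choice_step st N above Cap) d1) = rtab d1.
Proof. by elim: t => // t IH; rewrite iterateS /= IH. Qed.

Lemma solve_frame A : A != candidate_array -> btab dF A = btab d A.
Proof.
move=> ne; have values t : btab (iterate t (fun _ => value_step f st next Cap served) d) = btab d.
  by elim: t => // t IH; rewrite iterateS /= IH.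
have choices t d1 : btab (iterate t (fun _ => choice_step st N above Cap) d1) A = btab d1 A.
  by elim: t => // t IH; rewrite iterateS /= (negPf ne) IH.
by rewrite /dF /solve choices values.
Qed.

Lemma value_stepE d1 v j : v < n -> j <= n -> value_of st (value_step f st next Cap served d1) v j =
  (local v j + \sum_(c < n) (next c v)%:R * best_value st Cap c j d1)%R.
Proof.
move=> vn jn; rewrite /value_of /value_step /=.
have jn1 : j < n + 1 by rewrite addn1.
have -> : v * (n + 1) + j < bound_val (BMul BSize (BAdd BSize (BConst 1))) st := ltn_index vn jn1.
by rewrite divn_index ?modn_index.
Qed.

Lemma value_fix v j : v < n -> j <= n ->
  value v j = (local v j + \sum_(c < n) (next c v)%:R * best c j)%R.
Proof.
move=> vn jn; pose D t := iterate t (fun _ => value_step f st next Cap served) d.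
have DS t w i : w < n -> i <= n -> value_of st (D t.+1) w i =
    (local w i + \sum_(c < n) (next c w)%:R * best_value st Cap c i (D t))%R.
  by move=> wn lin; rewrite /D iterateS value_stepE.
have stable t : forall w i, w < n -> i <= n -> n <= rank w + t ->
    value_of st (D t.+1) w i = value_of st (D t) w i.
  elim: t => [|t IH] w i wn lin le; first by have := forest_rank_lt FR wn; lia.
  rewrite (DS t.+1) // (DS t) //; congr (_ + _)%R; apply: eq_bigr => c _.
  case cw: (next c w); last by rewrite !mul0r.
  have lt := forest_rank FR cw; have le' : n <= rank c + t by lia.
  rewrite /best_value /increments; case: (ltnP i n) => lt'; rewrite ?andbF ?andFb /=.
    by rewrite !IH.
  by rewrite !mul0r !add0r !mul1r IH.
rewrite -[dV]/(D n) -(stable n) //; last exact: leq_addl.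
exact: DS.
Qed.

Lemma choice_fix v : v < n -> F v = N v && inc v (above_count F v).
Proof.
move=> vn; pose D t := iterate t (fun _ => choice_step st N above Cap) dV.
have DS t w : w < n -> btab (D t.+1) candidate_array w =
    N w && inc w (above_count (btab (D t) candidate_array) w).
  move=> wn; rewrite /D iterateS /= wn; congr (_ && _).
  by rewrite /increments /value_of rtab_choice_step.
have stable t : forall w, w < n -> rank w < t ->
    btab (D t.+1) candidate_array w = btab (D t) candidate_array w.
  elim: t => [|t IH] w wn le //.
  rewrite (DS t.+1) // (DS t) //; congr (_ && increments _ _ _ _ _); apply: eq_sumN => y _.
  by case wy: (above w y) => //=; have [lt yn] := forest_above_rank FR wy; rewrite IH //; lia.
have -> : F = btab (D n) candidate_array by [].
by rewrite -DS // stable //; exact: (forest_rank_lt FR).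
Qed.

Lemma solve_in_forest v : v < n -> F v -> N v.
Proof. by move=> vn; rewrite choice_fix // => /andP[]. Qed.

Lemma solve_capacity v : v < n -> F v -> Cap v (chain_count F v).
Proof.
move=> vn Fv; move: (Fv); rewrite choice_fix // => /andP[_ /and3P[C _ _]].
by rewrite /chain_count Fv addn1.
Qed.

Definition is_root v := [forall p : 'I_n, ~~ next v p].

Lemma is_rootP v : reflect (forall p, ~~ next v p) (is_root v).
Proof.
apply: (iffP forallP) => H p; last exact: H.
by apply/negP => vp; have := H (Ordinal (forest_next_lt FR vp).2); rewrite /= vp.
Qed.

(* Every solution telescopes to its value at the roots; [gp v] is the number of vertices
   that it uses at the parent of [v] or above. *)
Lemma local_revenue_telescope (g gp : nat -> nat) : (forall v, v < n -> g v <= n) ->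
  (forall v p, next v p -> gp v = g p) ->
  (\sum_(v < n | N v) local v (g v) =
   \sum_(v < n | N v) (value v (g v) - (~~ is_root v)%:R * best v (gp v)))%R.
Proof.
move=> gn Hgp; rewrite big_split /= sumrN.
under [X in (X - _)%R]eq_bigr => v _ do rewrite value_fix ?gn //.
rewrite big_split /= -addrA; apply/esym/eqP; rewrite -subr_eq0 addrAC subrr add0r subr_eq0.
apply/eqP; rewrite exchange_big /= [RHS]big_mkcond /=; apply: eq_bigr => c _.
case: (is_rootP c) => [root|hp] /=.
  rewrite big1 => [|v _]; first by rewrite mul0r; case: ifP.
  by rewrite (negPf (root v)) mul0r.
have [p cp] : exists p, next c p.
  by apply: contrapT => H; apply: hp => p; apply/negP => cp; apply: H; exists p.
have [Nc Np] := forest_next FR cp; have pn := (forest_next_lt FR cp).2.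
rewrite Nc (bigD1 (Ordinal pn)) //= cp !mul1r (Hgp _ _ cp) big1 ?addr0 // => v /andP[_ ne].
case cv: (next c v); last by rewrite mul0r.
by case/eqP: ne; apply: val_inj; exact: (forest_next_uniq FR cv cp).
Qed.

Lemma value_le_best v gp g : v < n -> g <= n -> g = gp \/ g = gp.+1 /\ Cap v g ->
  (value v g <= best v gp)%R.
Proof.
move=> vn gn H; rewrite /best_value.
case: (boolP (inc v gp)) => [i|ni] /=; rewrite !(mul0r, mul1r, add0r, addr0).
  by case: H => [->|[-> _] //]; case/and3P: i.
case: H => [->//|[E C]]; move: ni; rewrite /increments -E C /= E.
have -> /= : gp < n by rewrite -E.
by rewrite -ltNge => /ltW.
Qed.

Lemma value_choice v : v < n -> N v -> value v (chain_count F v) = best v (above_count F v).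
Proof.
move=> vn Nv; rewrite /chain_count choice_fix // Nv /= /best_value.
case: (inc v (above_count F v)); first by rewrite addn1 mul1r mul0r addr0.
by rewrite mul0r mul1r add0r addn0.
Qed.

Lemma solve_optimal (X : nat -> nat) (F' : pred nat) :
  (forall v p, next v p -> X v = X p) ->
  (forall v j, v < n -> N v -> j <= X v -> Cap v j) ->
  (\sum_(v < n | N v) local v (minn (X v) (chain_count F' v)) <=
   \sum_(v < n | N v) local v (chain_count F v))%R.
Proof.
move=> HX HC; pose g v := minn (X v) (chain_count F' v); pose gp v := minn (X v) (above_count F' v).
have g_le v : v < n -> g v <= n.
  by move=> vn; have := chain_count_le FR F' vn; rewrite /g; lia.
have g_step v : v < n -> N v -> g v = gp v \/ g v = (gp v).+1 /\ Cap v (g v).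
  move=> vn Nv; rewrite /g /gp /chain_count.
  case: (F' v); last by left; rewrite addn0.
  case: (leqP (X v) (above_count F' v)) => le; first by left; lia.
  by right; split; [|apply: HC]; lia.
rewrite (local_revenue_telescope g_le (gp := gp)); last first.
  by move=> v p vp; rewrite /gp (above_count_next FR F' vp) (HX v p vp).
rewrite (local_revenue_telescope (chain_count_le FR F) (above_count_next FR F)).
apply: ler_sum => v Nv; have vn := ltn_ord v; rewrite value_choice //.
case: (is_rootP v) => [root|_] /=; rewrite ?mul0r ?mul1r ?subr0.
  have := value_le_best vn (g_le v vn) (g_step v vn Nv).
  by rewrite /gp !(above_count_root FR _ root) minn0.
by rewrite subrr subr_le0; exact: (value_le_best vn (g_le v vn) (g_step v vn Nv)).
Qed.

End Solve.

(** * The search *)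

Lemma sum_unique_le (R : numDomainType) (I : finType) (p q : pred I) (G : I -> R) (B : R) :
  (0 <= B)%R -> (forall c, p c -> q c -> G c <= B)%R ->
  (forall c c', p c -> p c' -> q c -> q c' -> c = c') ->
  (\sum_(c | p c) (q c)%:R * G c <= B)%R.
Proof.
move=> B0 H U; case: (boolP [exists c, p c && q c]) => [/existsP[c /andP[pc qc]]|no].
  rewrite (bigD1 c) //= qc mul1r big1 ?addr0 ?H // => c' /andP[pc' ne].
  case qc': (q c'); last by rewrite mul0r.
  by case/eqP: ne; exact: U.
rewrite big1 // => c pc; case qc: (q c); last by rewrite mul0r.
by case/negP: no; apply/existsP; exists c; rewrite pc.
Qed.

Lemma fill_btab_frame (R : realType) A N phi (d : tables R) B :
  B != A -> btab (fill_btab A N phi d) B = btab d B.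
Proof. by rewrite /= => /negPf ->. Qed.

Section Search.
Variables (R : realType) (f : nat -> R) (st : memory nat).
Hypothesis f_ge0 : forall j, (0 <= f j)%R.
Implicit Types (d : tables R) (L : level) (F : pred nat).
Local Notation n := (bound_val BSize st).
Local Notation revenue := (commodity_revenue f st).
Local Notation comp_revenue := (comp_revenue f st).
Local Notation total_revenue := (total_revenue f st).

Lemma commodity_revenue_ge0 F i : (0 <= revenue F i)%R.
Proof. exact: mulr_ge0. Qed.

Lemma eq_commodity_revenue F F' i :
  (forall v, v < n -> on_path st i v -> F v = F' v) -> revenue F i = revenue F' i.
Proof.
move=> E; have loadE : path_load st F i = path_load st F' i.
  by apply: eq_sumN => v vn; case iv: (on_path st i v) => //=; rewrite E.
by rewrite /commodity_revenue loadE.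
Qed.

Definition vertex_objective (obj : pred nat -> R) :=
  forall F F', (forall v, v < n -> F v = F' v) -> obj F = obj F'.

Lemma total_revenue_objective : vertex_objective total_revenue.
Proof.
by move=> F F' E; apply: eq_bigr => i _; apply: eq_commodity_revenue => v vn _; exact: E.
Qed.

Lemma comp_revenue_objective L c : vertex_objective (comp_revenue L c).
Proof.
move=> F F' E; apply: eq_bigr => i _; congr (_ * _)%R.
by apply: eq_commodity_revenue => v vn _; exact: E.
Qed.

Lemma keep_better_frame A obj d B :
  B != A -> B != flag_array -> btab (keep_better st A obj d) B = btab d B.
Proof. by move=> *; rewrite !fill_btab_frame. Qed.

Lemma keep_better_le A obj d : A != flag_array -> vertex_objective obj ->
  (obj (btab d A) <= obj (btab (keep_better st A obj d) A))%R /\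
  (obj (btab d candidate_array) <= obj (btab (keep_better st A obj d) A))%R.
Proof.
move=> Af E; set d' := keep_better st A obj d.
have keptE v : v < n -> btab d' A v = if (obj (btab d A) <= obj (btab d candidate_array))%R
    then btab d candidate_array v else btab d A v.
  by move=> vn; rewrite /d' /keep_better /= eqxx vn (negPf Af).
case: (lerP (obj (btab d A)) (obj (btab d candidate_array))) => [le|lt].
  have -> // : obj (btab d' A) = obj (btab d candidate_array).
  by apply: E => v vn; rewrite keptE // le.
have -> : obj (btab d' A) = obj (btab d A) by apply: E => v vn; rewrite keptE // leNgt lt.
by split=> //; exact: ltW.
Qed.

Section Level.
Variable L : level.

Definition code_reached c g (y : R) : Prop :=
  (forall up, exists d,
     comp_revenue L c (btab (solve_segs f st up L c g d) candidate_array) <= y)%R /\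
  (comp_revenue L c (lowest L (seg_budget L c g) c) <= y)%R.

Definition level_reached (y : R) : Prop :=
  (exists d, total_revenue (btab (solve_sides f st L d) candidate_array) <= y)%R /\
  exists2 Y : nat -> R, (\sum_(c < n | comp_top L c) Y c <= y)%R
    & forall c g, c < n -> g < 64 * (n * n) -> code_reached c g (Y c).

Lemma code_reached_le c g y y' : code_reached c g y -> (y <= y')%R -> code_reached c g y'.
Proof.
case=> dp low le; split; last exact: le_trans low le.
by move=> up; have [d ledp] := dp up; exists d; exact: le_trans ledp le.
Qed.

Lemma level_reached_le y y' : level_reached y -> (y <= y')%R -> level_reached y'.
Proof.
case=> [[d sides] [Y sumY codes]] le; split; first by exists d; exact: le_trans sides le.
by exists Y => //; exact: le_trans sumY le.
Qed.

Lemma try_code_frame c g d B :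
  comp_best_array < B -> B != flag_array -> btab (try_code f st L c g d) B = btab d B.
Proof.
move=> lt Bf; have [Bc Bd] : B != comp_best_array /\ B != candidate_array by lia.
by rewrite keep_better_frame // fill_btab_frame // keep_better_frame // solve_frame //
  keep_better_frame // solve_frame.
Qed.

Lemma try_code_spec c g d (y := comp_revenue L c (btab (try_code f st L c g d) comp_best_array)) :
  (comp_revenue L c (btab d comp_best_array) <= y)%R /\ code_reached c g y.
Proof.
rewrite /y /try_code; set d1 := solve_segs f st true L c g d; set d2 := keep_comp f st L c d1.
set d3 := solve_segs f st false L c g d2; set d4 := keep_comp f st L c d3.
set d5 := fill_btab candidate_array _ _ d4; set d6 := keep_comp f st L c d5.
have keep d' := @keep_better_le comp_best_array _ d' isT (@comp_revenue_objective L c).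
have [old1 new1] := keep d1; have [old3 new3] := keep d3; have [old5 new5] := keep d5.
rewrite [btab d1 _]solve_frame // in old1; rewrite [btab d3 _]solve_frame // in old3.
have le46 : (comp_revenue L c (btab d4 comp_best_array) <=
             comp_revenue L c (btab d6 comp_best_array))%R by [].
have le26 := le_trans old3 le46; split; first exact: le_trans old1 le26.
split=> [[]|]; first by exists d; exact: le_trans new1 le26.
  by exists d2; exact: le_trans new3 le46.
apply: le_trans new5.
by rewrite (@comp_revenue_objective L c _ (btab d5 candidate_array)) // => v vn; rewrite /d5 /= vn.
Qed.

Lemma try_codes_spec c g d : g < 64 * (n * n) ->
  code_reached c g (comp_revenue L c (btab (try_codes f st L c d) comp_best_array)).
Proof.
move=> gN; pose Q (d' : tables R) := code_reached c g (comp_revenue L c (btab d' comp_best_array)).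
refine (iterate_reach (Q := Q) _ (x0 := g) gN _ _) => [d'|g' d'].
  by case: (try_code_spec c g d').
by move=> /code_reached_le; apply; case: (try_code_spec c g' d').
Qed.

Lemma try_comp_best c d : btab (try_comp f st L c d) best_array = btab d best_array.
Proof.
apply: (iterate_ind (Q := fun d' => btab d' best_array = btab d best_array)) => // g d' _ <-.
exact: try_code_frame.
Qed.

Lemma try_comp_union c d v : v < n -> btab (try_comp f st L c d) union_array v =
  if comp_top L c && conn L c v then btab (try_codes f st L c d) comp_best_array v
  else btab d union_array v.
Proof.
move=> vn; rewrite /try_comp /= vn; case: ifP => // _.
suff -> : btab (try_codes f st L c d) union_array = btab d union_array by [].
apply: (iterate_ind (Q := fun d' => btab d' union_array = btab d union_array)) => // g d' _ <-.
exact: try_code_frame.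
Qed.

Hypothesis comp_top_unique : forall c c' v,
  comp_top L c -> comp_top L c' -> conn L c v -> conn L c' v -> c = c'.

Lemma union_on_comp d N c v : c < N -> v < n -> comp_top L c -> conn L c v ->
  btab (iterate N (fun c => try_comp f st L c) d) union_array v =
  btab (try_codes f st L c (iterate c (fun c => try_comp f st L c) d)) comp_best_array v.
Proof.
move=> cN vn top_c cv; elim: N cN => // N IH; rewrite ltnS leq_eqVlt iterateS try_comp_union //.
case/predU1P=> [<-|cN]; first by rewrite top_c cv.
case: ifP => [/andP[top_N Nv]|_]; last exact: IH.
by move: cN; rewrite (comp_top_unique top_c top_N cv Nv) ltnn.
Qed.

Lemma in_comp_unique c c' i : comp_top L c -> comp_top L c' ->
  in_comp st L c i -> in_comp st L c' i -> c = c'.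
Proof.
move=> top_c top_c' /andP[/allNP sub_c /hasNP[v vn iv]] /andP[/allNP sub_c' _].
by apply: (comp_top_unique (v := v)) => //; [have := sub_c v vn|have := sub_c' v vn]; rewrite iv.
Qed.

Lemma sum_comp_revenue_le F (G : nat -> pred nat) :
  (forall c v, c < n -> v < n -> comp_top L c -> conn L c v -> F v = G c v) ->
  (\sum_(c < n | comp_top L c) comp_revenue L c (G c) <= total_revenue F)%R.
Proof.
move=> FG; rewrite exchange_big /=; apply: ler_sum => i _.
apply: sum_unique_le => [|c top_c ic|c c' top_c top_c' ic ic'].
- exact: commodity_revenue_ge0.
- rewrite (eq_commodity_revenue (F' := F)) // => v vn iv; apply/esym/FG => //.
  by case/andP: ic => /allNP/(_ v vn); rewrite iv.
exact/val_inj/(in_comp_unique top_c top_c' ic ic').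
Qed.

Lemma try_level_spec d (y := total_revenue (btab (try_level f st L d) best_array)) :
  (total_revenue (btab d best_array) <= y)%R /\ level_reached y.
Proof.
rewrite /y /try_level; set d1 := solve_sides f st L d; set d2 := keep_better st _ _ d1.
set d3 := fill_btab union_array _ _ d2; set d4 := iterate n _ d3.
set d5 := fill_btab candidate_array _ _ d4.
have keep d' := @keep_better_le best_array _ d' isT total_revenue_objective.
have [old1 new1] := keep d1; have [old5 new5] := keep d5.
rewrite [btab d1 _]solve_frame // in old1.
have best52 : btab d5 best_array = btab d2 best_array.
  apply: (iterate_ind (Q := fun d' => btab d' best_array = btab d2 best_array)) => // c d' _ <-.
  exact: try_comp_best.
rewrite best52 in old5; split; first exact: le_trans old1 old5.
split; first by exists d; exact: le_trans new1 old5.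
pose G c := btab (try_codes f st L c (iterate c (fun c => try_comp f st L c) d3)) comp_best_array.
exists (fun c => comp_revenue L c (G c)) => [|c g cn gN]; last exact: try_codes_spec.
apply: le_trans new5; apply: sum_comp_revenue_le => c v cn vn top_c cv.
by rewrite /d5 /= vn; exact: union_on_comp.
Qed.

End Level.

Lemma best_search_spec d b l : b < n + 8 -> l < n ->
  (forall b l c c' v (L := level_of st b l),
     comp_top L c -> comp_top L c' -> conn L c v -> conn L c' v -> c = c') ->
  level_reached (level_of st b l) (total_revenue (btab (best_search f st d) best_array)).
Proof.
move=> bn ln uniq; pose Q (d' : tables R) :=
  level_reached (level_of st b l) (total_revenue (btab d' best_array)).
have monotone b' l' d' : Q d' -> Q (try_level f st (level_of st b' l') d').
  by move=> /level_reached_le; apply; case: (try_level_spec (@uniq b' l') d').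
refine (iterate_reach (Q := Q) _ (x0 := b) bn _ _) => [d1|b' d1 Qd].
  refine (iterate_reach (Q := Q) _ (x0 := l) ln _ _) => [d2|l' d2]; last exact: monotone.
  by case: (try_level_spec (@uniq b l) d2).
by apply: (iterate_ind (Q := Q)) => // l' d2 _; exact: monotone.
Qed.

Lemma write_outputE d v w : v < n -> w < n ->
  btab (write_output st d) output_array (v * n + w) = parent_of st v w && btab d best_array v.
Proof.
move=> vn wn; rewrite /write_output /=.
by rewrite (ltn_index vn wn : _ < bound_val (BMul BSize BSize) st) divn_index // modn_index.
Qed.

End Search.

(** * Earnings of the candidates *)

Section Subadditive.
Variables (R : numDomainType) (f : nat -> R).
Hypothesis f_mono : forall i j, i <= j -> (f i <= f j)%R.
Hypothesis f_sub : forall i j, (f (i + j) <= f i + f j)%R.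

Lemma subadditive_double m p : p <= 2 * m -> (f p <= 2 * f m)%R.
Proof.
move=> le; apply: le_trans (f_mono le) _; rewrite mul2n -addnn.
by apply: le_trans (f_sub _ _) _; rewrite mulr_natl mulr2n.
Qed.

Definition gain j : R := ((0 < j)%:R * f j)%R.

Lemma subadditive_gain m j : (f (m + j) <= f m + gain j)%R.
Proof. by rewrite /gain; case: j => [|j]; rewrite ?addn0 ?mul0r ?addr0 // mul1r. Qed.

Lemma subadditive_gain_sum m (s : seq nat) (g : nat -> nat) :
  (f (m + \sum_(z <- s) g z) <= f m + \sum_(z <- s) gain (g z))%R.
Proof.
elim: s => [|z s IH]; first by rewrite !big_nil addn0 addr0.
rewrite !big_cons addnCA addnC; apply: le_trans (subadditive_gain _ _) _.
by rewrite [X in (_ <= X)%R]addrCA [X in (_ <= X)%R]addrC lerD2r.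
Qed.

End Subadditive.

Lemma ler_sum_term (R : numDomainType) (I : finType) (p : pred I) (G : I -> R) i :
  (forall j, 0 <= G j)%R -> p i -> (G i <= \sum_(j | p j) G j)%R.
Proof. by move=> G_ge0 pi; rewrite (bigD1 i) //= lerDl sumr_ge0. Qed.

Section ServedRevenue.
Variables (R : realType) (f : nat -> R) (st : memory nat).
Hypothesis f_ge0 : forall j, (0 <= f j)%R.
Local Notation n := (bound_val BSize st).
Local Notation k := (bound_val BCount st).
Variables (N : pred nat) (served : nat -> nat -> pred nat) (h : nat -> nat).

Definition served_revenue i : R :=
  (\sum_(v < n | N v) (served i v (h v) * st weight_array i)%:R * f (h v))%R.

Lemma sum_served_revenue :
  (\sum_(i < k) served_revenue i = \sum_(v < n | N v) local_revenue f st served v (h v))%R.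
Proof. exact: exchange_big. Qed.

Lemma served_revenue_ge0 i : (0 <= served_revenue i)%R.
Proof. by apply: sumr_ge0 => v _; exact: mulr_ge0. Qed.

Lemma served_revenue_ge i v : v < n -> N v -> served i v (h v) ->
  ((st weight_array i)%:R * f (h v) <= served_revenue i)%R.
Proof.
move=> vn Nv sv.
apply: le_trans (ler_sum_term (p := fun v : 'I_n => N v) (i := Ordinal vn) _ Nv) => [|w].
  by rewrite /= sv mul1n.
exact: mulr_ge0.
Qed.

Lemma served_revenue_le i (B : R) : (0 <= B)%R ->
  (forall v, v < n -> N v -> served i v (h v) ->
    ((st weight_array i)%:R * f (h v) <= B)%R) ->
  (forall v v', served i v (h v) -> served i v' (h v') -> v = v') ->
  (served_revenue i <= B)%R.
Proof.
move=> B_ge0 le uniq; rewrite /served_revenue.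
under eq_bigr => v _ do rewrite natrM -mulrA.
apply: sum_unique_le => [//|v Nv sv|v v' _ _ sv sv']; first exact: le.
exact/val_inj/uniq.
Qed.

End ServedRevenue.

(* What the three kinds of candidates earn on a path when the coins isolate one of its
   pieces: [side] bounds the earnings on the path outside the skeleton, [seg] those on the
   segments that are met partially, and [mid] those on the segments that are covered. *)
Section PathBounds.
Variables (R : realType) (f : nat -> R) (L : level) (coin F : pred nat) (w : R).

Definition side_bound a s t (side : R) : Prop := forall y,
  hanging_root L s y -> coin y -> (forall y', hanging_root L t y' -> ~~ coin y') ->
  (w * f (side_count L a F s) <= side)%R.

Definition rounded_full_count a s t :=
  sumN (tree_size L) (fun z => full_seg L a s t z * rounded_count L coin F z).

Record path_bounds a s t (side seg mid : R) : Prop := PathBounds {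
  path_bounds_l : side_bound a s t side;
  path_bounds_r : side_bound a t s side;
  path_bounds_seg : forall z, partial_seg L a s t z -> 0 < piece_count L a s t F z ->
    coin z -> (forall z', z' != z -> partial_seg L a s t z' -> ~~ coin z') ->
    (w * f (piece_count L a s t F z) <= 2 * seg)%R;
  path_bounds_mid : (forall z, partial_seg L a s t z -> ~~ coin z) ->
    (w * f (rounded_full_count a s t) <= mid)%R
}.

End PathBounds.

Section Earnings.
Variables (R : realType) (f : nat -> R).
Hypothesis f_ge0 : forall j, (0 <= f j)%R.
Hypothesis f_mono : forall i j, i <= j -> (f i <= f j)%R.
Hypothesis f_sub : forall i j, (f (i + j) <= f i + f j)%R.
Variables (st : memory nat) (is_free is_mark F : pred nat).
Local Notation n := (bound_val BSize st).
Local Notation k := (bound_val BCount st).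
Local Notation L := (Level (tree_of st) is_free is_mark).
Local Notation weight i := ((st weight_array i)%:R : R)%R.
Local Notation limit := (st limit_array).
Local Notation revenue := (commodity_revenue f st).

Definition code_of c := find (fun g => allN n (fun z => conn L c z && seg_end L z ==>
  (seg_budget L c g z == rounded_count L (coin st) F z))) (iota 0 (64 * (n * n))).

Definition side_earning := served_revenue f st (side_vertex L (coin st))
  (fun i => side_served L (coin st) (on_path st i) (limit i))
  (chain_count n (side_above L (coin st)) F).

Definition direction_earning c up := served_revenue f st
  (seg_vertex L (seg_budget L c (code_of c)) c)
  (fun i => seg_served L (seg_budget L c (code_of c)) c up (on_path st i) (limit i))
  (fun v => minn (capacity L (seg_budget L c (code_of c)) v)
    (chain_count n (seg_ahead L (seg_budget L c (code_of c)) c up) F v)).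

Definition seg_earning i : R :=
  (\sum_(c < n | comp_top L c) (direction_earning c true i + direction_earning c false i))%R.

Definition mid_earning i : R := (\sum_(c < n | comp_top L c)
  (in_comp st L c i)%:R * revenue (lowest L (seg_budget L c (code_of c)) c) i)%R.

Lemma side_earning_ge0 i : (0 <= side_earning i)%R.
Proof. exact: served_revenue_ge0. Qed.

Lemma direction_earning_ge0 c up i : (0 <= direction_earning c up i)%R.
Proof. exact: served_revenue_ge0. Qed.

Lemma seg_earning_ge0 i : (0 <= seg_earning i)%R.
Proof. by apply: sumr_ge0 => c _; apply: addr_ge0; exact: direction_earning_ge0. Qed.

Lemma mid_earning_ge0 i : (0 <= mid_earning i)%R.
Proof. by apply: sumr_ge0 => c _; apply: mulr_ge0; last exact: commodity_revenue_ge0. Qed.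

Variables par dep : nat -> nat.
Hypothesis rL : rooted L par dep.

Lemma solve_sides_ge d : (\sum_(i < k) side_earning i <=
  total_revenue f st (btab (solve_sides f st L d) candidate_array))%R.
Proof.
set served := fun i => side_served L (coin st) (on_path st i) (limit i).
have FR := side_forest rL (coin st); set F' := btab _ candidate_array.
have := solve_optimal (Cap := fun _ _ => true) f served FR d (X := fun=> n.+1) F
  (fun _ _ _ => erefl) (fun _ _ _ _ _ => isT).
under eq_bigr => v _ do rewrite (minn_idPr _) ?(leqW (chain_count_le FR F (ltn_ord v))) //.
rewrite -!sum_served_revenue => /le_trans; apply; apply: ler_sum => i _.
apply: served_revenue_le => [|v vn Nv sv|v v']; first exact: commodity_revenue_ge0.
  have loadE : path_load st F' i = chain_count n (side_above L (coin st)) F' v.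
    by apply: (side_served_count rL sv) => w wn; exact: (solve_in_forest FR).
  by rewrite /commodity_revenue loadE; case/and3P: sv => _ _ ->; rewrite mul1n.
exact: (side_served_uniq rL).
Qed.

Lemma solve_segs_ge c up d : (\sum_(i < k) direction_earning c up i <=
  comp_revenue f st L c (btab (solve_segs f st up L c (code_of c) d) candidate_array))%R.
Proof.
set x := seg_budget L c (code_of c).
set served := fun i => seg_served L x c up (on_path st i) (limit i).
have FR := seg_forest rL x c up; set F' := btab _ candidate_array.
have capacity_next v p : seg_next L x c up v p -> capacity L x v = capacity L x p.
  by case/and4P=> _ _ /(same_segP rL)[z vz pz] _; rewrite !(capacityE rL _ (z := z)).
have := solve_optimal (Cap := seg_capacity L x) f served FR d F capacity_next
  (fun v j _ => @seg_capacity_leq _ _ _ rL x c v j).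
rewrite /direction_earning sum_served_revenue => /le_trans; apply.
rewrite -sum_served_revenue; apply: ler_sum => i _.
have in_forest w : w < n -> F' w -> seg_vertex L x c w by move=> wn; exact: (solve_in_forest FR).
have in_capacity w : w < n -> F' w -> seg_capacity L x w (chain_count n (seg_ahead L x c up) F' w).
  by move=> wn; exact: (solve_capacity FR).
apply: served_revenue_le =>
  [|v vn Nv /and3P[/allNP sub fits le]|v v' /and3P[_ sv _] /and3P[_ sv' _]].
- by apply: mulr_ge0 => //; exact: commodity_revenue_ge0.
- have /andP[count_le load_le] := seg_fits_count rL in_forest in_capacity fits.
  have -> : in_comp st L c i.
    apply/andP; split; first exact/allNP.
    by apply/hasNP; exists v; rewrite ?(seg_fits_on_path rL fits).
  by rewrite mul1r /commodity_revenue (leq_trans load_le le) mul1n ler_wpM2l ?f_mono.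
exact: (seg_fits_uniq rL sv sv').
Qed.

Section LevelReached.
Variable y : R.
Hypothesis reached : level_reached f st L y.
Hypothesis code_lt : forall c, c < n -> code_of c < 64 * (n * n).

Lemma sum_side_earning : (\sum_(i < k) side_earning i <= y)%R.
Proof. by case: reached => [[d le] _]; apply: le_trans le; exact: solve_sides_ge. Qed.

Lemma sum_seg_earning : (\sum_(i < k) seg_earning i <= 2 * y)%R.
Proof.
case: reached => _ [Y sumY codes]; rewrite exchange_big /=.
apply: (@le_trans _ _ (2 * \sum_(c < n | comp_top L c) Y c)%R); last by rewrite ler_pM2l.
rewrite mulr_sumr; apply: ler_sum => c _; rewrite big_split /= mulr_natl mulr2n.
have [dp _] := codes c _ (ltn_ord c) (code_lt (ltn_ord c)).
by apply: lerD; [have [d le] := dp true|have [d le] := dp false];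
  apply: le_trans le; exact: solve_segs_ge.
Qed.

Lemma sum_mid_earning : (\sum_(i < k) mid_earning i <= y)%R.
Proof.
case: reached => _ [Y sumY codes]; rewrite exchange_big /=; apply: le_trans sumY.
apply: ler_sum => c _.
by have [_] := codes c _ (ltn_ord c) (code_lt (ltn_ord c)).
Qed.

End LevelReached.

Section OnePath.
Variables i a s t : nat.
Hypothesis P : level_path L a s t.
Hypothesis on_pathE : forall v, v < n -> on_path st i v = tree_path L a s t v.
Hypothesis load_le : path_load st F i <= limit i.

Lemma path_loadE : path_load st F i = path_count L a s t F.
Proof. by apply: eq_sumN => v vn; rewrite on_pathE. Qed.

Lemma side_earning_bound : side_bound f L (coin st) F (weight i) a s t (side_earning i).
Proof.
move=> y root_s coin_y coin_t; rewrite -(side_count_chain rL P coin_t root_s coin_y).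
apply: served_revenue_ge => //; first exact: (level_path_ltl rL P).
  exact: (side_vertex_end rL P root_s coin_y).
by apply: (side_served_path rL P coin_t root_s coin_y on_pathE); rewrite -path_loadE.
Qed.

Variable c : nat.
Hypothesis ca : conn L c a.
Hypothesis codeE : forall z, conn L c z -> seg_end L z ->
  seg_budget L c (code_of c) z = rounded_count L (coin st) F z.
Local Notation x := (seg_budget L c (code_of c)).

Lemma budget_le z : conn L c z -> seg_end L z -> x z <= seg_count L F z.
Proof. by move=> cz mz; rewrite codeE //; exact: rounded_count_le. Qed.

Lemma partial_seg_in_comp z : partial_seg L a s t z -> conn L c z /\ seg_end L z.
Proof.
move=> /(partial_segP rL)[[w h iw] _]; split; last exact: in_seg_end h.
exact: (conn_trans rL (tree_path_in_comp rL P ca iw) (in_seg_conn h)).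
Qed.

Lemma budget_coin0 z : partial_seg L a s t z -> ~~ coin st z -> x z = 0.
Proof.
by case/partial_seg_in_comp=> cz mz nz; rewrite codeE // /rounded_count (negPf nz).
Qed.

Lemma direction_earning_bound up z v (p := piece_count L a s t F z) :
  partial_seg L a s t z -> partial_end L a s t up z v -> 0 < p -> coin st z ->
  (forall z', z' != z -> partial_seg L a s t z' -> ~~ coin st z') ->
  (weight i * f p <= 2 * direction_earning c up i)%R.
Proof.
move=> pz v_end p_gt0 cz others; have [hv _ _] := v_end; have vn := in_seg_ltl rL hv.
have p_le : p <= seg_count L F z.
  by apply: leq_sumN => w _; case: (in_seg _ _) => //=; case: tree_path.
have [ccz mz] := partial_seg_in_comp pz.
have lt_double : seg_count L F z < 2 * x z.
  by rewrite codeE //; apply: seg_count_lt_double cz _; exact: leq_trans p_gt0 p_le.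
have x_gt0 : 0 < x z by lia.
have x_others z' (ne : z' != z) pz' := budget_coin0 pz' (others z' ne pz').
have Nv := partial_end_vertex rL P ca v_end x_gt0.
have le_limit : path_count L a s t F <= limit i by rewrite -path_loadE.
have served := partial_end_served rL P on_pathE ca budget_le v_end x_gt0 x_others pz le_limit.
apply: (@le_trans _ _ (2 * (weight i * f (minn (x z) p)))%R).
  by rewrite mulrCA ler_wpM2l //; apply: subadditive_double => //; lia.
rewrite ler_wpM2l //; have countE := partial_end_chain_count rL P F ca v_end x_gt0.
have capE := capacityE rL x hv; rewrite -/p in countE served; rewrite -{1}countE -capE.
by apply: served_revenue_ge => //; rewrite capE countE.
Qed.

Lemma lowest_revenue_bound : hasN n (fun v => on_path st i v) ->
  (forall z, partial_seg L a s t z -> ~~ coin st z) ->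
  (weight i * f (rounded_full_count L (coin st) F a s t) <=
   (in_comp st L c i)%:R * revenue (lowest L x c) i)%R.
Proof.
move=> nonempty coin0; have -> : in_comp st L c i.
  rewrite /in_comp nonempty andbT; apply/allNP => w wn; apply/implyP; rewrite on_pathE //.
  exact: (tree_path_in_comp rL P ca).
have loadE : path_load st (lowest L x c) i = rounded_full_count L (coin st) F a s t.
  have := lowest_count rL P on_pathE ca budget_le (fun z pz => budget_coin0 pz (coin0 z pz)).
  rewrite /path_load => ->; apply: eq_sumN => z zn.
  case: (boolP (full_seg L a s t z)) => // /and3P[mz _ iz].
  by rewrite codeE //; exact: (tree_path_in_comp rL P ca).
have le : path_load st (lowest L x c) i <= limit i.
  rewrite loadE; apply: leq_trans load_le; rewrite path_loadE.
  apply: leq_trans (full_count_le rL a s t F).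
  by apply: leq_sumN => z _; rewrite leq_mul // rounded_count_le.
by rewrite mul1r /commodity_revenue le mul1n loadE.
Qed.

End OnePath.

Variable b : nat.
Hypothesis few_marks : forall c, c < n -> sumN n (fun w => conn L c w * mark L w) < b.
Hypothesis codes_le : (log2N n + 2) ^ (2 * b) <= 64 * (n * n).

Lemma code_ofP c : c < n -> code_of c < 64 * (n * n) /\ forall z, conn L c z -> seg_end L z ->
  seg_budget L c (code_of c) z = rounded_count L (coin st) F z.
Proof.
move=> cn; have n_gt0 : 0 < n by exact: leq_ltn_trans cn.
have [z /(conn_ltr rL)//|g g_lt gE] := @seg_budget_ex L c (coin st) F n_gt0.
rewrite /code_of; set p := (X in find X _); set codes := iota 0 _.
have found : has p codes.
  apply/hasP; exists g; last by apply/allNP => z _; apply/implyP => /andP[cz mz]; exact/eqP/gE.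
  rewrite mem_iota; apply: leq_trans g_lt _; apply: leq_trans codes_le; rewrite leq_exp2l ?addn2 //.
  apply: leq_trans (leq_trans (leq_addr _ _) (seg_end_count rL cn)) _.
  by rewrite leq_mul2l (ltnW (few_marks cn)).
have lt : find p codes < 64 * (n * n) by have := found; rewrite has_find size_iota.
split=> // z cz mz; have /allNP := nth_find 0 found; rewrite nth_iota //.
by move/(_ z (conn_ltr rL cz)); rewrite cz mz => /eqP.
Qed.

Lemma earning_path_bounds i a s t : level_path L a s t ->
  (forall v, v < n -> on_path st i v = tree_path L a s t v) ->
  path_load st F i <= limit i -> hasN n (fun v => on_path st i v) ->
  path_bounds f L (coin st) F (weight i) a s t (side_earning i) (seg_earning i) (mid_earning i).
Proof.
move=> P on_pathE load_le nonempty.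
have ca := level_path_connl rL P; have an := conn_ltl rL ca.
have [c top_c cca] := comp_top_ex rL an (conn_free rL ca).1.
have cn := conn_ltl rL cca; have [_ codeE] := code_ofP cn; split.
- exact: side_earning_bound.
- apply: (side_earning_bound (level_pathC P)) => // v vn.
  by rewrite on_pathE // tree_pathC.
- move=> z pz p_gt0 cz others; have [_ [up [v v_end]]] := partial_seg_cases rL P pz.
  have earn_le := direction_earning_bound P on_pathE load_le cca codeE pz v_end p_gt0 cz others.
  apply: le_trans earn_le _; rewrite ler_pM2l //.
  apply: le_trans (ler_sum_term (p := fun c : 'I_n => comp_top L c) (i := Ordinal cn) _ top_c).
    by case: up {v_end}; rewrite ?lerDl ?lerDr direction_earning_ge0.
  by move=> c'; apply: addr_ge0; exact: direction_earning_ge0.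
move=> coin0; apply: le_trans (lowest_revenue_bound P on_pathE load_le cca codeE nonempty coin0) _.
apply: (ler_sum_term (p := fun c : 'I_n => comp_top L c) (i := Ordinal cn) _ top_c) => c'.
by apply: mulr_ge0; last exact: commodity_revenue_ge0.
Qed.

End Earnings.

(** * Averaging over the coins *)

Section Coins.
Variables (R : realDomainType) (T : nat).
Local Notation tape := (T.-tuple bool).
Local Notation coin r z := (nth false (r : seq bool) z).

Definition xor_coins (h : pred nat) (r : tape) : tape := [tuple coin r i (+) h i | i < T].
Arguments xor_coins : simpl never.

Lemma nth_xor_coins h r z : z < T -> coin (xor_coins h r) z = coin r z (+) h z.
Proof. by move=> zT; rewrite (nth_mktuple _ _ (Ordinal zT)). Qed.

Lemma xor_coinsK h : involutive (xor_coins h).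
Proof.
move=> r; apply: eq_from_tnth => i; rewrite !(tnth_nth false) !nth_xor_coins //.
by rewrite -addbA addbb addbF.
Qed.

Lemma sum_tape_const (x : R) : (\sum_(r : tape) x = 2 ^+ T * x)%R.
Proof. by rewrite sumr_const card_tuple card_bool -natrX mulr_natl. Qed.

Lemma sum_half z (x : bool) (G : tape -> R) : z < T ->
  (forall r, G (xor_coins (pred1 z) r) = G r) ->
  (\sum_r G r = 2 * \sum_(r : tape) (coin r z == x)%:R * G r)%R.
Proof.
move=> zT inv.
have flipE : (\sum_(r : tape) (coin r z == x)%:R * G r =
              \sum_(r : tape) (coin r z != x)%:R * G r)%R.
  rewrite (reindex_inj (inv_inj (xor_coinsK (pred1 z)))); apply: eq_bigr => r _.
  by rewrite inv nth_xor_coins //= eqxx; case: (coin r z); case: x.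
rewrite mulr_natl mulr2n {2}flipE -big_split /=; apply: eq_bigr => r _; rewrite -mulrDl.
by case: eqP; rewrite ?addr0 ?add0r mul1r.
Qed.

Lemma sum_pattern (s : seq nat) (x : pred nat) (G : tape -> R) :
  uniq s -> {in s, forall z, z < T} ->
  (forall r z, z \in s -> G (xor_coins (pred1 z) r) = G r) ->
  (\sum_r G r = 2 ^+ size s * \sum_(r : tape) (all (fun z => coin r z == x z) s)%:R * G r)%R.
Proof.
elim: s => [|z s IH] /=.
  by move=> _ _ _; rewrite expr0 mul1r; under [in RHS]eq_bigr do rewrite mul1r.
case/andP=> zs us sT inv; rewrite IH //; first last.
- by move=> r y ys; rewrite inv // inE ys orbT.
- by move=> y ys; rewrite sT // inE ys orbT.
rewrite (@sum_half z (x z)); first last.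
- move=> r; rewrite inv ?mem_head //; congr ((nat_of_bool _)%:R * _)%R.
  apply: eq_in_all => y ys; rewrite nth_xor_coins ?sT ?inE ?ys ?orbT //=.
  by case: (eqVneq y z) => [yz|_]; rewrite ?addbF //; rewrite -yz ys in zs.
- by rewrite sT ?mem_head.
rewrite mulrA -exprSr; congr (_ * _)%R; apply: eq_bigr => r _.
by rewrite mulrA -natrM mulnb.
Qed.

Lemma sum_pattern_le (s : seq nat) (x : pred nat) (G h : tape -> R) m :
  uniq s -> {in s, forall z, z < T} -> size s <= m ->
  (forall r z, z \in s -> G (xor_coins (pred1 z) r) = G r) -> (forall r, 0 <= h r)%R ->
  (forall r : tape, all (fun z => coin r z == x z) s -> (G r <= h r)%R) ->
  (\sum_r G r <= 2 ^+ m * \sum_r h r)%R.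
Proof.
move=> us sT sm inv h_ge0 le; rewrite (sum_pattern x us sT inv).
apply: (@le_trans _ _ (2 ^+ size s * \sum_r h r)%R).
  rewrite ler_wpM2l ?exprn_ge0 //; apply: ler_sum => r _.
  by case: (boolP (all _ _)) => [/le|_]; rewrite ?mul1r ?mul0r.
by rewrite ler_wpM2r ?sumr_ge0 // -!natrX ler_nat leq_exp2l.
Qed.

Lemma sum_complement_ge (f : nat -> R) (S : tape -> nat) m :
  (forall i j, i <= j -> (f i <= f j)%R) -> (forall i j, (f (i + j)%N <= f i + f j)%R) ->
  (forall r, m <= S r + S (xor_coins xpredT r)) ->
  (2 ^+ T * f m <= 2 * \sum_r f (S r))%R.
Proof.
move=> f_mono f_sub H; rewrite [X in (_ <= X)%R](mulr_natl _ 2) [X in (_ <= X)%R]mulr2n.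
rewrite [X in (_ <= X + _)%R](reindex_inj (inv_inj (xor_coinsK xpredT))) -big_split /=.
rewrite -sum_tape_const; apply: ler_sum => r _; rewrite addrC.
by apply: le_trans (f_sub _ _); exact: f_mono.
Qed.

End Coins.

Section HangingRoots.
Variables (L : level) (par dep : nat -> nat).
Hypothesis rL : rooted L par dep.
Local Notation hanging_root := (hanging_root L).

Lemma side_count_gt0 a s t F : level_path L a s t -> 0 < side_count L a F s -> ~~ skeleton L s.
Proof.
move=> P; rewrite sumN_gt0 => /hasNP[v _]; rewrite lt0b => /and4P[av vs nv _].
apply: contra nv; apply: (skeleton_up rL).
by have [] := conn_split rL (level_path_connl rL P) av vs.
Qed.

Lemma hanging_root_neq a s t y y' : level_path L a s t ->
  hanging_root s y -> hanging_root t y' -> y != y'.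
Proof.
move=> P /(hanging_rootP rL)[ys ny _] /(hanging_rootP rL)[y't _ _]; apply: contraL y't => /eqP <-.
apply: contra ny => yt; have ya := level_path_lca P (conn_anc ys) (conn_anc yt).
have [cya _] := conn_split rL ys ya (level_path_l P).
exact: (skeleton_up rL cya (level_path_skeleton rL P)).
Qed.

End HangingRoots.

Section PathAverage.
Variables (R : realType) (f : nat -> R).
Hypothesis f_mono : forall i j, i <= j -> (f i <= f j)%R.
Hypothesis f_sub : forall i j, (f (i + j)%N <= f i + f j)%R.
Variables (L : level) (par dep : nat -> nat).
Hypothesis rL : rooted L par dep.
Local Notation n := (tree_size L).
Variables (T : nat) (nT : n <= T) (w : R) (F : pred nat).
Hypothesis w_ge0 : (0 <= w)%R.
Local Notation coin r := (nth false (tval r)).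

Lemma side_average a s t (side : T.-tuple bool -> R) : level_path L a s t ->
  (forall r, 0 <= side r)%R -> (forall r, side_bound f L (coin r) F w a s t (side r)) ->
  (2 ^+ T * (w * gain f (side_count L a F s)) <= 2 ^+ 2 * \sum_r side r)%R.
Proof.
move=> P side_ge0 bounds; rewrite /gain.
case: (boolP (0 < side_count L a F s)) => [side_gt0|_]; last first.
  by rewrite mul0r !mulr0 mulr_ge0 ?sumr_ge0.
have ns := side_count_gt0 rL P side_gt0.
have [y root_s] := hanging_root_ex rL (level_path_connl rL P) (level_path_skeleton rL P) ns.
have root_lt x z (h : hanging_root L x z) := leq_trans (hanging_root_lt rL h) nT.
rewrite mul1r -sum_tape_const.
have [/hasNP[y' _ root_t]|no] := boolP (hasN n (hanging_root L t)).
  have ne := hanging_root_neq rL P root_s root_t.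
  apply: (@sum_pattern_le _ _ [:: y; y'] (pred1 y)) => //=.
  - by rewrite inE ne.
  - by move=> z; rewrite !inE => /orP[]/eqP->; [exact: root_lt root_s|exact: root_lt root_t].
  move=> r /and3P[/eqP cy /eqP cy' _]; apply: (bounds r y root_s); first by rewrite cy eqxx.
  by move=> y2 /(hanging_root_uniq rL root_t) <-; rewrite cy' eq_sym.
apply: (@sum_pattern_le _ _ [:: y] (pred1 y)) => //=.
  by move=> z; rewrite inE => /eqP ->; exact: root_lt root_s.
move=> r /andP[/eqP cy _]; apply: (bounds r y root_s); first by rewrite cy eqxx.
by move=> y2 root_t; case/negP: no; apply/hasNP; exists y2; rewrite ?(hanging_root_lt rL root_t).
Qed.

Variables (a s t : nat) (side seg mid : T.-tuple bool -> R).
Hypothesis P : level_path L a s t.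
Hypotheses (side_ge0 : forall r, (0 <= side r)%R) (seg_ge0 : forall r, (0 <= seg r)%R)
  (mid_ge0 : forall r, (0 <= mid r)%R).
Hypothesis bounds : forall r, path_bounds f L (coin r) F w a s t (side r) (seg r) (mid r).
Local Notation partial_seg := (partial_seg L a s t).
Local Notation piece_count := (piece_count L a s t F).
Local Notation full_count := (full_count L a s t F).
Local Notation rounded_full_count coin := (rounded_full_count L coin F a s t).

Definition partial_segs := [seq z <- iota 0 n | partial_seg z].

Lemma mem_partial_segs z : (z \in partial_segs) = partial_seg z.
Proof.
by rewrite mem_filter mem_iota add0n leq0n andTb; apply: andb_idr; exact: (partial_seg_lt rL).
Qed.

Lemma sum_partial_segs_le (x : pred nat) (G h : T.-tuple bool -> R) :
  (forall r z, partial_seg z -> G (xor_coins (pred1 z) r) = G r) -> (forall r, 0 <= h r)%R ->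
  (forall r, (forall z, partial_seg z -> coin r z = x z) -> (G r <= h r)%R) ->
  (\sum_r G r <= 2 ^+ 3 * \sum_r h r)%R.
Proof.
move=> inv h_ge0 H; apply: (@sum_pattern_le _ _ partial_segs x) => //.
- by rewrite filter_uniq ?iota_uniq.
- by move=> z; rewrite mem_partial_segs => /(partial_seg_lt rL) zn; exact: leq_trans nT.
- by rewrite -sumN_size; exact: (partial_seg_count rL P).
- by move=> r z; rewrite mem_partial_segs; exact: inv.
by move=> r /allP pattern; apply: H => z pz; apply/eqP/pattern; rewrite mem_partial_segs.
Qed.

Lemma piece_average z : partial_seg z ->
  (2 ^+ T * (w * gain f (piece_count z)) <= 16 * \sum_r seg r)%R.
Proof.
move=> pz; rewrite /gain; case: (boolP (0 < piece_count z)) => [p_gt0|_]; last first.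
  by rewrite mul0r !mulr0 mulr_ge0 ?sumr_ge0.
rewrite mul1r -sum_tape_const (_ : 16 = 2 ^+ 3 * 2)%R; last by rewrite -natrX -natrM.
rewrite -mulrA mulr_sumr; apply: (sum_partial_segs_le (x := pred1 z)) => // [r|r pattern].
  exact: mulr_ge0.
apply: (path_bounds_seg (bounds r) pz p_gt0); first by rewrite pattern //= eqxx.
by move=> z' ne pz'; rewrite pattern.
Qed.

Lemma rounded_average :
  (\sum_(r : T.-tuple bool) w * f (rounded_full_count (coin r)) <= 2 ^+ 3 * \sum_r mid r)%R.
Proof.
apply: (sum_partial_segs_le (x := pred0)) => // [r z pz|r pattern]; last first.
  by apply: (path_bounds_mid (bounds r)) => z pz; rewrite pattern.
congr (_ * f _)%R; apply: eq_sumN => y yn; have [/and3P[_ ny _]|//] := boolP (full_seg L a s t y).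
congr (_ * _); rewrite /rounded_count nth_xor_coins ?(leq_trans yn nT) //=.
by case: (eqVneq y z) => [yz|_]; rewrite ?addbF //; rewrite yz pz in ny.
Qed.

Lemma rounded_complement : (2 ^+ T * f (rounded_full_count xpredT) <=
  2 * \sum_(r : T.-tuple bool) f (rounded_full_count (coin r)))%R.
Proof.
apply: sum_complement_ge => // r; rewrite -sumND; apply: leq_sumN => z zn.
rewrite -mulnDr leq_mul2l; apply/orP; right.
rewrite /rounded_count nth_xor_coins ?(leq_trans zn nT) // addbT.
by case: (nth false r z); rewrite /= ?addn0.
Qed.

Lemma full_count_le_double : full_count <= 2 * rounded_full_count xpredT.
Proof.
rewrite -sumN_mull; apply: leq_sumN => z zn; rewrite mulnCA leq_mul2l; apply/orP; right.
by case: (posnP (seg_count L F z)) => [->|/(@seg_count_lt_double L xpredT F z isT)/ltnW].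
Qed.

Lemma mid_average : (2 ^+ T * (w * f full_count) <= 32 * \sum_r mid r)%R.
Proof.
have le_rounded := rounded_average; rewrite -mulr_sumr in le_rounded.
apply: (@le_trans _ _ (2 ^+ T * (w * (2 * f (rounded_full_count xpredT))))%R).
  rewrite ler_pM2l ?exprn_gt0 // ler_wpM2l //.
  exact: subadditive_double full_count_le_double.
rewrite mulrCA; apply: (@le_trans _ _
    (w * (2 * (2 * \sum_(r : T.-tuple bool) f (rounded_full_count (coin r)))))%R).
  by rewrite ler_wpM2l // mulrCA ler_pM2l // rounded_complement.
lra.
Qed.

Lemma pieces_average :
  (2 ^+ T * (w * \sum_(z <- partial_segs) gain f (piece_count z)) <= 48 * \sum_r seg r)%R.
Proof.
have sum_seg_ge0 : (0 <= \sum_r seg r)%R by exact: sumr_ge0.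
rewrite [(w * _)%R]mulr_sumr [(2 ^+ T * _)%R]mulr_sumr big_seq_cond.
apply: (@le_trans _ _ (\sum_(z <- partial_segs | (z \in partial_segs) && true)
    16 * \sum_r seg r)%R).
  by apply: ler_sum => z /andP[zs _]; apply: piece_average; rewrite -mem_partial_segs.
rewrite -big_seq_cond big_const_seq iter_addr_0 count_predT -[X in (X <= _)%R]mulr_natl mulrA.
rewrite -natrM ler_wpM2r // ler_nat (leq_mul _ (leqnn 16) : _ <= 3 * 16) //.
by rewrite -sumN_size; exact: (partial_seg_count rL P).
Qed.

Lemma path_average : (2 ^+ T * (w * f (path_count L a s t F)) <=
  32 * \sum_r mid r + 48 * \sum_r seg r + 8 * \sum_r side r)%R.
Proof.
have split_path : (f (path_count L a s t F) <= f full_count + gain f (side_count L a F s) +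
    gain f (side_count L a F t) + \sum_(z <- partial_segs) gain f (piece_count z))%R.
  have := path_count_le rL a s t F.
  have -> : sumN n (fun z => partial_seg z * piece_count z) =
      \sum_(z <- partial_segs) piece_count z.
    rewrite big_filter big_mkcond /= -[n in iota 0 n]subn0 big_mkord.
    by apply: eq_bigr => i _; case: (partial_seg i); rewrite ?mul1n.
  rewrite !addnA => /f_mono/le_trans; apply.
  apply: le_trans (subadditive_gain_sum f_sub _ _ _) _; rewrite lerD2r.
  by apply: le_trans (subadditive_gain f_sub _ _) _; rewrite lerD2r subadditive_gain.
have le_s := side_average P side_ge0 (fun r => path_bounds_l (bounds r)).
have le_t := side_average (level_pathC P) side_ge0 (fun r => path_bounds_r (bounds r)).
have le_mid := mid_average; have le_seg := pieces_average.
have tw_ge0 : (0 <= 2 ^+ T * w)%R by rewrite mulr_ge0 ?exprn_ge0.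
rewrite mulrA; apply: le_trans (ler_wpM2l tw_ge0 split_path) _; rewrite !mulrDr -!mulrA.
rewrite (_ : 8 = 2 ^+ 2 + 2 ^+ 2)%R ?mulrDl; last by rewrite -natrX -natrD.
lra.
Qed.

End PathAverage.

Lemma last_true (Q : pred nat) m : Q 0 -> ~~ Q m.+1 -> exists2 l, l <= m & Q l && ~~ Q l.+1.
Proof.
elim: m => [|m IH] Q0 Qm; first by exists 0; rewrite ?Q0.
case: (boolP (Q m.+1)) => [q|/(IH Q0)[l lm Ql]]; first by exists m.+1; rewrite ?q.
by exists l => //; exact: leqW.
Qed.

Lemma path_bounds_coin (R : realType) (f : nat -> R) (L : level) par dep
    (coin coin' F : pred nat) w a s t side seg mid :
  rooted L par dep -> (forall v, v < tree_size L -> coin v = coin' v) ->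
  path_bounds f L coin F w a s t side seg mid -> path_bounds f L coin' F w a s t side seg mid.
Proof.
move=> rL coinE [bound_l bound_r bound_seg bound_mid].
have root_coin x y (h : hanging_root L x y) : coin y = coin' y := coinE y (hanging_root_lt rL h).
have seg_coin z (pz : partial_seg L a s t z) : coin z = coin' z := coinE z (partial_seg_lt rL pz).
split.
- move=> y root_s cy ct; apply: (bound_l y root_s); first by rewrite (root_coin _ _ root_s).
  by move=> y' root_t; rewrite (root_coin _ _ root_t) ct.
- move=> y root_t cy cs; apply: (bound_r y root_t); first by rewrite (root_coin _ _ root_t).
  by move=> y' root_s; rewrite (root_coin _ _ root_s) cs.
- move=> z pz p_gt0 cz others; apply: bound_seg => //; first by rewrite seg_coin.
  by move=> z' ne pz'; rewrite seg_coin ?others.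
move=> coin0; have -> : rounded_full_count L coin' F a s t = rounded_full_count L coin F a s t.
  by apply: eq_sumN => z zn; rewrite /rounded_count coinE.
by apply: bound_mid => z pz; rewrite seg_coin ?coin0.
Qed.

Record rooted_input (st : memory nat) (par dep top left right : nat -> nat) : Prop := RootedInput {
  rooted_input_tree : rooted (tree_of st) par dep;
  rooted_input_left : forall i, i < bound_val BCount st -> ancestor_of st (top i) (left i);
  rooted_input_right : forall i, i < bound_val BCount st -> ancestor_of st (top i) (right i);
  rooted_input_top : forall i v, i < bound_val BCount st ->
    ancestor_of st v (left i) -> ancestor_of st v (right i) -> ancestor_of st v (top i);
  rooted_input_path : forall i v, i < bound_val BCount st -> v < bound_val BSize st ->
    on_path st i v = tree_path (tree_of st) (top i) (left i) (right i) v
}.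

Definition with_coins (st : memory nat) (x : pred nat) : memory nat :=
  fun A j => if A == coin_array then x j : nat else st A j.

Section Average.
Variables (R : realType) (f : nat -> R).
Hypothesis f_ge0 : forall j, (0 <= f j)%R.
Hypothesis f_mono : forall i j, i <= j -> (f i <= f j)%R.
Hypothesis f_sub : forall i j, (f (i + j)%N <= f i + f j)%R.
Variables (st : memory nat) (par dep top left right : nat -> nat).
Hypothesis input : rooted_input st par dep top left right.
Variables (F : pred nat) (b : nat).
Local Notation n := (bound_val BSize st).
Local Notation k := (bound_val BCount st).
Hypotheses (n_gt0 : 0 < n) (b_gt1 : 1 < b) (b_lt : b < n + 8).
Hypothesis codes_le : (log2N n + 2) ^ (2 * b) <= 64 * (n * n).
Let rT := rooted_input_tree input.
Local Notation depth := (trunc_log b n).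
Local Notation level l := (level_of st b l).
Variables (T : nat) (nT : n <= T) (d : T.-tuple bool -> tables R).
Let flipped (r : T.-tuple bool) := with_coins st (fun j => (j < n) && nth false r j).
Let best r := btab (best_search f (flipped r) (d r)) best_array.
Let best_revenue r := total_revenue f (flipped r) (best r).

Lemma level_lt l : l <= depth -> l < n.
Proof. by move=> le; exact: leq_ltn_trans le (trunc_log_ltn_self b_gt1 n_gt0). Qed.

Lemma level_ofE l : l < n -> level l = separator_level (tree_of st) (b ^ l) (b * b ^ l).
Proof. by move=> ln; rewrite /level_of !powNE ?(ltnW ln) // expnS. Qed.

(* The coarsest separator that the path meets. *)
Lemma path_level_ex i : i < k ->
  exists2 l, l <= depth & level_path (level l) (top i) (left i) (right i).
Proof.
move=> ik; have al := rooted_input_left input ik; have ar := rooted_input_right input ik.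
have an := anc_ltl rT al.
pose on v := ancestor_of st (top i) v && (ancestor_of st v (left i) || ancestor_of st v (right i)).
pose Q l := hasN n (fun v => on v && separator (tree_of st) (b ^ l) v).
have [||l le /andP[/hasNP[m mn /andP[/andP[am mlr] sep]] none]] := @last_true Q depth.
- apply/hasNP; exists (top i) => //; rewrite expn0 (separator1 rT) // andbT /on al andbT.
  exact: (anc_refl rT an).
- apply/negP => /hasNP[v _ /andP[_]].
  by apply/negP/separator_large; exact: trunc_log_ltn.
exists l => //; rewrite level_ofE ?level_lt //; split=> //.
- by move=> v; exact: (rooted_input_top input ik).
- move=> v av vlr; apply/negP => sep_v; case/negP: none; apply/hasNP; exists v.
    exact: (anc_ltr rT av).
  by rewrite expnS /on; apply/andP; split; [exact/andP|].
by exists m.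
Qed.

Definition earning l r i : R :=
  (32 * mid_earning f (flipped r) (free (level l)) (mark (level l)) F i +
   48 * seg_earning f (flipped r) (free (level l)) (mark (level l)) F i +
   8 * side_earning f (flipped r) (free (level l)) (mark (level l)) F i)%R.

Lemma earning_ge0 l r i : (0 <= earning l r i)%R.
Proof.
rewrite /earning !addr_ge0 ?mulr_ge0 //.
- exact: mid_earning_ge0.
- exact: seg_earning_ge0.
exact: side_earning_ge0.
Qed.

Lemma few_marks_level l : l <= depth ->
  forall c, c < n -> sumN n (fun w => conn (level l) c w * mark (level l) w) < b.
Proof.
move=> le c cn; rewrite level_ofE ?level_lt //.
by apply: (separator_count_lt rT) => //; rewrite ?expn_gt0 (ltnW b_gt1).
Qed.

Lemma sum_earning_le l r : l <= depth ->
  (\sum_(i < k) earning l r i <= 136 * best_revenue r)%R.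
Proof.
move=> le; have uniq b' l' c c' v := @comp_top_uniq (level_of (flipped r) b' l') _ _ rT c c' v.
have reached := best_search_spec (st := flipped r) f_ge0 (d r) b_lt (level_lt le) uniq.
have rL : rooted (Level (tree_of (flipped r)) (free (level l)) (mark (level l))) par dep.
  exact: rT.
have code_lt c (cn : c < n) :=
  (@code_ofP (flipped r) _ _ F _ _ rL b (few_marks_level le) codes_le c cn).1.
have le_side := sum_side_earning f_ge0 F rL reached.
have le_seg := sum_seg_earning f_ge0 f_mono rL reached code_lt.
have le_mid := sum_mid_earning reached code_lt.
by rewrite /earning !big_split /= -!mulr_sumr /best_revenue /best; lra.
Qed.

Lemma commodity_average (i : 'I_k) : (2 ^+ T * commodity_revenue f st F i <=
  \sum_(l < depth.+1) \sum_r earning l r i + \sum_r commodity_revenue f (flipped r) (best r) i)%R.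
Proof.
have best_ge0 : (0 <= \sum_r commodity_revenue f (flipped r) (best r) i)%R.
  by apply: sumr_ge0 => r _; exact: commodity_revenue_ge0.
have level_ge0 (l : 'I_depth.+1) : (0 <= \sum_r earning l r i)%R.
  by apply: sumr_ge0 => r _; exact: earning_ge0.
case: (boolP (hasN n (fun v => on_path st i v))) => [nonempty|empty]; last first.
  apply: ler_wpDl; first exact: sumr_ge0.
  rewrite -sum_tape_const; apply: ler_sum => r _.
  rewrite (eq_commodity_revenue f (F' := best r)) // => v vn iv.
  by case/negP: empty; apply/hasNP; exists v.
case: (leqP (path_load st F i) (st limit_array i)) => [load_le|overload]; last first.
  rewrite /commodity_revenue [in X in (X <= _)%R]leqNgt overload mul0n mul0r mulr0.
  by apply: addr_ge0 => //; exact: sumr_ge0.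
have [l le P] := path_level_ex (ltn_ord i); rewrite -ltnS in le.
apply: ler_wpDr => //; apply: le_trans (ler_sum_term (i := Ordinal le) level_ge0 isT).
have on_pathE v : v < n -> on_path st i v = _ := rooted_input_path input (ltn_ord i).
rewrite /commodity_revenue load_le mul1n (path_loadE (is_free := free (level l))
  (is_mark := mark (level l)) F on_pathE) !big_split /= -!mulr_sumr.
have bounds r := earning_path_bounds f_ge0 f_mono f_sub (st := flipped r)
  (rT : rooted (level l) _ _) (few_marks_level le) codes_le P on_pathE load_le nonempty.
apply: (path_average f_mono f_sub (rT : rooted (level l) _ _) nT _ P) => [|r|r|r|r] //.
- exact: side_earning_ge0.
- exact: seg_earning_ge0.
- exact: mid_earning_ge0.
apply: (path_bounds_coin (rT : rooted (level l) _ _)) (bounds r) => v vn.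
by rewrite /coin /flipped /with_coins eqxx (vn : v < n); case: (nth false r v).
Qed.

Lemma average_bound : (2 ^+ T * total_revenue f st F <=
  (136 * depth.+2)%:R * \sum_r best_revenue r)%R.
Proof.
have best_ge0 : (0 <= \sum_r best_revenue r)%R.
  by apply: sumr_ge0 => r _; apply: sumr_ge0 => i _; exact: commodity_revenue_ge0.
rewrite mulr_sumr; apply: le_trans (ler_sum _ (fun i _ => commodity_average i)) _.
rewrite big_split /= exchange_big /= [X in (_ + X <= _)%R]exchange_big /=.
apply: (@le_trans _ _ (\sum_(l < depth.+1) 136 * \sum_r best_revenue r + \sum_r best_revenue r)%R).
  rewrite lerD2r; apply: ler_sum => l _; rewrite exchange_big mulr_sumr.
  by apply: ler_sum => r _; apply: sum_earning_le; rewrite -ltnS.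
rewrite sumr_const card_ord -[X in (X + _ <= _)%R]mulr_natl mulrA -natrM.
rewrite -[X in (_ + X <= _)%R]mul1r -mulrDl natr1.
by rewrite ler_wpM2r // ler_nat; lia.
Qed.

End Average.

(** * The branching parameter *)

(* The largest [b] such that [(log n + 2) ^ (2 * b)] codes can be tried. *)
Definition branching n := (trunc_log (trunc_log 2 n + 2) (64 * (n * n)))./2.

Definition approx_ratio n := 136 * (trunc_log (branching n) n).+2.

Lemma sqrt_floor_ex m : exists2 q, q * q <= m & m < q.+1 * q.+1.
Proof.
elim: m => [|m [q le lt]]; first by exists 0.
by case: (ltnP m.+1 (q.+1 * q.+1)) => h; [exists q => //; lia|exists q.+1 => //; nia].
Qed.

Lemma pow4_le l : (l + 2) ^ 4 <= 64 * 4 ^ l.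
Proof.
elim: l => [//|[//|l] IH]; apply: (@leq_trans (4 * (l.+1 + 2) ^ 4)).
  by move: (l) => m; rewrite !expnS expn0; nia.
by rewrite [4 ^ l.+2]expnS; lia.
Qed.

Section Branching.
Variable n : nat.
Hypothesis n_gt0 : 0 < n.
Local Notation log := (trunc_log 2 n).
Local Notation b := (branching n).

Let base_gt1 : 1 < log + 2. Proof. by rewrite addn2. Qed.

Let codes_gt0 : 0 < 64 * (n * n). Proof. by rewrite !muln_gt0 n_gt0. Qed.

Lemma branchingE : 2 * b <= trunc_log (log + 2) (64 * (n * n)) < 2 * b + 2.
Proof.
rewrite /branching mul2n; have := odd_double_half (trunc_log (log + 2) (64 * (n * n))).
by case: odd => /=; lia.
Qed.

Lemma branching_codes : (log2N n + 2) ^ (2 * b) <= 64 * (n * n).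
Proof.
rewrite log2NE //; have /andP[le _] := branchingE.
by apply: leq_trans (trunc_logP base_gt1 codes_gt0); rewrite leq_exp2l.
Qed.

Lemma codes_ge_pow4 : 64 * 4 ^ log <= 64 * (n * n).
Proof.
have le := trunc_logP (ltnSn 1) n_gt0.
by rewrite leq_mul2l (_ : 4 = 2 * 2) // expnMn leq_mul.
Qed.

Lemma codes_le_pow2 : 64 * (n * n) <= 2 ^ (2 * (log + 4)).
Proof.
have lt : n < 2 ^ log.+1 by exact: trunc_log_ltn.
apply: (@leq_trans (2 ^ 6 * (2 ^ log.+1 * 2 ^ log.+1))).
  by rewrite leq_mul2l leq_mul // ltnW.
by rewrite -!expnD leq_exp2l //; lia.
Qed.

Lemma branching_gt1 : 1 < b.
Proof.
have /andP[_ lt] := branchingE.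
suff : 4 <= trunc_log (log + 2) (64 * (n * n)) by lia.
apply: trunc_log_max => //; exact: leq_trans (pow4_le _) codes_ge_pow4.
Qed.

Lemma branching_lt : b < n + 8.
Proof.
have := leq_trans branching_codes codes_le_pow2; rewrite log2NE // => le.
have : 2 ^ (2 * b) <= 2 ^ (2 * (log + 4)).
  by apply: leq_trans le; rewrite leq_exp2r //; have := branching_gt1; lia.
by rewrite leq_exp2l // leq_mul2l /=; have := trunc_log_ltn_self (ltnSn 1) n_gt0; lia.
Qed.

(* With [q] the integer square root of [log + 2], the code bound compares the exponents of
   [2 ^ (2 * (log + 2))] and [(2 ^ (2 * q)) ^ (2 * b + 2)]. *)
Lemma log_le_branching_sq : log + 2 <= 9 * (b * b).
Proof.
have [q q_le lt_q] := sqrt_floor_ex (log + 2); have b_gt1 := branching_gt1.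
have lt_codes : 2 ^ (2 * (log + 2) + 2) < (log + 2) ^ (2 * b + 2).
  have /andP[_ lt] := branchingE; apply: (@leq_ltn_trans (64 * (n * n))).
    apply: leq_trans codes_ge_pow4; rewrite (_ : 64 = 2 ^ 6) // (_ : 4 = 2 ^ 2) //.
    by rewrite -expnM -expnD leq_exp2l //; lia.
  by apply: leq_trans (trunc_log_ltn _ base_gt1) _; rewrite leq_exp2l.
have codes_le : (log + 2) ^ (2 * b + 2) <= 2 ^ (2 * q * (2 * b + 2)).
  rewrite expnM leq_exp2r; last by lia.
  apply: leq_trans (ltnW lt_q) _; rewrite mul2n -addnn expnD.
  by apply: leq_mul; exact: ltn_expl.
have := leq_trans lt_codes codes_le; rewrite ltn_exp2l // => lt_exp.
have q_le_b : q <= 2 * b + 1 by nia.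
have : q.+1 * q.+1 <= (3 * b) * (3 * b) by apply: leq_mul; lia.
lia.
Qed.

Lemma log_le_branching_pow : log + 2 <= b ^ 6.
Proof.
apply: leq_trans log_le_branching_sq _; have b_gt1 := branching_gt1.
have b4 : 9 <= b ^ 4 by apply: (@leq_trans (2 ^ 4)) => //; rewrite leq_exp2r.
by rewrite (_ : 6 = 4 + 2) // expnD leq_mul // mulnn.
Qed.

End Branching.

Section Asymptotics.
Local Open Scope classical_set_scope.
Variable R : realType.
Local Open Scope ring_scope.
Implicit Types n b : nat.

Lemma expR_half_le2 : expR (1 / 2) <= 2 :> R.
Proof.
have exp_gt0 := expR_gt0 (1 / 2 : R).
have : 1 / 2 <= expR (- (1 / 2)) :> R by apply: le_trans (expR_ge1Dx _); lra.
by rewrite expRN; have := divff (lt0r_neq0 exp_gt0); nra.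
Qed.

Lemma ln_gt1 (x : R) : 4 < x -> 1 < ln x.
Proof.
move=> x_gt4; have x_gt0 : 0 < x by apply: lt_trans x_gt4.
rewrite -[1]expRK ltr_ln ?posrE ?expR_gt0 //; apply: le_lt_trans x_gt4.
rewrite (_ : 1 = 1 / 2 + 1 / 2 :> R); last by lra.
by rewrite expRD; have := expR_half_le2; have := expR_gt0 (1 / 2 : R); nra.
Qed.

Lemma ln_le_trunc_log n : (0 < n)%N -> ln (n%:R : R) <= (trunc_log 2 n + 2)%:R.
Proof.
move=> n_gt0; have : ln (n%:R : R) <= ln (2 ^+ (trunc_log 2 n).+1).
  rewrite ler_ln ?posrE ?exprn_gt0 ?ltr0n // -natrX ler_nat ltnW //; exact: trunc_log_ltn.
rewrite lnXn // -[(ln 2 *+ _)]mulr_natl => /le_trans; apply.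
apply: (@le_trans _ _ ((trunc_log 2 n).+1%:R * 1)); last by rewrite mulr1 ler_nat addn2.
rewrite ler_wpM2l // -[X in _ <= X]expRK ler_ln ?posrE ?expR_gt0 //.
by apply: le_trans (expR_ge1Dx _); lra.
Qed.

Lemma trunc_log_ln_le b n : (1 < b)%N -> (0 < n)%N ->
  (trunc_log b n)%:R * ln (b%:R : R) <= ln n%:R.
Proof.
move=> b_gt1 n_gt0; rewrite mulr_natl -lnXn ?ltr0n 1?ltnW // -natrX.
rewrite ler_ln ?posrE ?ltr0n ?expn_gt0 ?(ltnW b_gt1) // ler_nat; exact: trunc_logP.
Qed.

Lemma approx_ratio_le n : (4 < n)%N ->
  (approx_ratio n)%:R <= 1088 * (ln n%:R / ln (ln n%:R)) :> R.
Proof.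
move=> n_gt4; have n_gt0 : (0 < n)%N by exact: leq_ltn_trans n_gt4.
have ln_n : 1 < ln (n%:R : R) by apply: ln_gt1; rewrite ltr_nat.
have ln_n_gt0 : 0 < ln (n%:R : R) by apply: lt_trans ln_n.
have lnln_gt0 : 0 < ln (ln (n%:R : R)) by rewrite ln_gt0.
have b_gt1 := branching_gt1 n_gt0; set b := branching n in b_gt1.
have b_gt0 : 0 < (b%:R : R) by rewrite ltr0n ltnW.
have lnln_le : ln (ln (n%:R : R)) <= 6 * ln b%:R.
  rewrite mulr_natl -lnXn // ler_ln ?posrE ?exprn_gt0 //.
  by apply: le_trans (ln_le_trunc_log n_gt0) _; rewrite -natrX ler_nat log_le_branching_pow.
have quot_ge1 : 1 <= ln (n%:R : R) / ln (ln n%:R).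
  by rewrite ler_pdivlMr // mul1r ltW // ln_sublinear.
have depth_le : (trunc_log b n)%:R <= 6 * (ln (n%:R : R) / ln (ln n%:R)).
  rewrite mulrA ler_pdivlMr //; apply: le_trans (ler_wpM2l (ler0n _ _) lnln_le) _.
  by rewrite mulrCA ler_pM2l // trunc_log_ln_le.
by rewrite /approx_ratio -/b natrM -addn2 natrD; nra.
Qed.

Lemma approx_ratio_eqO :
  (fun n => (approx_ratio n)%:R : R) =O_\oo (fun n : nat => ln n%:R / ln (ln n%:R) : R).
Proof.
apply/eqO_exP; exists 1088; first by rewrite ltr0n.
near=> n; have n_gt4 : (4 < n)%N by near: n; exact: nbhs_infty_gt.
rewrite ger0_norm ?ler0n //; apply: le_trans (approx_ratio_le n_gt4) _.
by rewrite ler_pM2l ?ltr0n // ler_norm.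
Unshelve. all: by end_near.
Qed.

End Asymptotics.

(** * Rooting a tree by distance *)

Lemma sumN_first_le n (p : pred nat) t : t < n -> (forall s, p s -> p s.+1) ->
  (sumN n (fun s => ~~ p s) <= t) = p t.
Proof.
move=> tn pS; have p_mono s s' : s <= s' -> p s -> p s'.
  by move/subnK <-; elim: (s' - s) => [//|m IH] /IH /pS; rewrite addSn.
case: (boolP (p t)) => [pt|npt].
  rewrite -[leqRHS](sumN_ltn (ltnW tn)); apply: leq_sumN => s _.
  by case: (leqP t s) => [ts|_]; rewrite ?(p_mono _ _ ts pt) ?leq_b1.
apply/negbTE; rewrite -ltnNge -[leqLHS](sumN_ltn tn); apply: leq_sumN => s _.
rewrite ltnS; case: (leqP s t) => // st; case ps: (p s) => //.
by rewrite (p_mono _ _ st ps) in npt.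
Qed.

Section Distance.
Variables (V : finType) (e : rel V) (r : V).
Hypothesis eT : is_tree e.

Let e_sym : symmetric e. Proof. by case: eT. Qed.
Let e_irr : irreflexive e. Proof. by case: eT. Qed.

Fixpoint within t v :=
  if t is t'.+1 then within t' v || [exists w, e w v && within t' w] else v == r.

Definition distance v := sumN #|V| (fun t => ~~ within t v).

Lemma within_path p : path e r p -> within (size p) (last r p).
Proof.
elim/last_ind: p => [|p x IH] /=; first by rewrite eqxx.
rewrite rcons_path size_rcons last_rcons => /andP[/IH rp ex].
by apply/orP; right; apply/existsP; exists (last r p); rewrite ex.
Qed.

Lemma within_ex v : exists2 t, t < #|V| & within t v.
Proof.
have [_ _ _ /(_ r v)/connectP[p pp ->] _] := eT.
case/shortenP: pp => p' pp' up' _; exists (size p'); last exact: within_path.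
by have := max_card (mem (r :: p')); rewrite (card_uniqP up').
Qed.

Lemma distance_leE t v : t < #|V| -> (distance v <= t) = within t v.
Proof. by move=> tV; rewrite /distance sumN_first_le // => s /= ->. Qed.

Lemma distance_lt v : distance v < #|V|.
Proof.
by have [t tV rt] := within_ex v; apply: leq_ltn_trans (tV); rewrite distance_leE.
Qed.

Lemma distance_eq0 v : (distance v == 0) = (v == r).
Proof. by rewrite -leqn0 distance_leE //; apply/card_gt0P; exists r. Qed.

Lemma distance_edge v w : e v w -> distance w <= (distance v).+1.
Proof.
move=> vw; case: (ltnP (distance v).+1 #|V|) => lt; last first.
  exact: leq_trans (ltnW (distance_lt w)) lt.
rewrite distance_leE //=; apply/orP; right; apply/existsP; exists v; rewrite vw /=.
by rewrite -distance_leE // distance_lt.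
Qed.

Lemma distance_pred v : v != r -> exists2 w, e v w & distance v = (distance w).+1.
Proof.
move=> vr; have := vr; rewrite -distance_eq0; case E: (distance v) => [//|d] _.
have dV : d < #|V| by apply: ltn_trans (distance_lt v); rewrite E.
have : within d.+1 v by rewrite -distance_leE ?E // -E distance_lt.
rewrite /= -distance_leE // E ltnn /= => /existsP[w /andP[wv dw]].
exists w; first by rewrite e_sym.
rewrite -distance_leE // in dw; have := distance_edge wv; rewrite E => le.
by congr _.+1; apply/eqP; rewrite eqn_leq dw andbT -ltnS.
Qed.

Definition avoiding v := [rel x y | [&& e x y, x != v & y != v]].

Lemma connect_avoiding v w : w != v -> distance w <= distance v -> connect (avoiding v) w r.
Proof.
have [m] := ubnP (distance w); elim: m w => // m IH w lt wv le.
have [->|wr] := eqVneq w r; first exact: connect0.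
have [w' ww' E] := distance_pred wr.
have w'v : w' != v by apply: contraTneq le => <-; rewrite E -ltnNge.
apply: (@connect_trans _ _ w'); first by apply: connect1; rewrite /= ww' wv w'v.
by apply: IH => //; lia.
Qed.

(* Two such neighbours are connected through the root while avoiding [v], which would close
   a cycle. *)
Lemma near_neighbour_uniq v w1 w2 : e v w1 -> e v w2 ->
  distance w1 <= distance v -> distance w2 <= distance v -> w1 = w2.
Proof.
move=> e1 e2 d1 d2; apply/eqP; apply: contraT => ne.
have n1 : w1 != v by apply: contraTneq e1 => ->; rewrite e_irr.
have n2 : w2 != v by apply: contraTneq e2 => ->; rewrite e_irr.
have sym : connect_sym (avoiding v).
  by apply: sym_connect_sym => x y /=; rewrite e_sym; case: (e y x) => //=; rewrite andbC.
have /connectP[p pp lp] : connect (avoiding v) w1 w2.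
  by apply: connect_trans (connect_avoiding n1 d1) _; rewrite sym; exact: connect_avoiding.
case/shortenP: pp lp => q pq uq _ lq.
have pe : path e w1 q by apply: sub_path pq => x y /= /and3P[].
have nv : v \notin q.
  elim: (q) (w1) pq => [|y q' IH] x //= /andP[/and3P[_ _ yv] /IH].
  by rewrite inE eq_sym (negPf yv).
have long : 2 < size [:: v, w1 & q].
  by case: (q) lq => [/= E|//]; rewrite E eqxx in ne.
have [_ _ _ _ /(_ _ long)/negP[]] := eT.
by rewrite /= e1 rcons_path pe -lq e_sym e2 /= inE eq_sym (negPf n1) nv.
Qed.

Lemma distance_neq v w : e v w -> distance v != distance w.
Proof.
move=> vw; apply/negP => /eqP E; have vr : v != r.
  apply: contraTneq vw => vr; have : distance w == 0 by rewrite -E distance_eq0 vr.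
  by rewrite distance_eq0 => /eqP ->; rewrite vr e_irr.
have [p vp dp] := distance_pred vr.
have pw : p = w by apply: (near_neighbour_uniq vp vw); lia.
by rewrite pw E in dp; lia.
Qed.

Definition parent v := odflt r [pick w | e v w && (distance w < distance v)].

Lemma parentP v : v != r -> e v (parent v) /\ distance v = (distance (parent v)).+1.
Proof.
move=> vr; have [w vw E] := distance_pred vr; rewrite /parent.
case: pickP => [x /andP[vx lt]|/(_ w)]; last by rewrite vw E ltnSn.
by split=> //=; have -> // : x = w by apply: (near_neighbour_uniq vx vw); lia.
Qed.

Lemma parent_root : parent r = r.
Proof.
rewrite /parent; case: pickP => // x /andP[_].
by have /eqP -> : distance r == 0; rewrite ?distance_eq0 ?ltn0.
Qed.

Lemma near_parent v w : e v w -> distance w < distance v -> v != r /\ parent v = w.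
Proof.
move=> vw lt; have vr : v != r by rewrite -distance_eq0 -lt0n (leq_ltn_trans _ lt).
by have [vp dp] := parentP vr; split=> //; apply: (near_neighbour_uniq vp vw); lia.
Qed.

End Distance.

Definition parent_tree n par dep := Tree n
  (fun v w => [&& v < n, w < n, dep v <= dep w & iter (dep w - dep v) par w == v])
  (fun c v => [&& c < n, 0 < c & par c == v]).

Section TreePathStep.
Variables (T : tree) (par dep : nat -> nat).
Hypothesis rT : rooted T par dep.

Lemma anc_child c p v : child T c p -> anc T v c = (v == c) || anc T v p.
Proof.
move=> cp; apply/idP/orP => [vc|[/eqP->|vp]].
- case: (eqVneq v c) => [->|ne]; first by left.
  by right; rewrite -(child_par rT cp) (anc_to_par rT).
- exact: (anc_refl rT (child_ltl rT cp)).
exact: (anc_trans rT vp (child_anc rT cp)).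
Qed.

Lemma tree_path_from_child x y a t v : child T x y -> anc T a y ->
  tree_path T a x t v = (v == x) || tree_path T a y t v.
Proof.
move=> xy ay; rewrite /tree_path (anc_child v xy); case: (eqVneq v x) => //= ->.
rewrite (anc_trans rT ay (child_anc rT xy)) andbT; apply: contraTneq ay => <-.
exact: (child_not_anc rT xy).
Qed.

Lemma tree_path_to_child x y t v : child T y x -> anc T y t ->
  tree_path T x x t v = (v == y) || tree_path T y y t v.
Proof.
move=> yx yt; have xy := child_anc rT yx; rewrite /tree_path; case: (eqVneq v y) => [->|ne] /=.
  rewrite xy yt orbT andbT; apply: contraTneq (child_not_anc rT yx) => ->.
  by rewrite (anc_refl rT) ?(child_ltr rT yx).
apply/and3P/andP => [[xv nx /orP[vx|vt]]|[yv /orP[vy|vt]]].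
- by rewrite (anc_anti rT xv vx) eqxx in nx.
- case/orP: (anc_total rT yt vt) => [->|vy]; first by rewrite vt orbT.
  have vx := anc_to_par rT vy ne; rewrite (child_par rT yx) in vx.
  by rewrite (anc_anti rT xv vx) eqxx in nx.
- by rewrite (anc_anti rT yv vy) eqxx in ne.
split; [exact: (anc_trans rT xy yv)| |by rewrite vt orbT].
by apply: contraTneq yv => ->; exact: (child_not_anc rT yx).
Qed.

End TreePathStep.

Section RootedPaths.
Variables (n : nat) (n_gt0 : 0 < n) (e : rel 'I_n).
Hypothesis eT : is_tree e.
Local Notation V := 'I_n.
Let r : V := Ordinal n_gt0.

Definition parent_nat v : nat := parent e r (insubd r v).
Definition distance_nat v : nat := distance e r (insubd r v).
Definition distance_tree := parent_tree n parent_nat distance_nat.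
Local Notation T := distance_tree.

Lemma parent_natE (x : V) : parent_nat x = parent e r x.
Proof. by rewrite /parent_nat valKd. Qed.

Lemma distance_natE (x : V) : distance_nat x = distance e r x.
Proof. by rewrite /distance_nat valKd. Qed.

Lemma distance_tree_rooted : rooted T parent_nat distance_nat.
Proof.
have root0 : insubd r 0 = r by exact: (valKd r r).
split=> //.
- by rewrite /parent_nat root0 parent_root.
- by apply/eqP; rewrite /distance_nat root0 distance_eq0.
- by move=> v vn; exact: ltn_ord.
- move=> v /andP[v_gt0 vn]; rewrite -[v]/(val (Ordinal vn)) distance_natE parent_natE distance_natE.
  by have [] := parentP eT (_ : Ordinal vn != r); rewrite -?val_eqE /= -?lt0n.
by move=> v vn; rewrite -[v]/(val (Ordinal vn)) distance_natE -[ltnRHS]card_ord distance_lt.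
Qed.

Let rT := distance_tree_rooted.

Lemma edge_child (x y : V) : e x y -> child T x y \/ child T y x.
Proof.
move=> xy; have := distance_neq r eT xy; rewrite neq_ltn => /orP[] lt; [right|left].
  have [|y_root py] := near_parent eT _ lt; first by case: eT => ->.
  by rewrite /= ltn_ord lt0n y_root parent_natE py eqxx.
have [x_root px] := near_parent eT xy lt.
by rewrite /= ltn_ord lt0n x_root parent_natE px eqxx.
Qed.

Definition parent_edge (v : V) : {set V} := [set v; parent e r v].

Lemma parent_edge_inj (v w : V) : 0 < v -> 0 < w -> parent_edge v = parent_edge w -> v = w.
Proof.
move=> v_gt0 w_gt0 E; apply/eqP; apply: contraT => ne.
have vw : v \in parent_edge w by rewrite -E !inE eqxx.
have wv : w \in parent_edge v by rewrite E !inE eqxx.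
move: vw wv; rewrite !inE (negPf ne) [w == v]eq_sym (negPf ne) /= => /eqP pw /eqP pv.
have v_root : v != r by rewrite -lt0n.
have w_root : w != r by rewrite -lt0n.
by have [_] := parentP eT v_root; have [_] := parentP eT w_root; rewrite -pv -pw; lia.
Qed.

Lemma child_edge (x y : V) : child T x y -> [set x; y] = parent_edge x.
Proof. by case/and3P=> _ _ /eqP; rewrite parent_natE => /val_inj <-. Qed.

Lemma walk_edges_cons (x y : V) p : walk_edges x (y :: p) = [set x; y] |: walk_edges y p.
Proof.
apply/setP => S; rewrite !inE; apply/imsetP/orP => /=.
  case=> -[u v]; rewrite inE => /orP[/eqP[-> ->] ->|uv ->]; first by left.
  by right; apply/imsetP; exists (u, v).
case=> [/eqP ->|/imsetP[[u v] uv ->]]; first by exists (x, y); rewrite // inE eqxx.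
by exists (u, v); rewrite // inE uv orbT.
Qed.

Lemma cover_walk_edges (x : V) p v : v \in finset.cover (walk_edges x p) -> v \in x :: p.
Proof.
case/finset.bigcupP=> S; elim: p x => [|y p IH] x; first by case/imsetP=> -[].
rewrite walk_edges_cons in_setU1 => /orP[/eqP->|Sp] vS; last by rewrite inE IH ?orbT.
by move: vS; rewrite !inE => /orP[] ->; rewrite ?orbT.
Qed.

(* The path with edge set [S] runs between [s] and [t], and [a] is their lowest common
   ancestor. *)
Record edge_path (S : {set {set V}}) (a s t : nat) : Prop := EdgePath {
  edge_path_l : anc T a s;
  edge_path_r : anc T a t;
  edge_path_lca : forall v, anc T v s -> anc T v t -> anc T v a;
  edge_pathE : forall v : V, (0 < v) && (parent_edge v \in S) = tree_path T a s t v
}.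

Lemma edge_path_nil (x : V) : edge_path (walk_edges x [::]) x x x.
Proof.
have xx : anc T x x by exact: (anc_refl rT).
split=> // v; rewrite /tree_path orbb.
have -> : parent_edge v \in walk_edges x [::] = false.
  by apply/negP => /imsetP[[u w]]; rewrite inE.
rewrite andbF; apply/esym/negP => /and3P[xv ne vx].
by rewrite (anc_anti rT xv vx) eqxx in ne.
Qed.

Lemma edge_path_avoid S a s t (x v : V) : edge_path S a s t -> x \notin finset.cover S ->
  tree_path T a s t v -> v != x /\ parent e r v != x.
Proof.
move=> P xS; rewrite -(edge_pathE P) => /andP[v_gt0 vS].
have in_cover u : u \in parent_edge v -> u \in finset.cover S.
  by move=> uv; apply/finset.bigcupP; exists (parent_edge v).
by split; apply: contraNneq xS => <-; apply: in_cover; rewrite !inE eqxx ?orbT.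
Qed.

Lemma edge_path_step S (x y c p v : V) : [set x; y] = parent_edge c -> child T c p ->
  (0 < v) && (parent_edge v \in [set x; y] |: S) = (v == c) || ((0 < v) && (parent_edge v \in S)).
Proof.
move=> xyc /and3P[_ c_gt0 _]; rewrite in_setU1 xyc; case: (eqVneq v c) => [->|ne].
  by rewrite c_gt0 eqxx.
case: (posnP v) => //= v_gt0; case: eqP => // /(parent_edge_inj v_gt0 c_gt0) vc.
by rewrite vc eqxx in ne.
Qed.

Lemma edge_path_up S a t (x y : V) : child T x y -> edge_path S a y t -> t < n ->
  x \notin finset.cover S -> edge_path ([set x; y] |: S) a x t.
Proof.
move=> xy P tn xS; have ay := edge_path_l P; have yx := child_anc rT xy.
have ax : anc T a x by exact: (anc_trans rT ay yx).
have xa : val x != a by apply: contraTneq ay => <-; exact: (child_not_anc rT xy).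
have xt : ~~ anc T x t.
  apply/negP => xt; have [|] := edge_path_avoid (v := x) P xS; last by rewrite eqxx.
  by rewrite /tree_path ax xa xt orbT.
split=> //; first exact: (edge_path_r P).
  move=> v; rewrite (anc_child rT v xy) => /orP[/eqP->|]; last exact: (edge_path_lca P).
  by move=> xt'; rewrite xt' in xt.
move=> v; rewrite (tree_path_from_child rT t v xy ay) -(edge_pathE P).
by rewrite (edge_path_step _ _ (child_edge xy) xy).
Qed.

Lemma edge_path_down S a t (x y : V) : child T y x -> edge_path S a y t ->
  x \notin finset.cover S -> edge_path ([set x; y] |: S) x x t.
Proof.
move=> yx P xS; have yy : anc T y y by exact: (anc_refl rT).
have ya : a = y.
  apply/eqP; apply: contraT; rewrite eq_sym => ya.
  have [|_] := edge_path_avoid (v := y) P xS; first by rewrite /tree_path (edge_path_l P) ya yy.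
  by rewrite -val_eqE /= -parent_natE (child_par rT yx) eqxx.
rewrite {}ya in P; have xy := child_anc rT yx.
split.
- exact: (anc_refl rT).
- exact: (anc_trans rT xy (edge_path_r P)).
- by [].
have xyE : [set x; y] = parent_edge y by rewrite -(child_edge yx) finset.setUC.
move=> v; rewrite (tree_path_to_child rT v yx (edge_path_r P)) -(edge_pathE P).
by rewrite (edge_path_step _ _ xyE yx).
Qed.

Lemma walk_edge_path (x : V) p : path e x p -> uniq (x :: p) ->
  exists a : nat, edge_path (walk_edges x p) a x (last x p).
Proof.
elim: p x => [|y p IH] x /=; first by exists x; exact: edge_path_nil.
case/andP=> xy pp /andP[xn up]; have [a P] := IH y pp up; rewrite walk_edges_cons.
have xS : x \notin finset.cover (walk_edges y p) by apply: contra xn => /cover_walk_edges.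
case: (edge_child xy) => h; [exists a|exists x].
  exact: (edge_path_up h P).
exact: (edge_path_down h P xS).
Qed.

End RootedPaths.

(** * The instance as seen by the program *)

Section Instance.
Variables (R : realType) (I : fza R).
Local Notation n := (fza_n I).
Local Notation k := (fza_k I).
Local Notation e := (@fza_adj R I).
Let eT : is_tree e := @fza_tree R I.

Lemma fza_n_gt0 : 0 < n.
Proof. by case: eT => _ _; rewrite card_ord. Qed.

Let r : 'I_n := Ordinal fza_n_gt0.
Let par := parent_nat fza_n_gt0 e.
Let dep := distance_nat fza_n_gt0 e.
Local Notation T := (distance_tree fza_n_gt0 e).
Let rT : rooted T par dep := distance_tree_rooted fza_n_gt0 eT.
Local Notation parent_edge := (parent_edge fza_n_gt0 e).

(* The input with the tables that the preprocessing is to compute. *)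
Definition annotated_input : memory nat := fun A j =>
  match A with
  | distance_array => (j < n * n) && within e r (j %/ n) (insubd r (j %% n)) : nat
  | ancestor_array => (j < n * n) && anc T (j %/ n) (j %% n) : nat
  | _ => if A <= weight_array then input_nmem I A j else 0
  end.
Local Notation st := annotated_input.

Lemma annotated_adjacency (x y : 'I_n) : (st adjacency_array (x * n + y) != 0) = e x y.
Proof.
rewrite eqb0 negbK; apply/existsP/idP => [[x' /existsP[y' /andP[/eqP E]]]|xy].
  have := congr1 (divn^~ n) E; rewrite !divn_index // => /val_inj ->.
  by have := congr1 (modn^~ n) E; rewrite !modn_index // => /val_inj ->.
by exists x; apply/existsP; exists y; rewrite eqxx.
Qed.

Lemma annotated_path (i : 'I_k) (x y : 'I_n) :
  (st path_array ((i * n + x) * n + y) != 0) = ([set x; y] \in fza_P i).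
Proof.
rewrite eqb0 negbK.
apply/existsP/idP => [[i' /existsP[x' /existsP[y' /andP[/eqP E]]]]|xy].
  have E_row := congr1 (divn^~ n) E; rewrite !divn_index // in E_row.
  have := congr1 (divn^~ n) E_row; rewrite !divn_index // => /val_inj ->.
  have := congr1 (modn^~ n) E_row; rewrite !modn_index // => /val_inj ->.
  by have := congr1 (modn^~ n) E; rewrite !modn_index // => /val_inj ->.
by exists i; apply/existsP; exists x; apply/existsP; exists y; rewrite eqxx.
Qed.

Lemma annotated_limit (i : 'I_k) : st limit_array i = fza_u i.
Proof. by rewrite /st /= valK. Qed.

Lemma annotated_weight (i : 'I_k) : st weight_array i = fza_w i.
Proof. by rewrite /st /= valK. Qed.

Lemma annotated_distance t (x : 'I_n) : t < n -> st distance_array (t * n + x) = within e r t x.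
Proof.
move=> tn; rewrite [LHS]/(nat_of_bool (_ && _)) ltn_index // divn_index // modn_index // valKd.
by [].
Qed.

Lemma annotated_ancestor v w : v < n -> w < n -> st ancestor_array (v * n + w) = anc T v w.
Proof.
by move=> vn wn; rewrite [LHS]/(nat_of_bool (_ && _)) ltn_index // divn_index // modn_index.
Qed.

Lemma annotated_depth (x : 'I_n) : depth_of st x = dep x.
Proof.
rewrite /dep distance_natE /distance card_ord; apply: eq_sumN => t tn.
by rewrite annotated_distance // eqb0.
Qed.

Lemma annotated_parent : parent_of st = child T.
Proof.
apply: funext => v; apply: funext => w; rewrite /parent_of [bound_val _ _]/n /=.
case: (ltnP v n) => //= vn; case: (ltnP w n) => /= wn; last first.
  by apply/esym/negP => /andP[_ /eqP E]; have := rooted_par_lt rT vn; rewrite /par E ltnNge wn.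
rewrite -[v]/(val (Ordinal vn)) -[w]/(val (Ordinal wn)); move: (Ordinal vn) (Ordinal wn) => x y.
rewrite annotated_adjacency !annotated_depth /dep !distance_natE parent_natE.
apply/andP/andP => -[].
  by move=> xy lt; have [x_root ->] := near_parent eT xy lt; rewrite lt0n.
rewrite lt0n => x_root /eqP/val_inj <-.
by have [xp ->] := parentP eT (x_root : x != r).
Qed.

Lemma annotated_anc : ancestor_of st = anc T.
Proof.
apply: funext => v; apply: funext => w; rewrite /ancestor_of [bound_val _ _]/n.
case: (ltnP v n) => vn; last by rewrite /= [v < n]ltnNge vn.
case: (ltnP w n) => wn; last by rewrite /= vn [w < n]ltnNge wn.
by rewrite annotated_ancestor // eqb0 negbK.
Qed.

Lemma annotated_tree : tree_of st = T.
Proof. by rewrite /tree_of annotated_anc annotated_parent. Qed.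

Lemma annotated_on_path (i : 'I_k) (v : 'I_n) :
  on_path st i v = (0 < v) && (parent_edge v \in fza_P i).
Proof.
rewrite /on_path annotated_parent; apply/hasNP/andP => [[w wn /andP[vw]]|[v_gt0 vP]].
  rewrite -[w]/(val (Ordinal wn)) annotated_path (child_edge (y := Ordinal wn) vw) => vP.
  by case/and3P: vw.
exists (parent e r v); first exact: ltn_ord.
by rewrite annotated_path vP andbT /= ltn_ord v_gt0 parent_natE eqxx.
Qed.

Lemma annotated_rooted : exists top left right, rooted_input st par dep top left right.
Proof.
have path_ex i : exists q : nat * nat * nat, forall ik : i < k,
    edge_path fza_n_gt0 e (fza_P (Ordinal ik)) q.1.1 q.1.2 q.2.
  case: (pselect (i < k)) => [ik|nk]; last by exists (0, 0, 0) => ik; case: (nk ik).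
  have [x [p [pp up pathE]]] := @fza_P_path R I (Ordinal ik).
  have [a P] := walk_edge_path fza_n_gt0 eT pp up.
  by exists (a, val x, val (last x p)) => ik'; rewrite (bool_irrelevance ik' ik) pathE.
have {path_ex}[q P] := choice path_ex.
exists (fun i => (q i).1.1), (fun i => (q i).1.2), (fun i => (q i).2); split.
- by rewrite annotated_tree.
- by move=> i ik; rewrite annotated_anc; exact: (edge_path_l (P i ik)).
- by move=> i ik; rewrite annotated_anc; exact: (edge_path_r (P i ik)).
- by move=> i v ik; rewrite annotated_anc; exact: (edge_path_lca (P i ik)).
move=> i v ik vn; rewrite annotated_tree -[v]/(val (Ordinal vn)) -(edge_pathE (P i ik)).
exact: (annotated_on_path (Ordinal ik)).
Qed.

(** ** Sets of edges and sets of vertices *)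

Definition lower_ends (F : {set {set 'I_n}}) v := (0 < v) && (parent_edge (insubd r v) \in F).

Definition parent_edges (F : pred nat) : {set {set 'I_n}} :=
  [set parent_edge v | v : 'I_n & (0 < v) && F v].

Lemma edge_parent_edge S : S \in fza_E I -> exists2 v : 'I_n, 0 < v & S = parent_edge v.
Proof.
case/imsetP=> -[x y]; rewrite inE /= => xy ->.
have [h|h] := edge_child fza_n_gt0 eT xy; have /and3P[_ gt0 _] := h.
  by exists x => //; exact: child_edge.
by exists y => //; rewrite finset.setUC; exact: child_edge.
Qed.

Lemma parent_edge_in_E (v : 'I_n) : 0 < v -> parent_edge v \in fza_E I.
Proof.
rewrite lt0n => v_root; have [vp _] := parentP eT (v_root : v != r).
by apply/imsetP; exists (v, parent e r v); rewrite ?inE.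
Qed.

Lemma fza_P_sub_E i : fza_P i \subset fza_E I.
Proof.
have [x [p [pp _ ->]]] := @fza_P_path R I i.
elim: p x pp => [|y p IH] x /=.
  by move=> _; apply/fintype.subsetP => S /imsetP[[]].
case/andP=> xy /IH sub; rewrite walk_edges_cons finset.subUset sub andbT finset.sub1set.
by apply/imsetP; exists (x, y); rewrite ?inE.
Qed.

Lemma lower_ends_load (F : {set {set 'I_n}}) (i : 'I_k) :
  #|fza_P i :&: F| = path_load st (lower_ends F) i.
Proof.
have -> : fza_P i :&: F = [set parent_edge v | v : 'I_n & on_path st i v && lower_ends F v].
  apply/setP => S; rewrite !inE; apply/andP/imsetP.
    case=> SP SF; have [v v_gt0 E] := edge_parent_edge (fintype.subsetP (fza_P_sub_E i) _ SP).
    by exists v => //; rewrite inE annotated_on_path /lower_ends valKd v_gt0 -E SP SF.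
  by case=> v; rewrite inE annotated_on_path /lower_ends valKd => /andP[/andP[_ vP] /andP[_ vF]] ->.
rewrite card_in_imset => [|v w]; last first.
  rewrite !inE /lower_ends => /andP[_ /andP[v_gt0 _]] /andP[_ /andP[w_gt0 _]].
  exact: (parent_edge_inj eT).
by rewrite /path_load sumN_card; apply: eq_card => v; rewrite !inE.
Qed.

Lemma revenue_lower_ends (F : {set {set 'I_n}}) :
  revenue F = total_revenue (fza_f I) st (lower_ends F).
Proof.
apply: eq_bigr => i _.
rewrite /fza_rev /commodity_revenue lower_ends_load annotated_limit annotated_weight.
by case: leqP => _; rewrite ?mul1n // mul0n mul0r.
Qed.

Lemma parent_edges_sub F : parent_edges F \subset fza_E I.
Proof.
apply/fintype.subsetP => S /imsetP[v]; rewrite inE => /andP[v_gt0 _] ->.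
exact: parent_edge_in_E.
Qed.

Lemma revenue_parent_edges F : revenue (parent_edges F) = total_revenue (fza_f I) st F.
Proof.
rewrite revenue_lower_ends; apply: eq_bigr => i _; apply: eq_commodity_revenue => v vn.
rewrite -[v]/(val (Ordinal vn)) annotated_on_path => /andP[v_gt0 _].
rewrite /lower_ends valKd v_gt0 /=; apply/imsetP/idP => [[w]|Fv].
  by rewrite inE => /andP[w_gt0 Fw] /(parent_edge_inj eT v_gt0 w_gt0) /(congr1 val) /= ->.
by exists (Ordinal vn) => //; rewrite inE v_gt0.
Qed.

Lemma output_parent_edges (F : pred nat) (s : state R) :
  (forall v w, v < n -> w < n -> nmem s output_array (v * n + w) = child T v w && F v) ->
  output_set I s = parent_edges F.
Proof.
move=> outputE; apply/setP => S; apply/imsetP/imsetP => [[[x y]]|[v]]; rewrite inE /=.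
  rewrite outputE // eqb0 negbK => /andP[xy Fx] ->; have /and3P[_ x_gt0 _] := xy.
  by exists x; [rewrite inE x_gt0|exact: child_edge].
case/andP=> v_gt0 Fv ->; exists (v, parent e r v) => //.
by rewrite inE outputE // Fv andbT eqb0 negbK /= ltn_ord v_gt0 parent_natE eqxx.
Qed.

(** ** Correctness of the preprocessing *)

Lemma iterate_fill_frame m A N phi (d : tables R) B j : (B != A) || (N <= j) ->
  btab (iterate m (fun _ => fill_btab A N phi) d) B j = btab d B j.
Proof.
move=> outside; elim: m => [//|m IH]; rewrite iterateS /= -IH.
by case: eqP outside => //= -> le; rewrite ltnNge le.
Qed.

Lemma index_decomp j : j < n * n -> exists v (x : 'I_n), v < n /\ j = v * n + x.
Proof.
move=> jn; have mod_lt : j %% n < n by rewrite ltn_mod fza_n_gt0.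
by exists (j %/ n), (Ordinal mod_lt); split; [rewrite ltn_divLR ?fza_n_gt0|exact: divn_eq].
Qed.

Lemma annotated_out A j : A = distance_array \/ A = ancestor_array -> n * n <= j -> st A j = 0.
Proof. by case=> -> le; rewrite [LHS]/(nat_of_bool (_ && _)) ltnNge le. Qed.

Lemma distance_tableE x (d : tables R) j : (forall j, btab d distance_array j = false) ->
  (btab (distance_table (with_coins st x) d) distance_array j : nat) = st distance_array j.
Proof.
move=> d0; rewrite /distance_table; set body := fun _ => _.
have entry m t (v : 'I_n) : t < m -> t < n ->
    btab (iterate m body d) distance_array (t * n + v) = within e r t v.
  elim: m t v => // m IH t v tm tn; rewrite iterateS /= [bound_val _ _]/(n * n).
  rewrite ltn_index // divn_index // modn_index //.
  case: t tm tn => [|t] tm tn //=; rewrite subn1 /= IH //; last exact: ltnW.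
  congr orb; apply/hasNP/existsP => [[w wn]|[w /andP[wv tw]]].
    rewrite -[w]/(val (Ordinal wn)) annotated_adjacency IH ?(ltnW tn) // => h.
    by exists (Ordinal wn).
  by exists w => //; rewrite annotated_adjacency wv IH // ltnW.
have [/index_decomp[t [v [tn ->]]]|le] := ltnP j (n * n).
  by rewrite annotated_distance // entry.
by rewrite iterate_fill_frame ?annotated_out ?d0 ?le ?orbT //; left.
Qed.

Lemma ancestor_tableE x (d : tables R) j : (forall j, btab d ancestor_array j = false) ->
  (btab (ancestor_table (with_coins st x) d) ancestor_array j : nat) = st ancestor_array j.
Proof.
move=> d0; rewrite /ancestor_table; set body := fun _ => _.
have entry m u v : u < n -> v < n -> dep v < m ->
    btab (iterate m body d) ancestor_array (u * n + v) = anc T u v.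
  elim: m u v => // m IH u v un vn dm; rewrite iterateS [btab _ _ _]/= [bound_val _ _]/(n * n).
  rewrite ltn_index // divn_index // modn_index // [parent_of _]annotated_parent.
  case: (eqVneq u v) => [->|ne]; first by rewrite (anc_refl rT).
  rewrite orFb; apply/hasNP/idP => [[p pn /andP[vp]]|uv].
    rewrite IH //; last by rewrite -ltnS -(child_dep rT vp).
    by move=> up; exact: (anc_trans rT up (child_anc rT vp)).
  have vp := anc_neq_child rT uv ne; exists (par v); first exact: (rooted_par_lt rT).
  rewrite vp IH ?(anc_to_par rT uv) ?(rooted_par_lt rT) //.
  by have := child_dep rT vp; lia.
have [/index_decomp[u [v [un ->]]]|le] := ltnP j (n * n).
  by rewrite annotated_ancestor // entry ?(rooted_dep_lt rT).
by rewrite iterate_fill_frame ?annotated_out ?d0 ?le ?orbT //; right.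
Qed.

Lemma annotated_bounded x : bounded_input (input_size I) (with_coins st x).
Proof.
have size_ge : n ^ 2 * k.+1 <= input_size I by exact: leq_addr.
have k_lt : k < input_size I.
  by apply: leq_trans size_ge; rewrite leq_pmull // expn_gt0 fza_n_gt0.
have n_le : n <= input_size I.
  apply: leq_trans size_ge; rewrite -[n in n <= _]muln1 leq_mul //.
  by rewrite -mulnn leq_pmull // fza_n_gt0.
have le_pow m : m <= input_size I -> m <= 2 ^ input_size I.
  by move=> le; apply: leq_trans le _; exact: ltnW (ltn_expl _ _).
have le_bool (c : bool) : c <= 2 ^ input_size I.
  by apply: leq_trans (leq_b1 c) _; rewrite expn_gt0.
have le_bitlen (i : 'I_k) m : bitlen m <= bitlen (fza_u i) + bitlen (fza_w i) ->
    m <= 2 ^ input_size I.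
  move=> le; apply: (@leq_trans (2 ^ bitlen m)); first by rewrite ltnW // /bitlen trunc_log_ltn.
  rewrite leq_exp2l //; apply: leq_trans le _; apply: leq_trans (leq_addl _ _).
  by rewrite (bigD1 i) //= leq_addr.
split=> //; [exact: leq_ltn_trans k_lt|exact: ltnW|move=> A j].
rewrite /with_coins; case: eqP => // _.
case: A => [|[|[|[|[|[|[|[|[|[|[|[|A]]]]]]]]]]]] //=; try exact: le_bool.
- by case: j => [|[|j]] //; apply: le_pow => //; exact: ltnW.
- by case: insubP => // i _ _; apply: (le_bitlen i); exact: leq_addr.
- by case: insubP => // i _ _; apply: (le_bitlen i); exact: leq_addl.
Qed.

End Instance.

(** * The whole program *)

Definition flip_coins := CFor BSize 0 (CFlip coin_array (AGet loop_vars (ANat 0))).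

Lemma represents_next (R : realType) lim (st : memory nat) (d : tables R) (s : state R) :
  (forall j, (btab d lim j : nat) = st lim j) ->
  represents lim st d s -> represents lim.+1 st d s.
Proof.
move=> dE [rn rr]; split=> // A j nsA; rewrite rn // /writable.
case: (A =P output_array) => //= _; rewrite leq_eqVlt.
by case: (lim =P A) => [<-|] //=; rewrite ltnn dE.
Qed.

Section Run.
Variables (R : realType) (I : fza R).
Local Notation n := (fza_n I).
Local Notation f := (@fza_f R I).
Implicit Types r : seq bool.

Definition coin_memory r := with_coins (annotated_input I) (fun j => (j < n) && nth false r j).

Definition no_tables : tables R := Tables (fun _ _ => false) (fun _ _ => 0%R).

Definition with_distances r := distance_table (coin_memory r) no_tables.

Definition preprocessed r := ancestor_table (coin_memory r) (with_distances r).

Definition solution r : {set {set 'I_n}} :=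
  parent_edges I (btab (best_search f (coin_memory r) (preprocessed r)) best_array).

Lemma runs_flip_coins r : n <= size r ->
  runs f flip_coins (init_state I r) (n.+1 * (6 * n + 57))
    (represents distance_array (coin_memory r) no_tables).
Proof.
move=> nr; pose Inv x (s : state R) := [/\ nmem s loop_vars 0 = x, coins s = drop x r,
  rmem s = (fun _ _ => 0%R) & forall A j, A != loop_vars ->
    nmem s A j = if A == coin_array then (j < x) && nth false r j : nat else input_nmem I A j].
apply: (runs_weak _ _
  (runs_for (b := BSize) (N := n) (Inv := Inv) (Tc := n + 5) (Tb := n + 2) _ _ _)).
- by rewrite leq_mul //; lia.
- move=> s [_ _ r0 memE]; split=> [A j nsA|A j _]; last by rewrite r0.
  have A7 : A != loop_vars by apply: contraNneq nsA => ->.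
  rewrite memE // /coin_memory /with_coins; case: (A =P coin_array) => [->//|A8].
  by move: A nsA A7 A8; do 13?case=> //.
- move=> x s xn [x7 _ _ memE]; split=> //=; rewrite memE //=.
  by have := bitlen_leS n; have := bitlen_leS 0; lia.
- move=> x s xn [x7 coinsE r0 memE]; eexists _, _; split.
  + by apply: ExecFlip; rewrite coinsE (drop_nth false) // (leq_trans xn nr).
  + by rewrite /= x7; have := bitlen_leS x; have := bitlen_leS 0; lia.
  split=> //; split=> //= A j A7; rewrite /upd (negPf A7) /= x7.
  case: (A =P coin_array) => [->|A8] /=; last by rewrite memE //; case: eqP.
  by rewrite ltnS leq_eqVlt; case: eqP => [->//|_] /=; rewrite memE.
split; rewrite ?drop0 //= => A j A7; rewrite /upd (negPf A7) /=.
by case: eqP => [->|].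
Qed.

Lemma with_distancesE r j :
  (btab (with_distances r) distance_array j : nat) = coin_memory r distance_array j.
Proof. exact: distance_tableE. Qed.

Lemma preprocessedE r j :
  (btab (preprocessed r) ancestor_array j : nat) = coin_memory r ancestor_array j.
Proof. by apply: ancestor_tableE => j'; rewrite iterate_fill_frame. Qed.

Lemma output_solution r (s : state R) :
  represents search_arrays (coin_memory r) (write_output (coin_memory r)
    (best_search f (coin_memory r) (preprocessed r))) s -> output_set I s = solution r.
Proof.
case=> rn _; apply: output_parent_edges => v w vn wn; rewrite rn // write_outputE //.
by rewrite -(annotated_parent I).
Qed.

End Run.

Lemma program_ex (R : realType) : exists (c : cmd) (a : nat), forall I : fza R,
  let T := a * input_size I ^ a in
  fza_n I <= T /\ computes_within (I := I) c (fun r : T.-tuple bool => solution I r).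
Proof.
have no_loc (i : nat) : i < 0 -> 0 < 0 by [].
have [c1 [T1 [p1 run1]]] := @definable_distance_table R (fun=> 0) 0 no_loc.
have [c2 [T2 [p2 run2]]] := @definable_ancestor_table R (fun=> 0) 0 no_loc.
have [c3 [T3 [p3 run3]]] := @definable_search R (fun=> 0) 0 no_loc.
have [a le_a] : poly_bounded (fun X => 3 + X.+1 * (6 * X + 57) + T1 X + T2 X + T3 X + X).
  by solve_poly_bounded.
exists (CSeq flip_coins (CSeq c1 (CSeq c2 c3))), a => I T; set X := input_size I.
have bounded r : bounded_input X (coin_memory I r) by exact: annotated_bounded.
have [X_gt0 n_le _ _] := bounded [::]; have {}le_a := le_a X X_gt0; rewrite -/T in le_a.
have nT : fza_n I <= T by apply: leq_trans le_a; apply: leq_trans n_le _; exact: leq_addl.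
split=> // r; pose st := Env (coin_memory I r) (fza_f I).
have valid0 lim d (s : state R) :
    represents lim st d s -> valid X lim st d (fun=> 0) (tt : ctx 0) s.
  by move=> rs; split=> //; exact: bounded.
have search s0 : represents distance_array st (no_tables R) s0 ->
    runs (fza_f I) (CSeq c1 (CSeq c2 c3)) s0 (1 + T1 X + (1 + T2 X + T3 X))
      (fun s => output_set I s = solution I r).
  move=> r0; apply: (runs_seq (run1 X st _ _ s0 (valid0 _ _ _ r0))) => s1 [_ r1].
  have {}r1 := represents_next (lim := distance_array) (with_distancesE I r) r1.
  apply: (runs_seq (run2 X st _ _ s1 (valid0 _ _ _ r1))) => s2 [_ r2].
  have {}r2 := represents_next (lim := ancestor_array) (preprocessedE I r) r2.
  apply: (runs_weak (leqnn _) _ (run3 X st _ _ s2 (valid0 _ _ _ r2))) => s3 [_ r3].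
  exact: output_solution.
have nr : fza_n I <= size r by rewrite size_tuple.
have [t [s [run le_t outputE]]] := runs_seq (runs_flip_coins nr) search.
exists t, s; split=> //; apply: leq_trans le_t _; apply: leq_trans le_a.
have : (fza_n I).+1 * (6 * fza_n I + 57) <= X.+1 * (6 * X + 57).
  by rewrite leq_mul // leq_add2r leq_mul2l n_le.
by lia.
Qed.

Lemma concave_subadditive (R : realDomainType) (f : nat -> R) : (0 <= f 0)%R ->
  (forall j, f j.+2 - f j.+1 <= f j.+1 - f j)%R -> forall i j, (f (i + j)%N <= f i + f j)%R.
Proof.
move=> f0_ge0 concave; have increment i j : (f (i + j).+1 - f (i + j)%N <= f i.+1 - f i)%R.
  by elim: j => [|j IH]; rewrite ?addn0 // addnS; apply: le_trans (concave _) IH.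
move=> i j; suff : (f (i + j)%N - f i <= f j - f 0)%R by lra.
elim: i => [|i IH]; first by rewrite add0n.
by have := increment i j; rewrite addSn; lra.
Qed.

Lemma opt_le_expectation (R : realType) (I : fza R) T : fza_n I <= T ->
  (opt I / (approx_ratio (fza_n I))%:R <=
   coin_expectation (fun r : T.-tuple bool => revenue (solution I r)))%R.
Proof.
move=> nT; have f_ge0 := @fza_f_ge0 R I; have n_gt0 := fza_n_gt0 I.
have f_sub := concave_subadditive (f_ge0 0) (@fza_f_concave R I).
have [top [left [right input]]] := annotated_rooted I.
rewrite ler_pdivrMr ?ltr0n // mulrC /coin_expectation mulrA.
apply: Order.POrderTheory.bigmax_le => [|F FE].
  rewrite divr_ge0 ?exprn_ge0 // mulr_ge0 // sumr_ge0 // => r _.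
  by rewrite revenue_parent_edges; apply: sumr_ge0 => i _; exact: commodity_revenue_ge0.
rewrite ler_pdivlMr ?exprn_gt0 // [leLHS]mulrC revenue_lower_ends.
have := average_bound f_ge0 (@fza_f_nondecreasing R I) f_sub input (lower_ends F) n_gt0
  (branching_gt1 n_gt0) (branching_lt n_gt0) (branching_codes n_gt0) nT
  (fun r => preprocessed I r).
move/le_trans; apply.
by rewrite ler_wpM2l //; apply: ler_sum => r _; rewrite revenue_parent_edges.
Qed.

Local Open Scope classical_set_scope.
Local Open Scope ring_scope.

Theorem theorem3 (R : realType) :
  exists (c : cmd) (a d : nat) (alpha : nat -> R),
    [/\ forall n : nat, 0 < alpha n,
        alpha =O_\oo (fun n : nat => ln n%:R / ln (ln n%:R) : R)
      & forall I : fza R,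
          let T := (a * input_size I ^ d)%N in
          exists F : T.-tuple bool -> {set {set 'I_(fza_n I)}},
            [/\ computes_within (I := I) c F,
                forall r : T.-tuple bool, F r \subset fza_E I
              & opt I / alpha (fza_n I)
                  <= coin_expectation (fun r : T.-tuple bool => revenue (F r))]].
Proof.
have [c [a computes]] := program_ex R.
exists c, a, a, (fun n => (approx_ratio n)%:R); split.
- by move=> n; rewrite ltr0n.
- exact: approx_ratio_eqO.
move=> I T; have [nT cF] := computes I.
exists (fun r => solution I r); split=> // [r|]; first exact: parent_edges_sub.
exact: opt_le_expectation.
Qed.
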